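(* Suppose that $P\to M$ is a $GN$-structure on a smooth manifold $M$ and let $\lambda$ be its associated null-distribution. Given a metric $g$ belonging to $P$, a vector field $X$ is an infinitesimal automorphism of $P$ if and only if $X$ is an algebra preserving nil-Killing vector field with respect to $(M,g,\lambda)$.
   Context: **The group $GN$.** On $\mathbb{R}^n$, $n=\dim M$, rename the standard basis $\{k,l,m_1,\dots,m_{n-2}\}$ and let $\eta$ be the Minkowski inner product with $\eta(k,l)=1$, $\eta(m_i,m_j)=\delta_{ij}$ and all other products of basis vectors zero. $GN\subset GL(n,\mathbb{R})$ is the Lie group of invertible linear maps $f$ with (1) $f(k)\in\mathbb{R}k$; (2) $\eta(f(w),f(\tilde w))=\eta(w,\tilde w)$ for all $w,\tilde w\in\{k\}^\perp$; (3) $\eta(f(k),f(z))=\eta(k,z)$ for all $z\in\mathbb{R}^n$. Let $Sim(n-2)=\{f\in\mathcal{O}(1,n-1): f(k)\in\mathbb{R}k\}=GN\cap\mathcal{O}(1,n-1)$, where $\mathcal{O}(1,n-1)$ is the orthogonal group of $\eta$. **$GN$-structures.** A $GN$-structure $P\to M$ is a principal $GN$-subbundle of the frame bundle of $M$ (fibres over $x$ are subsets of $GL(\mathbb{R}^n,T_xM)$). It determines distributions $\lambda_x=u(\mathbb{R}k)$ and $\Lambda_x=u(\{k\}^\perp)$ ($u\in P_x$ arbitrary), of dimension $1$ and codimension $1$, with $\lambda\subset\Lambda$. **Metrics belonging to $P$.** A Lorentzian metric $g$ on $M$ belongs to $P$ if there is a principal $Sim(n-2)$-subbundle $Q\subset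 P$ such that $g(u(v),u(w))=\eta(v,w)$ for all $u\in Q$, $v,w\in\mathbb{R}^n$. For such $g$, $\lambda$ is null and $\lambda^\perp=\Lambda$. **Infinitesimal automorphisms.** A diffeomorphism is an automorphism of $P$ if the action of its derivative on frames maps $P$ into itself. A vector field is an infinitesimal automorphism of $P$ if its (local) flow maps preserve $P$ in this sense. **Algebra preserving nil-Killing.** For a Lorentzian manifold $(M,g)$ with a null (one-dimensional) distribution $\lambda$, a vector field $X$ is nil-Killing w.r.t. $\lambda$ if $\mathcal{L}_Xg$ is of type $III$ w.r.t. $\lambda$, i.e. $\mathcal{L}_Xg(Y,Z)=0$ and $\mathcal{L}_Xg(W,\tilde W)=0$ for all $Y\in\lambda$, $Z\in TM$, $W,\tilde W\in\lambda^\perp$. It is algebra preserving if in addition $[X,\lambda]\subset\lambda$. *)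

(* Defs.v *)
From HB Require Import structures.
From mathcomp Require Import all_boot all_order all_algebra.
From mathcomp Require Import all_classical all_reals all_analysis.

Set Implicit Arguments.
Unset Strict Implicit.
Unset Printing Implicit Defensive.

Import Order.TTheory GRing.Theory Num.Theory.
Import numFieldNormedType.Exports.

Local Open Scope classical_set_scope.
Local Open Scope ring_scope.

(* [V] is meant to be finite-dimensional and [A] open; there, [f] is C^(k+1)
   on [A] iff it is Fréchet differentiable with all [x |-> 'd f x v] of class
   C^k on [A]. *)
Fixpoint Ck_on (R : realType) (V W : normedModType R) (k : nat) (A : set V)
    (f : V -> W) : Prop :=
  match k with
  | 0%N => forall x, A x -> {for x, continuous f}
  | k'.+1 => (forall x, A x -> differentiable f x) /\
             (forall v, Ck_on k' A (fun x => 'd f x v))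
  end.

Definition smooth_on (R : realType) (V W : normedModType R) (A : set V)
    (f : V -> W) : Prop :=
  forall k, Ck_on k A f.

(* [chart_fun] and [chart_inv] are total functions whose values outside
   [chart_src], resp. [chart_tgt], are irrelevant. *)
Record chart (R : realType) (n : nat) (M : topologicalType) := Chart {
  chart_src : set M ;
  chart_tgt : set 'rV[R]_n ;
  chart_fun :> M -> 'rV[R]_n ;
  chart_inv : 'rV[R]_n -> M ;
  chart_src_open : open chart_src ;
  chart_tgt_open : open chart_tgt ;
  chart_fun_tgt : forall x, chart_src x -> chart_tgt (chart_fun x) ;
  chart_inv_src : forall y, chart_tgt y -> chart_src (chart_inv y) ;
  chart_funK : forall x, chart_src x -> chart_inv (chart_fun x) = x ;
  chart_invK : forall y, chart_tgt y -> chart_fun (chart_inv y) = y ;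
  chart_fun_cont : forall x, chart_src x -> {for x, continuous chart_fun} ;
  chart_inv_cont : forall y, chart_tgt y -> {for y, continuous chart_inv}
}.

(* The image under the chart [c] of the part of [U] covered by [c]. *)
Definition chart_dom (R : realType) (n : nat) (M : topologicalType)
    (c : chart R n M) (U : set M) : set 'rV[R]_n :=
  chart_tgt c `&` chart_inv c @^-1` U.

(* [chart_at] selects, for every point, one chart of the atlas around it; its
   only role is to provide a model of the tangent spaces, see [tangent]. *)
Record smoothManifold (R : realType) (n : nat) := SmoothManifold {
  manifold_sort :> topologicalType ;
  manifold_hausdorff : hausdorff_space manifold_sort ;
  manifold_second_countable : @second_countable manifold_sort ;
  atlas : set (chart R n manifold_sort) ;
  chart_at : manifold_sort -> chart R n manifold_sort ;
  chart_at_atlas : forall x, atlas (chart_at x) ;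
  chart_at_src : forall x, chart_src (chart_at x) x ;
  atlas_compat : forall c c', atlas c -> atlas c' ->
    smooth_on (chart_dom c (chart_src c')) (c' \o chart_inv c)
}.

(* T_xM, a tangent vector being represented by its row of components in the
   chart [chart_at x]; components in any other chart around [x] are obtained
   through [chart_change]. *)
Definition tangent (R : realType) (n : nat) (M : smoothManifold R n) (x : M)
    : Type := 'rV[R]_n.

Definition vector_field (R : realType) (n : nat) (M : smoothManifold R n) :=
  forall x : M, tangent x.

Definition distribution (R : realType) (n : nat) (M : smoothManifold R n) :=
  forall x : M, set (tangent x).

(* GL(R^n, T_xM) is the set of invertible matrices: [u : 'M_n] stands for the
   linear map [v |-> v *m u] from R^n to T_xM, so that row [i] of [u] is the
   [i]-th vector of the frame, and the right action [u \o f] of a linear map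
   [f] of R^n (also acting on rows) is the matrix [f *m u]. *)
Definition frame_set (R : realType) (n : nat) (M : smoothManifold R n) :=
  M -> set 'M[R]_n.

(* A field of bilinear forms, [g x] being the Gram matrix on [tangent x]. *)
Definition tensor02 (R : realType) (n : nat) (M : smoothManifold R n) :=
  M -> 'M[R]_n.

Definition bform (R : realType) (n : nat) (G : 'M[R]_n) (v w : 'rV[R]_n) : R :=
  (v *m G *m w^T) 0 0.

(* Multiplying a row of components in [c] by [chart_change c c' x] gives the
   components in [c'] of the same tangent vector at [x]. *)
Definition chart_change (R : realType) (n : nat) (M : topologicalType)
    (c c' : chart R n M) (x : M) : 'M[R]_n :=
  jacobian (c' \o chart_inv c) (c x).

Definition vf_coord (R : realType) (n : nat) (M : smoothManifold R n)
    (X : vector_field M) (c : chart R n M) (y : 'rV[R]_n) : 'rV[R]_n :=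
  let x := chart_inv c y in (X x : 'rV[R]_n) *m chart_change (chart_at x) c x.

Definition tensor_coord (R : realType) (n : nat) (M : smoothManifold R n)
    (g : tensor02 M) (c : chart R n M) (y : 'rV[R]_n) : 'M[R]_n :=
  let x := chart_inv c y in
  let J := chart_change c (chart_at x) x in J *m g x *m J^T.

Definition smooth_vf (R : realType) (n : nat) (M : smoothManifold R n)
    (U : set M) (X : vector_field M) : Prop :=
  forall c, atlas c -> smooth_on (chart_dom c U) (vf_coord X c).

Definition smooth_frame (R : realType) (n : nat) (M : smoothManifold R n)
    (U : set M) (s : M -> 'M[R]_n) : Prop :=
  forall i, smooth_vf U (fun x => row i (s x) : tangent x).

(* The derivative of [f] at [x], as a matrix acting on rows from T_xM to
   T_(f x)M. *)
Definition tangent_map (R : realType) (n : nat) (M : smoothManifold R n)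
    (f : M -> M) (x : M) : 'M[R]_n :=
  jacobian (chart_at (f x) \o f \o chart_inv (chart_at x)) (chart_at x x).

Definition lie_bracket (R : realType) (n : nat) (M : smoothManifold R n)
    (X Y : vector_field M) : vector_field M := fun x =>
  let c := chart_at x in
  'd (vf_coord Y c) (c x) (X x) - 'd (vf_coord X c) (c x) (Y x).

(* In the coordinates of [chart_at x], with J the matrix of partial derivatives
   J i k = d_i X^k:
   (L_X g) i j = X^k (d_k g i j) + (d_i X^k) g k j + (d_j X^k) g i k. *)
Definition lie_derivative (R : realType) (n : nat) (M : smoothManifold R n)
    (X : vector_field M) (g : tensor02 M) : tensor02 M := fun x =>
  let c := chart_at x in
  let J := jacobian (vf_coord X c) (c x) in
  'd (tensor_coord g c) (c x) (X x) + J *m g x + g x *m J^T.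

Definition lorentzian_metric (R : realType) (n : nat) (M : smoothManifold R n)
    (g : tensor02 M) : Prop :=
  [/\ forall c, atlas c -> smooth_on (chart_dom c setT) (tensor_coord g c),
      forall x, (g x)^T = g x &
      forall x, exists2 u : 'M[R]_n, u \in unitmx &
        u *m g x *m u^T = diag_mx (\row_i (if i == 0%N :> nat then -1 else 1))].

(* [Q] is a principal [G]-subbundle of the frame bundle, for [G] a closed
   subgroup of GL(R^n): each fibre is an orbit of [G] in the set of frames, and
   [Q] has smooth local sections (equivalently, local trivializations). *)
Definition principal_subbundle (R : realType) (n : nat)
    (M : smoothManifold R n) (G : set 'M[R]_n) (Q : frame_set M) : Prop :=
  [/\ forall x u, Q x u -> u \in unitmx,
      forall x u f, Q x u -> G f -> Q x (f *m u),
      forall x u u', Q x u -> Q x u' -> exists2 f, G f & u' = f *m u &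
      forall x, exists U (s : M -> 'M[R]_n),
        [/\ open U, U x, smooth_frame U s & forall y, U y -> Q y (s y)]].

(* The basis (k, l, m_1, ..., m_d) of R^(d+2) is the standard one, in this
   order. *)
Definition kvec (R : realType) (d : nat) : 'rV[R]_d.+2 := delta_mx 0 0.

Definition eta_mx (R : realType) (d : nat) : 'M[R]_d.+2 :=
  \matrix_(i, j)
    (if (i < 2)%N then ((i + j)%N == 1%N)%:R else (i == j)%:R).

Definition eta (R : realType) (d : nat) : 'rV[R]_d.+2 -> 'rV[R]_d.+2 -> R :=
  bform (eta_mx R d).

Definition kperp (R : realType) (d : nat) : set 'rV[R]_d.+2 :=
  [set w | eta (kvec R d) w = 0].

Definition preserves_kline (R : realType) (d : nat) (f : 'M[R]_d.+2) : Prop :=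
  exists a : R, kvec R d *m f = a *: kvec R d.

Definition GN (R : realType) (d : nat) : set 'M[R]_d.+2 :=
  [set f | [/\ f \in unitmx,
      preserves_kline f,
      forall w w', kperp w -> kperp w' -> eta (w *m f) (w' *m f) = eta w w' &
      forall z, eta (kvec R d *m f) (z *m f) = eta (kvec R d) z]].

Definition O1 (R : realType) (d : nat) : set 'M[R]_d.+2 :=
  [set f | f \in unitmx /\ forall v w, eta (v *m f) (w *m f) = eta v w].

Definition Sim (R : realType) (d : nat) : set 'M[R]_d.+2 :=
  [set f | O1 f /\ preserves_kline f].

Definition GN_structure (R : realType) (d : nat) (M : smoothManifold R d.+2)
    (P : frame_set M) : Prop :=
  principal_subbundle (@GN R d) P.

Definition null_distribution (R : realType) (d : nat)
    (M : smoothManifold R d.+2) (P : frame_set M) : distribution M := fun x =>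
  [set v | exists2 u, P x u & exists a : R, v = (a *: kvec R d) *m u].

Definition metric_belongs (R : realType) (d : nat) (M : smoothManifold R d.+2)
    (g : tensor02 M) (P : frame_set M) : Prop :=
  lorentzian_metric g /\
  exists Q : frame_set M,
    [/\ principal_subbundle (@Sim R d) Q,
        forall x, Q x `<=` P x &
        forall x u v w, Q x u -> bform (g x) (v *m u) (w *m u) = eta v w].

Definition orthogonal (R : realType) (n : nat) (M : smoothManifold R n)
    (g : tensor02 M) (lam : distribution M) : distribution M := fun x =>
  [set w | forall v, lam x v -> bform (g x) v w = 0].

Definition nil_killing (R : realType) (n : nat) (M : smoothManifold R n)
    (g : tensor02 M) (lam : distribution M) (X : vector_field M) : Prop :=
  forall x,
    (forall Y Z : tangent x, lam x Y -> bform (lie_derivative X g x) Y Z = 0) /\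
    (forall W W' : tangent x, orthogonal g lam W -> orthogonal g lam W' ->
       bform (lie_derivative X g x) W W' = 0).

Definition bracket_preserves (R : realType) (n : nat) (M : smoothManifold R n)
    (lam : distribution M) (X : vector_field M) : Prop :=
  forall (U : set M) (Y : vector_field M), open U -> smooth_vf U Y ->
    (forall x, U x -> lam x (Y x)) ->
    forall x, U x -> lam x (lie_bracket X Y x).

Definition algebra_preserving_nil_killing (R : realType) (n : nat)
    (M : smoothManifold R n) (g : tensor02 M) (lam : distribution M)
    (X : vector_field M) : Prop :=
  nil_killing g lam X /\ bracket_preserves lam X.

(* Only the values [phi t x] for [a < t < b] and [x] in [U] matter. Continuity
   makes the sets on which smoothness of the coordinate expressions is required
   open. *)
Definition local_flow (R : realType) (n : nat) (M : smoothManifold R n)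
    (X : vector_field M) (a b : R) (U : set M) (phi : R -> M -> M) : Prop :=
  [/\ a < 0 < b,
      open U,
      forall x, U x -> phi 0 x = x,
      forall t x, a < t < b -> U x ->
        is_derive t (1 : R) (fun s => chart_at (phi t x) (phi s x))
                  (X (phi t x) : 'rV[R]_n) &
      (forall t x, a < t < b -> U x ->
        {for (t, x), continuous (fun p : R * M => phi p.1 p.2)}) /\
      (forall c c', atlas c -> atlas c' ->
        smooth_on
          [set p : R * 'rV[R]_n | [/\ a < p.1 < b, chart_dom c U p.2 &
             chart_src c' (phi p.1 (chart_inv c p.2))]]
          (fun p : R * 'rV[R]_n => c' (phi p.1 (chart_inv c p.2))))].

Definition maps_frames_into (R : realType) (n : nat) (M : smoothManifold R n)
    (P : frame_set M) (U : set M) (f : M -> M) : Prop :=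
  forall x u, U x -> P x u -> P (f x) (u *m tangent_map f x).

Definition infinitesimal_automorphism (R : realType) (n : nat)
    (M : smoothManifold R n) (P : frame_set M) (X : vector_field M) : Prop :=
  forall a b U phi, local_flow X a b U phi ->
    forall t, a < t < b -> maps_frames_into P U (phi t).

(* Main.v *)
From HB Require Import structures.
From mathcomp Require Import all_boot all_order all_algebra.
From mathcomp Require Import all_classical all_reals all_analysis.
From mathcomp Require Import ring lra.
(* Last, so that [eta] is not the eta-expansion of ssrfun. *)
Require Import Defs.

(* Let [s] be a local section of [Q], so that [s g s^T = eta], and write
   [[X, s_i] = sum_j K_ij s_j]. Then [s (L_X g) s^T = -(K eta + eta K^T)], and
   [X] preserves [lambda] iff the first row of [K] is a multiple of [k]; thus
   [X] is algebra preserving nil-Killing iff [K] takes its values in the Lie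
   algebra [gn] of [GN]. On the other hand a frame carried along the flow of [X]
   has coordinates [H] with respect to [s] satisfying [H' = - H K].

   If [K] is in [gn], then [(k H^-1)' = k K H^-1] is a multiple of [k H^-1],
   which thus stays in [R k], after which the functions of [H] defining [GN] have
   zero derivative; hence [H] stays in [GN] along the connected time interval.
   The converse follows by differentiating [H] at time 0, once local flows are
   known to exist. They are obtained by Picard iteration for the field clamped to
   a box; Gronwall's lemma gives differentiability in the initial value, and the
   derivative is again a family of integral curves, of the tangent field, whence
   smoothness by induction. *)

Set Implicit Arguments.
Unset Strict Implicit.
Unset Printing Implicit Defensive.

Import Order.TTheory GRing.Theory Num.Theory.
Import numFieldNormedType.Exports.

Local Open Scope classical_set_scope.
Local Open Scope ring_scope.

(** * Functions of class C^k *)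

(** Tangent spaces are modelled through [chart_at], which may jump from point to point, so neither
    [tangent_map (phi t) x] nor [s (phi t x)] need be continuous in [t]. Only their quotient [H], in
    which the changes of chart cancel, can be differentiated. Its equation involves the time
    derivative of the space derivative of a flow, whence the need for joint smoothness and for the
    symmetry of second derivatives. A local flow comes without a group law, since [phi t x] may
    leave [U]; invertibility of the derivatives of the flow maps is therefore obtained from
    Gronwall's lemma and connectedness instead of from inverse flow maps. Clamping turns a field
    that is Lipschitz on a box into a globally Lipschitz one, so Picard iterates are defined and
    converge for all times, and no shrinking domains have to be tracked. The clamp is invisible
    while a curve stays in the box. The condition that [k H] is a multiple of [k] is treated on
    [H^-1]: there [K] acts from the left and merely rescales the first row, whereas the equation for
    [k H] closes up only once the claim is known. *)

Section Ck.
Context {R : realType}.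
Implicit Types V W Z : normedModType R.

(** The expansion that characterises the differential depends only on the germ of the function;
    [diff_unique] then identifies ['d g x], which is defined by a choice. *)
Lemma near_is_diff V W (f g df : V -> W) (x : V) :
  (\near x, f x = g x) -> is_diff x f df -> is_diff x g df.
Proof.
move=> fg [df1 <-]; have fgx := nbhs_singleton fg.
have E : g \o shift x = cst (g x) + 'd f x +o_ 0 id.
  apply/eqaddoP => _/posnumP[e].
  have /eqaddoP /(_ e%:num [gt0 of e%:num]) := diff_locally df1.
  have {}fg : \forall h \near 0, f (h + x) = g (h + x).
    by move: fg; rewrite (near_shift 0) /=; apply: filterS => y; rewrite /= subr0.
  apply: filter_app; near=> h => /=.
  rewrite -[(_ \o _ - _) h]/(f (h + x) - (f x + 'd f x h)).
  rewrite -[(_ \o _ - _) h]/(g (h + x) - (g x + 'd f x h)).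
  by rewrite -fgx; have -> : f (h + x) = g (h + x) by near: h.
have dg := diff_unique (diff_continuous df1) E.
split => //; apply/diff_locallyP; rewrite dg; split => //.
exact: diff_continuous.
Unshelve. all: by end_near. Qed.

Lemma near_differentiable V W (f g : V -> W) (x : V) :
  (\near x, f x = g x) -> differentiable f x -> differentiable g x.
Proof. by move=> fg /differentiableP /(near_is_diff fg) []. Qed.

Lemma near_diff V W (f g : V -> W) (x : V) :
  (\near x, f x = g x) -> differentiable f x -> 'd g x = 'd f x :> (V -> W).
Proof. by move=> fg /differentiableP /(near_is_diff fg) []. Qed.

Lemma open_near V (A : set V) x : open A -> A x -> \forall y \near x, A y.
Proof. by move=> oA Ax; apply: open_nbhs_nbhs. Qed.

Lemma open_nearS V (A P : set V) x : open A -> A x ->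
  (forall y, A y -> P y) -> \forall y \near x, P y.
Proof. by move=> oA Ax H; apply: filterS H _; exact: open_near. Qed.

Lemma Ck_ext V W k (A : set V) (f g : V -> W) : open A ->
  (forall x, A x -> f x = g x) -> Ck_on k A f -> Ck_on k A g.
Proof.
move=> oA; elim: k f g => [|k IH] f g fg /=.
  move=> cf x Ax; have {}cf := cf x Ax; rewrite /prop_for /continuous_at in cf *;
 rewrite -(fg x Ax).
  apply: cvg_trans cf; apply: near_eq_cvg.
  by apply: filterS (open_near oA Ax) => y; apply: fg.
have fgx x : A x -> \forall y \near x, f y = g y.
  by move=> Ax; apply: filterS (open_near oA Ax) => y; apply: fg.
move=> [df Cdf]; split => [x Ax|v].
  exact: near_differentiable (fgx x Ax) (df x Ax).
apply: (IH (fun x => 'd f x v)) => // x Ax.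
by rewrite (near_diff (fgx x Ax) (df x Ax)).
Qed.

Lemma Ck_sub V W k (A B : set V) (f : V -> W) : B `<=` A ->
  Ck_on k A f -> Ck_on k B f.
Proof.
move=> BA; elim: k f => [|k IH] f /=; first by move=> cf x /BA; exact: cf.
by move=> [df Cdf]; split => [x /BA|v]; [exact: df|exact: IH].
Qed.

Lemma Ck_succ V W k (A : set V) (f : V -> W) : Ck_on k.+1 A f <->
  (forall x, A x -> differentiable f x) /\
  (forall v, Ck_on k A (fun x => 'd f x v)).
Proof. by []. Qed.

Lemma Ck_S V W k (A : set V) (f : V -> W) : Ck_on k.+1 A f -> Ck_on k A f.
Proof.
elim: k f => [|k IH] f /= [df Cdf].
  by move=> x Ax; exact/differentiable_continuous/df.
by split => // v; apply: IH (Cdf v).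
Qed.

(** The introduction rule of the regularity proofs below: an explicit formula [df] replaces the
    chosen ['d f x], and its regularity is checked along fixed vectors only. *)
Lemma Ck_diffI V W k (A : set V) (f : V -> W) (df : V -> V -> W) : open A ->
  (forall x, A x -> is_diff x f (df x)) ->
  (forall v, Ck_on k A (df^~ v)) -> Ck_on k.+1 A f.
Proof.
move=> oA Hf Cdf; split => [x /Hf//|v].
by apply: Ck_ext (Cdf v) => // x /Hf H; rewrite diff_val.
Qed.

Lemma Ck_cst V W k (A : set V) (w : W) : Ck_on k A (fun=> w).
Proof.
elim: k w => [|k IH] w /=; first by move=> x _; exact: cst_continuous.
split=> [x _|v]; first exact: differentiable_cst.
rewrite (_ : (fun _ => _) = fun=> 0) //; apply/funext => x.
by rewrite (@diff_cst _ V W w x).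
Qed.

Lemma Ck_lin V W Z k (A : set V) (f : V -> W) (l : {linear W -> Z}) :
  open A -> continuous l -> Ck_on k A f -> Ck_on k A (l \o f).
Proof.
move=> oA cl; elim: k f => [|k IH] f /=.
  by move=> cf x Ax; apply: continuous_comp; [exact: cf|exact: cl].
move=> [df Cdf].
have H x : A x -> is_diff x (l \o f) (l \o 'd f x).
  move=> Ax; apply: is_diff_comp; first exact/differentiableP/df.
  by split; [exact: linear_differentiable|rewrite diff_lin].
by apply: (Ck_diffI oA H) => v; apply: (IH (fun x => 'd f x v)).
Qed.

Lemma Ck_lin1 V W k (A : set V) (l : {linear V -> W}) :
  continuous l -> Ck_on k A l.
Proof.
move=> cl; case: k => [|k]; first by move=> x _; exact: cl.
split=> [x _|v]; first exact: linear_differentiable.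
rewrite (_ : (fun _ => _) = fun=> l v); first exact: Ck_cst.
by apply/funext => x; rewrite diff_lin.
Qed.

Lemma Ck_add V W k (A : set V) (f g : V -> W) :
  open A -> Ck_on k A f -> Ck_on k A g -> Ck_on k A (fun x => f x + g x).
Proof.
move=> oA; elim: k f g => [|k IH] f g /=.
  by move=> cf cg x Ax; apply: cvgD; [exact: cf|exact: cg].
move=> [df Cdf] [dg Cdg].
have H x : A x -> is_diff x (f + g) (('d f x : V -> W) + ('d g x : V -> W)).
  by move=> Ax; apply: is_diffD; apply/differentiableP; [exact: df|exact: dg].
by apply: (Ck_diffI oA H) => v; exact: (IH (fun x => 'd f x v) (fun x => 'd g x v)).
Qed.

Lemma Ck_sum V W k (A : set V) (I : finType) (f : I -> V -> W) :
  open A -> (forall i, Ck_on k A (f i)) ->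
  Ck_on k A (fun x => \sum_i f i x).
Proof.
move=> oA Cf; elim: (index_enum I) => [|i r IH].
  by under eq_fun do rewrite big_nil; exact: Ck_cst.
by under eq_fun do rewrite big_cons; apply: Ck_add.
Qed.

(** Chain rule for the pair [(a, f)] followed by scalar multiplication, which is given its bilinear
    structure on the spot so that [diff_bilin] applies. *)
Lemma is_diff_scale V W (a da : V -> R) (f df : V -> W) x :
  is_diff x a da -> is_diff x f df ->
  is_diff x (fun y => a y *: f y) (fun v => a x *: df v + da v *: f x).
Proof.
move=> Ha Hf.
pose b := [fun (r : R) (w : W) => r *: w].
have bb : bilinear_for (GRing.Scale.Law.clone _ _ *:%R _)
   (GRing.Scale.Law.clone _ _ *:%R _) (fun (r : R) (w : W) => r *: w).
  split=> [w|r] c y z /=; first by rewrite scalerDl scalerA.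
  by rewrite scalerDr !scalerA mulrC.
pose bm := bilinear_isBilinear.Build R R W W _ _ (fun (r : R) (w : W) => r *: w) bb.
pose bl : {bilinear R -> W -> W} := HB.pack (fun (r : R) (w : W) => r *: w) bm.
have cb : continuous (fun p : R * W => bl p.1 p.2).
  by move=> p; exact: scale_continuous.
have Hp := is_diff_pair Ha Hf.
have Hb : is_diff (a x, f x) (fun p : R * W => bl p.1 p.2)
   (fun q => bl (a x) q.2 + bl q.1 (f x)).
  split; first exact: differentiable_bilin.
  by rewrite diff_bilin.
exact: (is_diff_comp Hp Hb).
Qed.

Lemma Ck_scale V W k (A : set V) (a : V -> R) (f : V -> W) :
  open A -> Ck_on k A a -> Ck_on k A f -> Ck_on k A (fun x => a x *: f x).
Proof.
move=> oA; elim: k a f => [|k IH] a f.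
  by move=> ca cf x Ax; apply: cvgZ; [exact: ca|exact: cf].
move=> Ca Cf; have /Ck_succ [df Cdf] := Cf; have /Ck_succ [da Cda] := Ca.
apply: (@Ck_diffI _ _ _ _ _ (fun x v => a x *: 'd f x v + 'd a x v *: f x)) => //.
  by move=> x Ax; apply: is_diff_scale; apply/differentiableP; [exact: da|exact: df].
move=> v; apply: Ck_add => //.
  exact: (IH a (fun x => 'd f x v) (Ck_S Ca)).
exact: (IH (fun x => 'd a x v) f (Cda v) (Ck_S Cf)).
Qed.

(** Finite dimensionality in the form used by the chain rule: a vector is a finite combination of
    fixed vectors with continuous linear coefficients. *)
Definition fin_coord W := exists (I : finType) (e : I -> W) (l : I -> {linear W -> R}),
  (forall i, continuous (l i)) /\ forall w, w = \sum_i l i w *: e i.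

(** In ['d g (f x) ('d f x v)] the direction varies with [x], while [Ck_on] controls ['d g] along
    fixed vectors only. Expanding the direction in coordinates gives a finite sum to which the
    product rule and the induction apply. *)
Lemma Ck_comp V W Z k (A : set V) (B : set W) (f : V -> W) (g : W -> Z) :
  fin_coord W -> open A -> (forall x, A x -> B (f x)) ->
  Ck_on k A f -> Ck_on k B g -> Ck_on k A (g \o f).
Proof.
move=> [I [e [l [cl wE]]]] oA fAB; elim: k f g fAB => [|k IH] f g fAB.
  move=> cf cg x Ax; apply: continuous_comp; first exact: cf.
  exact/cg/fAB.
move=> Cf /Ck_succ [dg Cdg]; have /Ck_succ [df Cdf] := Cf.
apply: (@Ck_diffI _ _ _ _ _
  (fun x v => \sum_i (l i ('d f x v)) *: 'd g (f x) (e i))) => //.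
  move=> x Ax; have := is_diff_comp (differentiableP (df x Ax))
    (differentiableP (dg _ (fAB x Ax))).
  congr (is_diff_def _ _ _); apply/funext => v /=.
  by rewrite {1}(wE ('d f x v)) linear_sum; apply: eq_bigr => i _; rewrite linearZ.
move=> v; apply: Ck_sum => // i; apply: Ck_scale => //.
  exact: (Ck_lin oA (cl i) (Cdf v)).
apply: (IH f (fun y => 'd g y (e i))) => //.
exact: Ck_S.
Qed.

Lemma Ck_pair V W Z k (A : set V) (f : V -> W) (g : V -> Z) :
  open A -> Ck_on k A f -> Ck_on k A g -> Ck_on k A (fun x => (f x, g x)).
Proof.
move=> oA; elim: k f g => [|k IH] f g.
  by move=> cf cg x Ax; apply: cvg_pair; [exact: cf|exact: cg].
move=> /Ck_succ [df Cdf] /Ck_succ [dg Cdg].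
apply: (@Ck_diffI _ _ _ _ _ (fun x v => ('d f x v, 'd g x v))) => //.
  by move=> x Ax; apply: is_diff_pair; apply/differentiableP; [exact: df|exact: dg].
by move=> v; exact: IH.
Qed.

End Ck.

(** * Coordinates, the maximum norm and mean value estimates *)

Section coords.
Context {R : realType}.

Lemma fin_coord_real : fin_coord R.
Proof.
exists unit, (fun=> 1), (fun=> idfun); split=> [_ x //|w].
by rewrite (bigD1 tt) //= big1 ?addr0; [rewrite [RHS]mulr1|case].
Qed.

Definition coord_mx m n (i : 'I_m) (j : 'I_n) (A : 'M[R]_(m, n)) : R := A i j.

Lemma coord_mx_is_linear m n (i : 'I_m) (j : 'I_n) : linear (@coord_mx m n i j).
Proof. by move=> a A B; rewrite /coord_mx !mxE. Qed.

HB.instance Definition _ m n (i : 'I_m) (j : 'I_n) :=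
  GRing.isLinear.Build R 'M[R]_(m, n) R _ (@coord_mx m n i j)
    (coord_mx_is_linear i j).

Lemma fin_coord_rV n : fin_coord 'rV[R]_n.
Proof.
exists 'I_n, (delta_mx 0), (fun j => @coord_mx 1 n 0 j); split=> [i|w].
  exact: coord_continuous.
exact: row_sum_delta.
Qed.

Lemma fin_coord_prod (V W : normedModType R) :
  fin_coord V -> fin_coord W -> fin_coord (V * W)%type.
Proof.
move=> [I [e [l [cl lE]]]] [J [f [m [cm mE]]]].
exists (I + J)%type, (fun k => match k with inl i => (e i, 0) | inr j => (0, f j) end).
exists (fun k => match k with inl i => (l i \o fst : {linear (V * W)%type -> R})
   | inr j => (m j \o snd : {linear (V * W)%type -> R}) end).
split=> [[i|j] x /=|[v w]].
- by apply: continuous_comp; [exact: cvg_fst|exact: cl].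
- by apply: continuous_comp; [exact: cvg_snd|exact: cm].
rewrite big_sumType /=.
have E1 : \sum_i l i v *: (e i, 0) = (v, 0) :> V * W.
  rewrite {2}(lE v); elim/big_rec2: _ => // i y _ _ ->.
  by congr (_, _); rewrite /= scaler0 addr0.
have E2 : \sum_i m i w *: (0, f i) = (0, w) :> V * W.
  rewrite {2}(mE w); elim/big_rec2: _ => // i y _ _ ->.
  by congr (_, _); rewrite /= scaler0 addr0.
by rewrite E1 E2; congr (_, _); rewrite /= ?addr0 ?add0r.
Qed.

Lemma mx_norm_leP m n (A : 'M[R]_(m, n)) C : 0 <= C ->
  (`|A| <= C) <-> (forall i j, `|A i j| <= C).
Proof.
move=> C0; rewrite [`|A|]/Num.Def.normr /= mx_normrE; split=> [H i j|H].
  by apply: le_trans H; exact: (le_bigmax _ _ (i, j)).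
by apply: bigmax_le => // -[i j] _; exact: H.
Qed.

Lemma mx_norm_ge m n (A : 'M[R]_(m, n)) i j : `|A i j| <= `|A|.
Proof. by have /(mx_norm_leP A (normr_ge0 _)) := lexx `|A|; apply. Qed.

Lemma is_derive_mxP (V : normedModType R) m n (M : V -> 'M[R]_(m, n)) M' t v :
  is_derive t v M M' <-> forall i j, is_derive t v (fun x => M x i j : R) (M' i j).
Proof.
split=> [[dM <-] i j|H].
  split; first by have /derivable_mxP := dM; apply.
  by rewrite derive_mx // mxE.
have dM : derivable M t v by apply/derivable_mxP => i j; case: (H i j).
split=> //; rewrite derive_mx //; apply/matrixP => i j; rewrite mxE.
by case: (H i j).
Qed.

Lemma is_derive_ext (V W : normedModType R) (f g : V -> W) x v df dg :
  is_derive x v f df -> (forall y, f y = g y) -> df = dg -> is_derive x v g dg.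
Proof. by move=> H /funext <- <-. Qed.

Lemma is_derive_ndecr (g g' : R -> R) (a b : R) : a <= b ->
  (forall t, a <= t <= b -> is_derive t (1 : R) g (g' t)) ->
  (forall t, a <= t <= b -> 0 <= g' t) -> g a <= g b.
Proof.
move=> ab dg g0.
have dgo t : t \in `]a, b[%R -> is_derive t (1 : R) g (g' t).
  by rewrite in_itv /= => /andP[at_ tb]; apply: dg; rewrite !ltW.
have cg : {within `[a, b], continuous g}.
  by apply: derivable_within_continuous => t; rewrite in_itv /= => /dg [].
have [c cab E] := MVT_segment ab dgo cg.
rewrite -subr_ge0 E mulr_ge0 ?subr_ge0 //; apply: g0.
by move: cab; rewrite in_itv.
Qed.

(** The norm being the maximum of the coordinates, it suffices that [w + f_j] and [w - f_j] are
    nondecreasing. A variable bound [w'] is allowed for the sake of exponential weights. *)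
Lemma mean_value_ineq n (f f' : R -> 'rV[R]_n) (w w' : R -> R) (a b : R) : a <= b ->
  (forall t, a <= t <= b -> is_derive t (1 : R) f (f' t)) ->
  (forall t, a <= t <= b -> is_derive t (1 : R) w (w' t)) ->
  (forall t, a <= t <= b -> `|f' t| <= w' t) -> `|f b - f a| <= w b - w a.
Proof.
move=> ab df dw H.
have H0 t : a <= t <= b -> 0 <= w' t by move=> /H; apply: le_trans.
have key := fun g g' => @is_derive_ndecr g g' a b ab.
apply/mx_norm_leP => [|i j].
  by rewrite subr_ge0; exact: key dw H0.
have dfj t : a <= t <= b -> is_derive t (1 : R) (fun t => f t i j : R) (f' t i j).
  by move=> /df /is_derive_mxP.
have Hj t : a <= t <= b -> - w' t <= f' t i j <= w' t.
  by move=> /H; rewrite -ler_norml; apply: le_trans; exact: mx_norm_ge.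
rewrite !mxE ler_norml; apply/andP; split.
- have := key (fun t => w t + f t i j) (fun t => w' t + f' t i j).
  rewrite lerNl opprB lerBlDr => K.
  suff: w a + f a i j <= w b + f b i j by lra.
  apply: K => [t tab|t /Hj]; last by lra.
  by apply: is_deriveD; [exact: dw|exact: dfj].
- have := key (fun t => w t - f t i j) (fun t => w' t - f' t i j).
  move=> K; suff: w a - f a i j <= w b - f b i j by lra.
  apply: K => [t tab|t /Hj]; last by lra.
  by apply: is_deriveB; [exact: dw|exact: dfj].
Qed.

Lemma bounded_derive_lip n (f f' : R -> 'rV[R]_n) (C a b s t : R) :
  (forall t, a <= t <= b -> is_derive t (1 : R) f (f' t)) ->
  (forall t, a <= t <= b -> `|f' t| <= C) ->
  a <= s <= b -> a <= t <= b -> `|f s - f t| <= C * `|s - t|.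
Proof.
move=> df bf; wlog ts : s t / t <= s => [W hs ht|].
  have [ts|/ltW st] := leP t s; first exact: W.
  by rewrite distrC (distrC s); exact: W.
move=> /andP[as_ sb] /andP[at_ tb].
have tsab u : t <= u <= s -> a <= u <= b by lra.
rewrite (@ger0_norm _ (s - t)) ?subr_ge0 // mulrBr.
apply: (@mean_value_ineq _ f f' ( *%R C) (fun=> C)) => //.
- by move=> u /tsab; exact: df.
- move=> u _; have := @is_deriveZ R R R id C u 1 1 (is_derive_id _ _).
  by rewrite /GRing.scale /= mulr1.
- by move=> u /tsab; exact: bf.
Qed.

End coords.

(** * Ordinary differential equations *)

Section ode.
Context {R : realType}.

(** The maximum norm along a curve need not be differentiable, the sum of squares is; this
    comparison is the origin of the factors [n] in Gronwall's lemma. *)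
Lemma sumsq_norm n (v : 'rV[R]_n) :
  `|v| ^+ 2 <= \sum_j v 0 j ^+ 2 <= n%:R * `|v| ^+ 2.
Proof.
apply/andP; split.
  have S0 : 0 <= \sum_j v 0 j ^+ 2 by apply: sumr_ge0 => j _; exact: sqr_ge0.
  rewrite -(sqr_sqrtr S0) ler_pXn2r ?nnegrE ?sqrtr_ge0 //.
  apply/mx_norm_leP => [|i j]; first exact: sqrtr_ge0.
  rewrite ord1 -sqrtr_sqr ler_sqrt // (bigD1 j) //= lerDl.
  by apply: sumr_ge0 => k _; exact: sqr_ge0.
apply: (@le_trans _ _ (\sum_(j < n) `|v| ^+ 2)).
  apply: ler_sum => j _; rewrite -[leLHS]real_normK ?num_real //.
  by rewrite ler_pXn2r ?nnegrE //; exact: mx_norm_ge.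
by rewrite sumr_const card_ord mulr_natl.
Qed.

(** With [N] the sum of the squared coordinates of [f], the function [expR (- C t) (N + n de^2)] is
    nonincreasing. *)
Lemma gronwall_sq n (L de : R) (f f' : R -> 'rV[R]_n) (a b : R) :
  0 <= L -> 0 <= de -> a <= b ->
  (forall t, a <= t <= b -> is_derive t (1 : R) f (f' t)) ->
  (forall t, a <= t <= b -> `|f' t| <= L * `|f t| + de) ->
  `|f b| ^+ 2 <= expR (n%:R * (2 * L + 1) * (b - a)) * (n%:R * (`|f a| ^+ 2 + de ^+ 2)).
Proof.
move=> L0 de0 ab df H.
(* [N'] is at most [2 n |f| (L |f| + de)], and [2 |f| de <= |f|^2 + de^2]. *)
set C := n%:R * (2 * L + 1).
pose N t := \sum_j f t 0 j ^+ 2.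
pose N' t := \sum_j (f t 0 j * f' t 0 j) *+ 2.
have dN t : a <= t <= b -> is_derive t (1 : R) N (N' t).
  move=> /df /is_derive_mxP dft.
  have -> : N = \sum_j (fun t => f t 0 j ^+ 2).
    by apply/funext => s; rewrite fct_sumE.
  apply: is_derive_sum => j.
  apply: is_derive_ext (is_deriveM (dft 0 j) (dft 0 j)) _ _ => [s|].
    by rewrite expr2.
  by rewrite /GRing.scale /= mulr2n.
pose w t := expR (- C * t) * (N t + n%:R * de ^+ 2).
pose w' t := expR (- C * t) * (N' t - C * (N t + n%:R * de ^+ 2)).
have dw t : a <= t <= b -> is_derive t (1 : R) w (w' t).
  move=> tab.
  have d1 : is_derive t (1 : R) (fun t => - C * t) (- C).
    by have := @is_deriveZ R R R id (- C) t 1 1 (is_derive_id _ _); rewrite /GRing.scale /= mulr1.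
  have d2 := @is_derive1_comp R expR (fun t => - C * t) t _ _ (is_derive_expR _) d1.
  have d3 : is_derive t (1 : R) (fun t => N t + n%:R * de ^+ 2) (N' t + 0).
    by apply: is_deriveD; exact: dN.
  apply: is_derive_ext (is_deriveM d2 d3) _ _ => [//|].
  rewrite /w' /GRing.scale /=; ring.
have N0 t : 0 <= N t by apply: sumr_ge0 => j _; exact: sqr_ge0.
have N'C t : a <= t <= b -> N' t <= C * (N t + n%:R * de ^+ 2).
  move=> tab; have Ht := H t tab.
  have : N' t <= \sum_(j < n) (`|f t| * (L * `|f t| + de)) *+ 2.
    apply: ler_sum => j _; rewrite lerMn2r /=.
    apply: le_trans (ler_norm _) _; rewrite normrM.
    apply: ler_pM => //; first exact: mx_norm_ge.
    by apply: le_trans Ht; exact: mx_norm_ge.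
  move=> /le_trans; apply; rewrite sumr_const card_ord.
  have /andP[S1 S2] := sumsq_norm (f t).
  rewrite -/(N t) in S1 S2.
  (* The estimate uses [de^2 <= n de^2], which fails in dimension 0, where both sides vanish. *)
  case: (posnP n) => [n0|n0].
    have nR : n%:R = 0 :> R by rewrite n0.
    by rewrite -[leLHS]mulr_natl /C nR !mul0r.
  rewrite -[leLHS]mulr_natl /C -mulrA ler_wpM2l //.
  have n1 : 1 <= n%:R :> R by rewrite ler1n.
  have de2 := sqr_ge0 de.
  have S3 : L * `|f t| ^+ 2 <= L * N t by rewrite ler_wpM2l.
  have S4 : 1 * de ^+ 2 <= n%:R * de ^+ 2 by rewrite ler_wpM2r.
  have S5 : 0 <= L * (n%:R * de ^+ 2) by rewrite !mulr_ge0.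
  have S6 := sqr_ge0 (`|f t| - de).
  rewrite -mulr_natl; lra.
have dwN t : a <= t <= b -> is_derive t (1 : R) (fun t => - w t) (- w' t).
  by move=> /dw H'; apply: is_deriveN.
have wab : - w a <= - w b.
  apply: (is_derive_ndecr ab dwN) => t tab.
  rewrite oppr_ge0 /w' pmulr_rle0 ?expR_gt0 // subr_le0; exact: N'C.
rewrite lerN2 in wab.
have /andP[S1 _] := sumsq_norm (f b).
have /andP[_ S2] := sumsq_norm (f a).
rewrite -/(N b) -/(N a) in S1 S2.
have {wab} : N b + n%:R * de ^+ 2 <= expR (C * (b - a)) * (N a + n%:R * de ^+ 2).
  have -> : C * (b - a) = C * b + - C * a by ring.
  rewrite expRD -mulrA -(@ler_pM2l _ (expR (- C * b))) ?expR_gt0 //.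
  rewrite [leRHS]mulrA -expRD mulNr addNr expR0 mul1r -mulNr.
  exact: wab.
have : 0 <= n%:R * de ^+ 2 by rewrite mulr_ge0 // sqr_ge0.
move=> P1 P2; rewrite (mulrDr n%:R).
apply: le_trans S1 _.
apply: (@le_trans _ _ (N b + n%:R * de ^+ 2)); first by rewrite lerDl.
apply: le_trans P2 _; rewrite ler_pM2l ?expR_gt0 //.
by rewrite lerD2r.
Qed.

(** The constant is fixed before the curve, which makes it uniform in the initial value, and [s] and
    [t] may come in either order. *)
Lemma gronwall n (L T : R) : 0 <= L -> exists2 G : R, 0 <= G &
  forall (f f' : R -> 'rV[R]_n) de (a b s t : R), 0 <= de -> b - a <= T ->
  (forall t, a <= t <= b -> is_derive t (1 : R) f (f' t)) ->
  (forall t, a <= t <= b -> `|f' t| <= L * `|f t| + de) ->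
  a <= s <= b -> a <= t <= b ->
  `|f t| <= G * (`|f s| + de).
Proof.
move=> L0; set C := n%:R * (2 * L + 1).
have C0 : 0 <= C by rewrite mulr_ge0 // addr_ge0 // mulr_ge0.
set E := n%:R * expR (C * T).
have E0 : 0 <= E by rewrite mulr_ge0 // expR_ge0.
(* [E <= (E + 1)^2] lets the squared estimate be unsquared without a square root. *)
exists (E + 1); first by rewrite addr_ge0.
have core (f f' : R -> 'rV[R]_n) de (s t : R) : 0 <= de -> s <= t -> t - s <= T ->
  (forall u, s <= u <= t -> is_derive u (1 : R) f (f' u)) ->
  (forall u, s <= u <= t -> `|f' u| <= L * `|f u| + de) ->
  `|f t| <= (E + 1) * (`|f s| + de).
  move=> de0 st tsT df H.
  have := gronwall_sq L0 de0 st df H; rewrite -/C => K.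
  rewrite -(@ler_pXn2r _ 2) ?nnegrE //; last by rewrite mulr_ge0 ?addr_ge0.
  apply: le_trans K _.
  apply: (@le_trans _ _ (E * (`|f s| ^+ 2 + de ^+ 2))).
    rewrite /E mulrCA mulrA ler_wpM2r ?addr_ge0 ?sqr_ge0 //.
    by rewrite ler_wpM2l // ler_expR ler_wpM2l.
  rewrite exprMn; apply: ler_pM => //; first by rewrite addr_ge0 ?sqr_ge0.
    by have := sqr_ge0 E; lra.
  by have : 0 <= `|f s| * de by [rewrite mulr_ge0]; lra.
move=> f f' de a b s t de0 baT df H /andP[as_ sb] /andP[at_ tb].
have [st|/ltW ts] := leP s t.
  apply: (core f f') => // [|u su|u su]; first lra.
  - apply: df; lra.
  - apply: H; lra.
(* For [t < s], time is reversed. *)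
have := @core (fun u => f (- u)) (fun u => - f' (- u)) de (- s) (- t).
rewrite !opprK; apply => // [||u su|u su]; [lra|lra| |]; last first.
  rewrite normrN; apply: H; lra.
have d1 : is_derive u (1 : R) (-%R : R -> R) (-1).
  exact: (@is_deriveNid _ R u 1).
apply/is_derive_mxP => i j.
have /is_derive_mxP dfu := df (- u) ltac:(lra).
apply: is_derive_ext (is_derive1_comp (dfu i j) d1) _ _ => //.
by rewrite mxE mulrN1.
Qed.

End ode.

(** * Primitives and Picard iteration on the whole real line *)

Section picard.
Context {R : realType}.

Lemma derive_continuous (W : normedModType R) (f f' : R -> W) :
  (forall t, is_derive t (1 : R) f (f' t)) -> continuous f.
Proof.
by move=> df t; apply/differentiable_continuous/derivable1_diffP; case: (df t).
Qed.

Lemma antiderivative_half (f : R -> R) (a : R) : continuous f ->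
  exists F : R -> R, forall t, a < t -> is_derive t (1 : R) F (f t).
Proof.
move=> cf; exists (fun x => \int[lebesgue_measure]_(t in [set` `[a, x]]) (f t))%R.
move=> t at_.
have [] := @continuous_FTC1_closed R f a t (t + 1) _ _ at_ (cf t).
- by rewrite ltrDl.
- apply: continuous_compact_integrable; first exact: segment_compact.
  exact: continuous_subspaceT.
by move=> H1 H2; split; [exact: H1|rewrite -H2 derive1E].
Qed.

Lemma is_derive_neg (f : R -> R) (t d : R) : is_derive (- t) (1 : R) f d ->
  is_derive t (1 : R) (fun x => f (- x)) (- d).
Proof.
move=> H; apply: is_derive_ext (is_derive1_comp H (@is_deriveNid _ R t 1)) _ _ => //.
by rewrite mulrN1.
Qed.

(** Integrating from a base point gives a primitive only to its right. A primitive on [t > -1] and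
    the reflection of one of [- f (- t)] are glued at 0; normalised to vanish there, they coincide
    on []-1, 1[]. *)
Lemma antiderivative_real (f : R -> R) : continuous f ->
  exists F : R -> R, F 0 = 0 /\ forall t, is_derive t (1 : R) F (f t).
Proof.
move=> cf.
have [F1 dF1] := antiderivative_half (-1) cf.
have [|F2 dF2] := @antiderivative_half (fun t => - f (- t)) (-1).
  move=> t; apply: continuousN; apply: continuous_comp; last exact: cf.
  exact: opp_continuous.
pose G1 t := F1 t - F1 0; pose G2 t := F2 (- t) - F2 0.
have dG1 (t : R) : -1 < t -> is_derive t (1 : R) G1 (f t).
  by move=> /dF1 H; apply: is_derive_ext (is_deriveB H (is_derive_cst (F1 0) t 1)) _ _ => //; rewrite subr0.
have dG2 (t : R) : t < 1 -> is_derive t (1 : R) G2 (f t).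
  move=> t1; have := dF2 (- t) ltac:(lra); rewrite opprK => /is_derive_neg; rewrite opprK => H.
  by apply: is_derive_ext (is_deriveB H (is_derive_cst (F2 0) t 1)) _ _ => //; rewrite subr0.
have G12 (t : R) : -1 < t < 1 -> G1 t = G2 t.
  move=> /andP[t1 t2].
  pose D s := G1 s - G2 s.
  have dD (s : R) : -1 < s < 1 -> is_derive s (1 : R) D 0.
    move=> /andP[s1 s2]; apply: is_derive_ext (is_deriveB (dG1 s s1) (dG2 s s2)) _ _ => //.
    by rewrite subrr.
  have D0 : D 0 = 0 by rewrite /D /G1 /G2 oppr0 !subrr.
  suff: D t = 0 by rewrite /D => /eqP; rewrite subr_eq0 => /eqP.
  have dD' (s : R) : -1 < s < 1 -> is_derive s (1 : R) (fun x => - D x) 0.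
    by move=> /dD H; apply: is_derive_ext (is_deriveN H) _ _ => //; rewrite oppr0.
  have [t0|/ltW t0] := leP 0 t.
    have := @is_derive_ndecr _ D (fun=> 0) 0 t t0 (fun s hs => dD s ltac:(lra)) (fun _ _ => lexx 0).
    have := @is_derive_ndecr _ (fun x => - D x) (fun=> 0) 0 t t0 (fun s hs => dD' s ltac:(lra)) (fun _ _ => lexx 0).
    lra.
  have := @is_derive_ndecr _ D (fun=> 0) t 0 t0 (fun s hs => dD s ltac:(lra)) (fun _ _ => lexx 0).
  have := @is_derive_ndecr _ (fun x => - D x) (fun=> 0) t 0 t0 (fun s hs => dD' s ltac:(lra)) (fun _ _ => lexx 0).
  lra.
exists (fun t => if t < 0 then G2 t else G1 t); split.
  by rewrite ltxx /G1 subrr.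
move=> t; have [t0|t0] := ltP t 0.
  apply: near_eq_is_derive (dG2 t ltac:(lra)).
  by near=> s; have -> : s < 0 by near: s; exact: lt_nbhsl.
apply: near_eq_is_derive (dG1 t ltac:(lra)).
near=> s; case: ifPn => // s0; apply: G12; rewrite (lt_trans s0) // andbT.
by near: s; apply: lt_nbhsr; lra.
Unshelve. all: by end_near. Qed.

Lemma antiderivative n (f : R -> 'rV[R]_n) : continuous f ->
  exists F : R -> 'rV[R]_n, F 0 = 0 /\ forall t, is_derive t (1 : R) F (f t).
Proof.
move=> cf.
have /choice[F HF] (j : 'I_n) : exists Fj : R -> R, Fj 0 = 0 /\
    forall t, is_derive t (1 : R) Fj (f t 0 j).
  apply: antiderivative_real => t.
  apply: (@continuous_comp _ _ _ f (fun v : 'rV[R]_n => v 0 j)); first exact: cf.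
  exact: coord_continuous.
exists (fun t => \row_j F j t); split.
  by apply/rowP => j; rewrite !mxE; case: (HF j).
move=> t; apply/is_derive_mxP => i j; rewrite ord1.
have [_ /(_ t) H] := HF j.
by apply: is_derive_ext H _ _ => // s; rewrite mxE.
Qed.

Let h : R := 2^-1.

Lemma half_pow_small (B e : R) : 0 <= B -> 0 < e -> exists N, B * h ^+ N < e.
Proof.
move=> B0 e0.
have : B * h ^+ n @[n --> \oo] --> B * 0.
  by apply: cvgMr; apply: cvg_expr; rewrite /h gtr0_norm ?invr_gt0 // invf_lt1 // ltr1n.
rewrite mulr0 => /cvgrPdist_lt /(_ e e0) [N _ /(_ N (leqnn N))] /=.
by rewrite sub0r normrN => H; exists N; apply: le_lt_trans H; exact: ler_norm.
Qed.

Lemma le_half_pow_eq0 (W : normedModType R) (x : W) (B : R) :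
  (forall n, `|x| <= B * h ^+ n) -> x = 0.
Proof.
move=> H; apply/eqP; rewrite -normr_le0 leNgt; apply/negP => x0.
have B0 : 0 <= B by have := H 0%N; rewrite expr0 mulr1; apply: le_trans.
have [N HN] := half_pow_small B0 x0.
by have := lt_le_trans HN (H N); rewrite ltxx.
Qed.

Lemma geometric_limit n (u : nat -> 'rV[R]_n) (B : R) :
  (forall k, `|u k.+1 - u k| <= B * h ^+ k) ->
  exists l, forall k, `|l - u k| <= 2 * B * h ^+ k.
Proof.
move=> H.
have B0 : 0 <= B by have := H 0%N; rewrite expr0 mulr1; apply: le_trans.
have h0 k : 0 <= h ^+ k by rewrite exprn_ge0 // invr_ge0.
(* The subtracted term is what makes the induction on [m] close; it is dropped in [H3]. *)
have H2 k m : `|u (k + m)%N - u k| <= 2 * B * h ^+ k - 2 * B * h ^+ (k + m).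
  elim: m => [|m IH]; first by rewrite addn0 !subrr normr0.
  rewrite addnS -(subrKA (u (k + m)%N)).
  apply: le_trans (ler_normD _ _) _.
  have := H (k + m)%N; rewrite exprS => H1.
  have hE : h * 2 = 1 by rewrite /h mulVf.
  have -> : 2 * B * (h * h ^+ (k + m)) = (h * 2) * B * h ^+ (k + m) by ring.
  rewrite hE; lra.
have H3 k m : `|u (k + m)%N - u k| <= 2 * B * h ^+ k.
  apply: le_trans (H2 k m) _; rewrite gerBl; apply: mulr_ge0 => //; exact: mulr_ge0.
have cu : cauchy (u @ \oo).
  apply/cauchy_exP => e e0.
  have [N HN] := half_pow_small (mulr_ge0 (ler0n _ 2) B0) e0.
  exists (u N); exists N => // m /= Nm.
  rewrite -ball_normE /= distrC; apply: le_lt_trans HN.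
  by rewrite -(subnKC Nm).
have [l ul] := (cvg_ex _).1 ((cauchy_cvgP _).1 cu).
exists l => k.
apply: (@closed_cvg _ _ _ _ u (fun x => `|x - u k| <= 2 * B * h ^+ k)) ul.
  apply: (@preimage_closed _ _ (fun x : 'rV[R]_n => `|x - u k|) [set y | y <= 2 * B * h ^+ k]).
    move=> x _; apply: continuous_comp; last exact: norm_continuous.
    by apply: continuousB => //; exact: cst_continuous.
  exact: closed_le.
exists k => // m /= km; rewrite -(subnKC km); exact: H3.
Qed.

(** Bielecki's weight: a primitive of [C expR (2 L s)] gains the factor [1 / (2 L)], so an
    [L]-Lipschitz right-hand side makes the Picard operator contract by one half, however long the
    time interval. *)
Lemma exp_weight_bound n (L C T : R) (y y' : R -> 'rV[R]_n) : 0 < L -> y 0 = 0 ->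
  (forall t, is_derive t (1 : R) y (y' t)) ->
  (forall t, `|t| <= T -> `|y' t| <= C * expR (2 * L * `|t|)) ->
  forall t, `|t| <= T -> `|y t| <= C / (2 * L) * expR (2 * L * `|t|).
Proof.
move=> L0 y0 dy H t tT.
have C0 : 0 <= C.
  have := H 0; rewrite normr0 mulr0 expR0 mulr1 => /(_ (le_trans (normr_ge0 t) tT)).
  exact: le_trans.
have cL : 0 <= C / (2 * L) by rewrite divr_ge0 // mulr_ge0 // ltW.
have dw (K : R) s : is_derive s (1 : R) (fun s => C / (2 * L) * expR (K * s))
    (C / (2 * L) * (K * expR (K * s))).
  have d1 : is_derive s (1 : R) (fun t => K * t) K.
    by have := @is_deriveZ R R R id K s 1 1 (is_derive_id _ _); rewrite /GRing.scale /= mulr1.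
  have d2 := is_derive1_comp (is_derive_expR (K * s)) d1.
  apply: is_derive_ext (is_deriveZ (C / (2 * L)) d2) _ _ => //.
  by rewrite (mulrC K (expR _)).
have LE : C / (2 * L) * (2 * L) = C by rewrite divfK // mulf_neq0 // gt_eqF.
have [t0|/ltW t0] := leP 0 t.
  rewrite ger0_norm // in tT *.
  have := @mean_value_ineq _ _ y y' _ _ 0 t t0 (fun s _ => dy s) (fun s _ => dw (2 * L) s).
  rewrite y0 subr0 mulr0 expR0 mulr1 => K.
  apply: le_trans (K _) _; last by rewrite gerBl.
  move=> s /andP[s0 st]; have := H s; rewrite ger0_norm // => /(_ (le_trans st tT)).
  by rewrite mulrA LE.
rewrite ler0_norm // in tT *.
have dw' s : is_derive s (1 : R) (fun s => - (C / (2 * L) * expR (- (2 * L) * s)))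
    (C * expR (- (2 * L) * s)).
  apply: is_derive_ext (is_deriveN (dw (- (2 * L)) s)) _ _ => //.
  by rewrite mulrA mulrN LE mulNr opprK.
have := @mean_value_ineq _ _ y y' _ _ t 0 t0 (fun s _ => dy s) (fun s _ => dw' s).
rewrite y0 sub0r normrN !mulr0 expR0 mulr1 opprK mulrN -mulNr => K.
apply: le_trans (K _) _; last by rewrite addrC gerBl.
move=> s /andP[ts s0]; have := H s; rewrite ler0_norm // mulrN -mulNr; apply; lra.
Qed.

(** In Bielecki's weighted norm the iterates converge like [2^-k] on every bounded interval, so a
    single solution exists for all times. *)
Lemma picard n (F : R -> 'rV[R]_n -> 'rV[R]_n) (L : R) : 0 < L ->
  (forall y : R -> 'rV[R]_n, continuous y -> continuous (fun t => F t (y t))) ->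
  (forall t y z, `|F t y - F t z| <= L * `|y - z|) ->
  forall y0, exists y : R -> 'rV[R]_n, y 0 = y0 /\
    forall t, is_derive t (1 : R) y (F t (y t)).
Proof.
move=> L0 cF lF y0.
(* [P] is a total integration operator, with irrelevant values at discontinuous functions. *)
have /choice[P HP] (f : R -> 'rV[R]_n) : exists g : R -> 'rV[R]_n, continuous f ->
    g 0 = 0 /\ forall t, is_derive t (1 : R) g (f t).
  case: (pselect (continuous f)) => [/antiderivative[g Hg]|nf].
    by exists g.
  by exists f => /nf.
pose u := fix u k : R -> 'rV[R]_n := if k is k'.+1
  then fun t => y0 + P (fun t => F t (u k' t)) t else fun=> y0.
have cu k : continuous (u k).
  elim: k => [|k IH]; first by move=> t; exact: cst_continuous.
  have [_ /derive_continuous cP] := HP _ (cF _ IH).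
  by move=> t; apply: continuousD; [exact: cst_continuous|exact: cP].
have dPD f (t : R) : continuous f ->
    is_derive t (1 : R) (fun t => y0 + P f t) (f t).
  move=> /HP [_ /(_ t) H].
  apply: is_derive_ext (is_deriveD (is_derive_cst y0 t 1) H) _ _ => //.
  by rewrite add0r.
have du k t : is_derive t (1 : R) (u k.+1) (F t (u k t)).
  exact/dPD/cF/cu.
have u0 k : u k 0 = y0.
  by case: k => // k /=; have [-> _] := HP _ (cF _ (cu k)); rewrite addr0.
(* [D] is the maximum of [|u 1 - u 0|] over [[-T, T]]; each iteration halves the bound. *)
have bT (T : R) : exists D : R, forall k t, `|t| <= T ->
    `|u k.+1 t - u k t| <= D * h ^+ k * expR (2 * L * `|t|).
  have [T0|T0] := ltP T 0.
    by exists 0 => k t /(le_trans (normr_ge0 t)); rewrite leNgt T0.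
  have TT : - T <= T by lra.
  have [|c _ Hc] := @EVT_max R (fun t => `|u 1 t - u 0 t|) _ _ TT.
    apply: continuous_subspaceT => t; apply: continuous_comp; last exact: norm_continuous.
    by apply: continuousB; exact: cu.
  exists (`|u 1 c - u 0 c|); elim=> [|k IH] t tT.
    rewrite expr0 mulr1; apply: (@le_trans _ _ `|u 1 c - u 0 c|).
      by apply: Hc; rewrite in_itv /= -ler_norml.
    rewrite ler_peMr // -expR0 ler_expR mulr_ge0 //; apply: mulr_ge0 => //; exact: ltW.
  have := @exp_weight_bound n L (L * (`|u 1 c - u 0 c| * h ^+ k)) T
    (fun t => u k.+2 t - u k.+1 t) (fun t => F t (u k.+1 t) - F t (u k t)) L0.
  have -> : L * (`|u 1 c - u 0 c| * h ^+ k) / (2 * L) = `|u 1 c - u 0 c| * h ^+ k.+1.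
    have L1 : L != 0 by rewrite gt_eqF.
    by rewrite exprS /h; field.
  apply => //; first by rewrite !u0 subrr.
  move=> s sT; apply: le_trans (lF _ _ _) _.
  by rewrite -(mulrA L) ler_pM2l //; apply: IH.
(* The limit is required to satisfy the estimate for every admissible [D], so that the bounds [bT]
   for different [T] all concern the same [y]. *)
have /choice[y Hy] (t : R) : exists l, forall D, (forall k,
   `|u k.+1 t - u k t| <= D * h ^+ k) -> forall k, `|l - u k t| <= 2 * D * h ^+ k.
  have [D HD] := bT `|t|.
  have [|l Hl] := @geometric_limit _ (fun k => u k t) (D * expR (2 * L * `|t|)).
    by move=> k; rewrite mulrAC; exact: HD.
  exists l => D' HD' k; have [l' Hl'] := geometric_limit HD'.
  suff -> : l = l' by exact: Hl'.
  apply/eqP; rewrite -subr_eq0; apply/eqP.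
  apply: (@le_half_pow_eq0 _ _ (2 * (D * expR (2 * L * `|t|)) + 2 * D')) => m.
  rewrite -(subrKA (u m t)); apply: le_trans (ler_normD _ _) _.
  by rewrite (distrC (u m t)) mulrDl lerD.
have yT (T : R) : exists D : R, forall k t, `|t| <= T -> `|y t - u k t| <= D * h ^+ k.
  have [D HD] := bT T; exists (2 * (D * expR (2 * L * T))) => k t tT.
  apply: Hy => m; apply: le_trans (HD m t tT) _.
  rewrite mulrAC ler_wpM2r ?exprn_ge0 ?invr_ge0 // ler_wpM2l //; last first.
    by rewrite ler_expR ler_wpM2l // mulr_ge0 // ltW.
  have := HD 0%N t tT; rewrite expr0 mulr1 => /(le_trans (normr_ge0 _)).
  by rewrite pmulr_lge0 // expR_gt0.
have cy : continuous y.
  move=> t; apply/cvgrPdist_lt => e e0.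
  have [D HD] := yT (`|t| + 1).
  have D0 : 0 <= D.
    have := HD 0%N t ltac:(lra); rewrite expr0 mulr1; exact: le_trans.
  have e3 : 0 < e / 3 by rewrite divr_gt0.
  have [N HN] := half_pow_small D0 e3.
  have ut := cu N t; move/cvgrPdist_lt: ut => /(_ _ e3) ut.
  near=> s.
  have s1 : `|s| <= `|t| + 1.
    have : `|t - s| < 1 by near: s; apply: (@cvgr_dist_lt _ R); [exact: cvg_id|].
    have := ler_normB t (t - s); rewrite opprB addrC subrK; lra.
  have A1 := HD N t ltac:(lra).
  have A2 := HD N s s1.
  have A3 : `|u N t - u N s| < e / 3 by near: s.
  have -> : y t - y s = (y t - u N t) + ((u N t - u N s) - (y s - u N s)).
    by rewrite (opprB (y s)) !subrKA.
  apply: le_lt_trans (ler_normD _ _) _.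
  have := ler_normB (u N t - u N s) (y s - u N s); lra.
have [z0 dz] := HP _ (cF _ cy).
pose z t := y0 + P (fun t => F t (y t)) t.
(* [z] is the Picard operator applied to the limit [y]. Both [z - u k.+1] and [y - u k.+1] are of
   order [2^-k], hence [y] is a fixed point. *)
suff yz : y = z.
  exists y; split.
    by rewrite yz /z z0 addr0.
  by move=> t; have := @dPD (fun t => F t (y t)) t (cF _ cy); rewrite -/z -yz.
apply/funext => t; apply/eqP; rewrite eq_sym -subr_eq0; apply/eqP.
have [D HD] := yT `|t|.
apply: (@le_half_pow_eq0 _ _ (L * D * `|t| + D)) => k.
have zu : `|z t - u k.+1 t| <= L * D * h ^+ k * `|t|.
  have := @bounded_derive_lip _ n (fun s => z s - u k.+1 s) (fun s => F s (y s) - F s (u k s))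
    (L * D * h ^+ k) (- `|t|) `|t| t 0.
  rewrite u0 /z z0 addr0 subrr !subr0; apply.
  - by move=> s _; exact: is_derive_ext (is_deriveB (dPD _ s (cF _ cy)) (du k s)) _ _.
  - move=> s; rewrite -ler_norml => st; apply: le_trans (lF _ _ _) _.
    by rewrite -(mulrA L) ler_pM2l //; apply: HD.
  - by rewrite -ler_norml.
  - by rewrite oppr_le0 normr_ge0.
have D0 : 0 <= D by have := HD 0%N t (lexx _); rewrite expr0 mulr1; exact: le_trans.
rewrite -(subrKA (u k.+1 t)) mulrDl; apply: le_trans (ler_normD _ _) _.
apply: lerD; first by rewrite mulrAC.
rewrite distrC; apply: le_trans (HD k.+1 t (lexx _)) _.
rewrite ler_wpM2l // exprS ger_pMl ?exprn_gt0 ?invr_gt0 //.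
by rewrite /h invf_le1 // ler1n.
Unshelve. all: by end_near. Qed.

End picard.

(** * Lipschitz and Taylor estimates on a box *)

Section box.
Context {R : realType}.

Lemma fin_coord_continuous (V W : normedModType R) (l : {linear V -> W}) :
  fin_coord V -> continuous l.
Proof.
move=> [I [e [c [cc cE]]]].
have -> : l = (fun v => \sum_i c i v *: l (e i)) :> (V -> W).
  apply/funext => v; rewrite {1}(cE v) linear_sum.
  by apply: eq_bigr => i _; rewrite linearZ.
have C0 : Ck_on 0 setT (fun v => \sum_i c i v *: l (e i)).
  apply: Ck_sum; first exact: openT.
  move=> i; apply: (Ck_scale openT); last exact: Ck_cst.
  exact: Ck_lin1.
by move=> x; exact: C0.
Qed.

Lemma is_derive_chain (V W : normedModType R) (c : R -> V) (t : R) (c' : V) (f : V -> W) :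
  is_derive t (1 : R) c c' -> differentiable f (c t) ->
  is_derive t (1 : R) (fun s => f (c s)) ('d f (c t) c').
Proof.
move=> [/derivable1_diffP dc <-] df.
have dfc := differentiable_comp dc df.
split; first exact/derivable1_diffP.
by rewrite deriveE // deriveE // (diff_comp dc df).
Qed.

(** Gronwall's lemma delivers remainders of this quadratic form, rather than little-o ones. *)
Lemma is_diff_quad (V W : normedModType R) (f : V -> W) (df : {linear V -> W})
    (C : R) x : continuous df ->
  (\forall h \near 0, `|f (x + h) - f x - df h| <= C * `|h| ^+ 2) ->
  is_diff x f df.
Proof.
move=> cdf H.
have E : f \o shift x = cst (f x) + df +o_ 0 id.
  apply/eqaddoP => _/posnumP[e].
  have C1 : 0 < `|C| + 1 by rewrite ltr_wpDl.
  have N0 : \forall h \near (0 : V), `|h| <= (`|C| + 1)^-1 * e%:num.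
    by apply: nbhs0_le; rewrite mulr_gt0 // invr_gt0.
  near=> h => /=.
  rewrite -[(_ \o _ - _) h]/(f (h + x) - (f x + df h)).
  have : `|f (x + h) - f x - df h| <= C * `|h| ^+ 2 by near: h.
  rewrite opprD addrA [h + x]addrC => /le_trans; apply.
  rewrite expr2 mulrA ler_wpM2r //.
  apply: (@le_trans _ _ ((`|C| + 1) * `|h|)).
    by rewrite ler_wpM2r //; have := ler_norm C; lra.
  by rewrite -ler_pdivlMl //; near: h.
have dfE := diff_unique cdf E.
split => //; apply/diff_locallyP; rewrite dfE; split => //.
Unshelve. all: by end_near. Qed.

Lemma lip_continuous (V W : normedModType R) (C : R) (f : V -> W) x :
  (\forall y \near x, `|f x - f y| <= C * `|x - y|) -> {for x, continuous f}.
Proof.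
move=> H; apply/cvgrPdist_lt => e e0.
have C1 : 0 < `|C| + 1 by rewrite ltr_wpDl.
have N : \forall y \near x, `|x - y| < e / (`|C| + 1).
  by apply/nbhs_normP; exists (e / (`|C| + 1)) => //=; rewrite divr_gt0.
apply: filterS2 H N => y H1; rewrite ltr_pdivlMr // mulrC; apply: le_lt_trans.
apply: le_trans H1 _; rewrite ler_wpM2r //; have := ler_norm C; lra.
Qed.

Lemma lip_setT_continuous (V W : normedModType R) (C : R) (f : V -> W) :
  (forall x y, `|f x - f y| <= C * `|x - y|) -> continuous f.
Proof. by move=> H x; apply: (@lip_continuous _ _ C); exact: nearW. Qed.

Definition box n (a b : 'rV[R]_n) : set 'rV[R]_n :=
  [set y | forall j, a 0 j <= y 0 j <= b 0 j].

(** For [a <= b], a 1-Lipschitz retraction onto the box: composing with it extends a field from the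
    box without increasing its Lipschitz constant. *)
Definition clamp n (a b y : 'rV[R]_n) : 'rV[R]_n :=
  \row_j Num.max (a 0 j) (Num.min (b 0 j) (y 0 j)).

Lemma box_compact n (a b : 'rV[R]_n) : compact (box a b).
Proof.
have -> : box a b = [set y | forall j, `[a 0 j, b 0 j]%classic (y ord0 j)].
  by apply/seteqP; split => y H j; have := H j; rewrite /= in_itv.
apply: (@rV_compact R n (fun j => `[a 0 j, b 0 j]%classic)) => j.
exact: segment_compact.
Qed.

Lemma box_segment n (a b y z : 'rV[R]_n) (s : R) : 0 <= s <= 1 ->
  box a b y -> box a b z -> box a b (y + s *: (z - y)).
Proof.
move=> /andP[s0 s1] by_ bz j; rewrite !mxE.
have /andP[y1 y2] := by_ j; have /andP[z1 z2] := bz j.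
have -> : y 0 j + s * (z 0 j - y 0 j) = (1 - s) * y 0 j + s * z 0 j by ring.
have s2 : 0 <= 1 - s by lra.
have H1 := ler_wpM2l s0 z1; have H2 := ler_wpM2l s0 z2.
have H3 := ler_wpM2l s2 y1; have H4 := ler_wpM2l s2 y2.
by apply/andP; split; lra.
Qed.

Lemma clamp_box n (a b y : 'rV[R]_n) : (forall j, a 0 j <= b 0 j) ->
  box a b (clamp a b y).
Proof.
by move=> ab j; rewrite mxE le_max lexx /= ge_max ab ge_min lexx.
Qed.

Lemma clamp_id n (a b y : 'rV[R]_n) : box a b y -> clamp a b y = y.
Proof.
move=> H; apply/rowP => j; rewrite mxE.
by have /andP[y1 y2] := H j; rewrite min_r // max_r.
Qed.

Lemma clamp_lip n (a b y z : 'rV[R]_n) : `|clamp a b y - clamp a b z| <= `|y - z|.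
Proof.
apply/mx_norm_leP => // i j; rewrite ord1 !mxE.
have : `|y 0 j - z 0 j| <= `|y - z|.
  by apply: le_trans (mx_norm_ge (y - z) 0 j); rewrite !mxE.
move: `|y - z| => r; rewrite !ler_norml !maxEle !minEle.
move=> /andP[r1 r2].
by do ! case: ifPn => //; rewrite ?leNgt ?negbK; intros; lra.
Qed.

Lemma clamp_continuous n (a b : 'rV[R]_n) : continuous (clamp a b).
Proof.
by apply: (@lip_setT_continuous _ _ 1) => y z; rewrite mul1r; exact: clamp_lip.
Qed.

Lemma box_bound n (W : normedModType R) (a b : 'rV[R]_n) (f : 'rV[R]_n -> W) :
  Ck_on 0 (box a b) f -> exists2 C : R, 0 <= C & forall y, box a b y -> `|f y| <= C.
Proof.
move=> cf; have [A0|/set0P/negP] := pselect (box a b !=set0); last first.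
  rewrite negbK => /eqP A0; exists 0 => // y; rewrite A0 //.
have [|c _ Hc] := @EVT_max_rV R n (fun y => `|f y|) _ A0 (@box_compact n a b).
  apply: continuous_in_subspaceT => y; rewrite inE => yA.
  by apply: continuous_comp; [exact: cf|exact: norm_continuous].
by exists `|f c| => // y yA; apply: Hc; rewrite inE.
Qed.

Lemma diff_row n (W : normedModType R) (l : {linear 'rV[R]_n -> W}) v :
  l v = \sum_j v 0 j *: l (delta_mx 0 j).
Proof.
rewrite {1}(row_sum_delta v) linear_sum.
by apply: eq_bigr => j _; rewrite linearZ.
Qed.

(** [Ck_on] gives continuity of ['d f] along fixed vectors; bounds along the basis vectors are added
    up. *)
Lemma box_diff_bound n (W : normedModType R) (a b : 'rV[R]_n) (f : 'rV[R]_n -> W) :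
  Ck_on 1 (box a b) f -> exists2 L : R, 0 <= L &
  forall y v, box a b y -> `|'d f y v| <= L * `|v|.
Proof.
move=> [_ Cf].
have /choice[L HL] (j : 'I_n) : exists L : R, 0 <= L /\
    forall y, box a b y -> `|'d f y (delta_mx 0 j)| <= L.
  by have [L L0 HL] := box_bound (Cf (delta_mx 0 j)); exists L.
exists (\sum_j L j) => [|y v yA]; first by apply: sumr_ge0 => j _; case: (HL j).
rewrite diff_row mulr_suml; apply: le_trans (ler_norm_sum _ _ _) _.
apply: ler_sum => j _; rewrite normrZ mulrC; apply: ler_pM => //.
  by case: (HL j) => _; apply.
exact: mx_norm_ge.
Qed.

Lemma is_derive_line (V W : normedModType R) (f : V -> W) y v (s : R) :
  differentiable f (y + s *: v) ->
  is_derive s (1 : R) (fun s => f (y + s *: v)) ('d f (y + s *: v) v).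
Proof.
move=> df.
have dl : is_derive s (1 : R) (fun s => y + s *: v) v.
  split; first exact/derivable1_diffP.
  rewrite deriveE //.
  have H : is_diff s (cst y + ( *:%R^~ v)) (0 + ( *:%R^~ v)).
    exact: is_diffD.
  by have -> := @diff_val _ _ _ _ _ _ _ H; rewrite add0r scale1r.
exact: (is_derive_chain dl df).
Qed.

Lemma box_lip n m (a b : 'rV[R]_n) (f : 'rV[R]_n -> 'rV[R]_m) :
  Ck_on 1 (box a b) f -> exists2 L : R, 0 <= L &
  (forall y v, box a b y -> `|'d f y v| <= L * `|v|) /\
  forall y z, box a b y -> box a b z -> `|f z - f y| <= L * `|z - y|.
Proof.
move=> Cf; have [L L0 HL] := box_diff_bound Cf; exists L => //; split=> // y z yA zA.
have [df _] := Cf.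
have seg s : 0 <= s <= 1 -> box a b (y + s *: (z - y)).
  by move=> s01; exact: box_segment.
have := @bounded_derive_lip _ m (fun s => f (y + s *: (z - y)))
  (fun s => 'd f (y + s *: (z - y)) (z - y)) (L * `|z - y|) 0 1 1 0.
rewrite scale1r scale0r addr0 [y + (z - y)]addrC subrK subr0 normr1 mulr1.
apply; rewrite ?lexx ?ler01 //.
- by move=> s /seg sA; apply: is_derive_line; exact: df.
- by move=> s /seg sA; exact: HL.
Qed.

(** Along the segment from [y] to [z = y + v], the derivative of [f (y + s v) - s 'd f y v] is at
    most [L |v|^2], the partial derivatives being Lipschitz on the box. *)
Lemma box_quad n m (a b : 'rV[R]_n) (f : 'rV[R]_n -> 'rV[R]_m) :
  Ck_on 2 (box a b) f -> exists2 L : R, 0 <= L &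
  forall y z, box a b y -> box a b z ->
    `|f z - f y - 'd f y (z - y)| <= L * `|z - y| ^+ 2.
Proof.
move=> [df Cdf].
have /choice[K HK] (j : 'I_n) : exists K : R, 0 <= K /\
    forall y z, box a b y -> box a b z ->
      `|'d f z (delta_mx 0 j) - 'd f y (delta_mx 0 j)| <= K * `|z - y|.
  by have [K K0 [_ HK]] := box_lip (Cdf (delta_mx 0 j)); exists K.
pose L := \sum_j K j.
have L0 : 0 <= L by apply: sumr_ge0 => j _; case: (HK j).
have dlip y z v : box a b y -> box a b z ->
    `|'d f z v - 'd f y v| <= L * `|z - y| * `|v|.
  move=> yA zA.
  have -> : 'd f z v - 'd f y v =
      \sum_j v 0 j *: ('d f z (delta_mx 0 j) - 'd f y (delta_mx 0 j)).
    under eq_bigr do rewrite scalerBr.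
    by rewrite sumrB; congr (_ - _); exact: diff_row.
  apply: le_trans (ler_norm_sum _ _ _) _; rewrite /L !mulr_suml.
  apply: ler_sum => j _; rewrite normrZ mulrC.
  apply: ler_pM => //; last exact: mx_norm_ge.
  by case: (HK j) => _; apply.
exists L => // y z yA zA; set v := z - y.
have seg s : 0 <= s <= 1 -> box a b (y + s *: v).
  by move=> s01; exact: box_segment.
have := @bounded_derive_lip _ m (fun s => f (y + s *: v) - s *: 'd f y v)
  (fun s => 'd f (y + s *: v) v - 'd f y v) (L * `|v| ^+ 2) 0 1 1 0.
rewrite !scale1r !scale0r addr0 [y + v]addrC subrK !subr0 normr1 mulr1 addrAC.
apply; rewrite ?lexx ?ler01 //.
- move=> s /seg sA.
  have d1 := is_derive_line (df _ sA).
  have d2 : is_derive s (1 : R) (fun s => s *: 'd f y v) ('d f y v).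
    split; first exact/derivable1_diffP.
    by rewrite deriveE // diff_val scale1r.
  exact: is_derive_ext (is_deriveB d1 d2) _ _.
- move=> s s01; have sA := seg s s01; apply: le_trans (dlip _ _ _ yA sA) _.
  rewrite addrC addKr normrZ expr2 !mulrA ler_wpM2r // ler_wpM2r //.
  have /andP[s0 s1] := s01; rewrite ger0_norm //.
  by rewrite -[leRHS]mulr1 ler_wpM2l.
Qed.

End box.

(** * Smooth dependence on the initial value *)

Section flow_regularity.
Context {R : realType}.

Lemma norm_pair_le (V W : normedModType R) (x : V * W) :
  `|x.1| <= `|x| /\ `|x.2| <= `|x|.
Proof. by rewrite prod_normE /= !le_max !lexx orbT. Qed.

Lemma Ck_mulmxr (V : normedModType R) k m n (M : 'M[R]_(m, n)) (A : set V)
    (f : V -> 'rV[R]_m) :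
  open A -> Ck_on k A f -> Ck_on k A (fun x => f x *m M).
Proof.
move=> oA; apply: (@Ck_lin _ _ _ _ k A f (mulmxr M)) => //.
exact/fin_coord_continuous/fin_coord_rV.
Qed.

Lemma Ck_row_mx (V : normedModType R) k m n (A : set V)
    (f : V -> 'rV[R]_m) (g : V -> 'rV[R]_n) :
  open A -> Ck_on k A f -> Ck_on k A g -> Ck_on k A (fun x => row_mx (f x) (g x)).
Proof.
move=> oA Cf Cg.
have -> : (fun x => row_mx (f x) (g x)) =
   (fun x => f x *m row_mx 1%:M 0 + g x *m row_mx 0 1%:M).
  by apply/funext => x; rewrite !mul_mx_row !mulmx1 !mulmx0 add_row_mx addr0 add0r.
by apply: Ck_add => //; exact: Ck_mulmxr.
Qed.

Lemma lsubmxE n1 n2 (v : 'rV[R]_(n1 + n2)) : lsubmx v = v *m col_mx 1%:M 0.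
Proof. by rewrite -[v in RHS]hsubmxK mul_row_col mulmx1 mulmx0 addr0. Qed.

Lemma rsubmxE n1 n2 (v : 'rV[R]_(n1 + n2)) : rsubmx v = v *m col_mx 0 1%:M.
Proof. by rewrite -[v in RHS]hsubmxK mul_row_col mulmx1 mulmx0 add0r. Qed.

Lemma Ck_lsubmx (V : normedModType R) k n1 n2 (A : set V) (f : V -> 'rV[R]_(n1 + n2)) :
  open A -> Ck_on k A f -> Ck_on k A (fun x => lsubmx (f x)).
Proof.
move=> oA Cf; have := Ck_mulmxr (col_mx 1%:M 0 : 'M[R]_(n1 + n2, n1)) oA Cf.
by apply: Ck_ext => // x _; rewrite lsubmxE.
Qed.

Lemma Ck_rsubmx (V : normedModType R) k n1 n2 (A : set V) (f : V -> 'rV[R]_(n1 + n2)) :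
  open A -> Ck_on k A f -> Ck_on k A (fun x => rsubmx (f x)).
Proof.
move=> oA Cf; have := Ck_mulmxr (col_mx 0 1%:M : 'M[R]_(n1 + n2, n2)) oA Cf.
by apply: Ck_ext => // x _; rewrite rsubmxE.
Qed.

Lemma Ck_id (V : normedModType R) k (A : set V) : Ck_on k A id.
Proof. by apply: (@Ck_lin1 _ _ _ k A idfun) => x; exact: cvg_id. Qed.

Lemma Ck_fst (V W : normedModType R) k (A : set (V * W)) : Ck_on k A fst.
Proof. by apply: (@Ck_lin1 _ _ _ k A fst) => x; exact: cvg_fst. Qed.

Lemma Ck_snd (V W : normedModType R) k (A : set (V * W)) : Ck_on k A snd.
Proof. by apply: (@Ck_lin1 _ _ _ k A snd) => x; exact: cvg_snd. Qed.

Lemma mulmx_bound m n (M : 'M[R]_(m, n)) : exists2 C : R, 0 <= C &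
  forall v : 'rV[R]_m, `|v *m M| <= C * `|v|.
Proof.
have [C C0 H] := @linear_lipschitz _ _ _ (mulmxr M : {linear 'rV[R]_m -> 'rV[R]_n})
  (@fin_coord_continuous _ _ _ _ (fin_coord_rV m)).
by exists C => //; exact: ltW.
Qed.

(* [phi] is a family of integral curves of [X] staying in a box, with affine
   initial values. Being affine is preserved by passing to the tangent family. *)
Record flow_family n m (Om : set 'rV[R]_n) (X : 'rV[R]_n -> 'rV[R]_n)
    (a b : 'rV[R]_n) (U : set 'rV[R]_m) (M : 'M[R]_(m, n)) (c : 'rV[R]_n) (e : R)
    (phi : R -> 'rV[R]_m -> 'rV[R]_n) : Prop := FlowFamily {
  ff_open : open Om ;
  ff_smooth : smooth_on Om X ;
  ff_box : box a b `<=` Om ;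
  ff_le : forall j, a 0 j <= b 0 j ;
  ff_dom : open U ;
  ff_e : 0 < e ;
  ff_init : forall p, U p -> phi 0 p = p *m M + c ;
  ff_cont : forall p, U p -> continuous (phi^~ p) ;
  ff_in : forall p t, U p -> `|t| < e -> box a b (phi t p) ;
  ff_derive : forall p t, U p -> `|t| < e ->
    is_derive t (1 : R) (phi^~ p) (X (phi t p)) }.

Lemma open_tube m (U : set 'rV[R]_m) (e : R) : open U ->
  open [set q : R * 'rV[R]_m | `|q.1| < e /\ U q.2].
Proof.
move=> oU.
have -> : [set q : R * 'rV[R]_m | `|q.1| < e /\ U q.2] =
   (fun q => `|q.1|) @^-1` [set y | y < e] `&` snd @^-1` U by [].
apply: openI.
  apply: open_comp; last exact: open_lt.
  by move=> q _; apply: continuous_comp; [exact: cvg_fst|exact: norm_continuous].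
by apply: open_comp => // q _; exact: cvg_snd.
Qed.

Lemma gronwall_sym n (L e : R) : 0 <= L -> exists2 G : R, 0 <= G &
  forall (f f' : R -> 'rV[R]_n) (de t : R), 0 <= de -> `|t| < e ->
  (forall u, `|u| <= `|t| -> is_derive u (1 : R) f (f' u)) ->
  (forall u, `|u| <= `|t| -> `|f' u| <= L * `|f u| + de) ->
  `|f t| <= G * (`|f 0| + de).
Proof.
move=> L0; have [G G0 HG] := @gronwall R n L (2 * e) L0.
exists G => // f f' de t de0 te df H.
apply: (HG f f' de (- `|t|) `|t| 0 t) => //.
- by rewrite opprK; lra.
- by move=> u; rewrite -ler_norml; exact: df.
- by move=> u; rewrite -ler_norml; exact: H.
- by rewrite oppr_le0 normr_ge0.
- by rewrite -ler_norml.
Qed.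

Section family.
Context n m (Om : set 'rV[R]_n) (X : 'rV[R]_n -> 'rV[R]_n)
  (a b : 'rV[R]_n) (U : set 'rV[R]_m) (M : 'M[R]_(m, n)) (c : 'rV[R]_n) (e : R)
  (phi : R -> 'rV[R]_m -> 'rV[R]_n) (F : flow_family Om X a b U M c e phi).

Let CX k : Ck_on k (box a b) X.
Proof. by apply: Ck_sub (ff_box F) _; exact: (ff_smooth F). Qed.

Lemma lt_between_norm (s t u : R) : `|s| < e -> `|t| < e ->
  Num.min s t <= u <= Num.max s t -> `|u| < e.
Proof.
rewrite !ltr_norml minEle maxEle; case: ifPn => _; lra.
Qed.

Lemma flow_init_sub p q : U p -> U q -> phi 0 p - phi 0 q = (p - q) *m M.
Proof.
by move=> Up Uq; rewrite !(ff_init F) // opprD addrACA subrr addr0 mulmxBl.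
Qed.

(** Gronwall's lemma handles the change of initial value, the bound of [X] on the box the change of
    time. *)
Lemma flow_lip : exists2 C : R, 0 <= C &
  forall s t p q, `|s| < e -> `|t| < e -> U p -> U q ->
  `|phi t p - phi s q| <= C * `|p - q| + C * `|t - s|.
Proof.
have e0 := ff_e F.
have [L L0 [_ HL]] := box_lip (@CX 1).
have [B B0 HB] := box_bound (@CX 0).
have [G G0 HG] := @gronwall_sym n L e L0.
have [K K0 HK] := mulmx_bound M.
exists (G * K + B) => [|s t p q se te Up Uq]; first by rewrite addr_ge0 ?mulr_ge0.
have H1 : `|phi t p - phi t q| <= G * K * `|p - q|.
  have te' (u : R) : `|u| <= `|t| -> `|u| < e by move=> /le_lt_trans; apply.
  have D (u : R) : `|u| <= `|t| ->
      is_derive u (1 : R) (fun u => phi u p - phi u q) (X (phi u p) - X (phi u q)).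
    move=> /te' ue.
    exact: is_derive_ext (is_deriveB (ff_derive F Up ue) (ff_derive F Uq ue)) _ _.
  have D' (u : R) : `|u| <= `|t| ->
      `|X (phi u p) - X (phi u q)| <= L * `|phi u p - phi u q| + 0.
    by move=> /te' ue; rewrite addr0; apply: HL; exact: (ff_in F).
  have H := HG _ _ 0 t (lexx _) te D D'.
  apply: le_trans H _; rewrite addr0 (flow_init_sub Up Uq) -mulrA.
  exact: (ler_wpM2l G0 (HK _)).
have H2 : `|phi t q - phi s q| <= B * `|t - s|.
  apply: (@bounded_derive_lip _ n (phi^~ q) (fun u => X (phi u q)) B (Num.min s t) (Num.max s t)).
  - by move=> u /(lt_between_norm se te) ue; exact: (ff_derive F).
  - by move=> u /(lt_between_norm se te) ue; apply: HB; exact: (ff_in F).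
  - by rewrite ge_min le_max !lexx !orbT.
  - by rewrite ge_min le_max !lexx ?orbT.
rewrite -(subrKA (phi t q)); apply: le_trans (ler_normD _ _) _.
have := mulr_ge0 B0 (normr_ge0 (p - q)).
have := mulr_ge0 (mulr_ge0 G0 K0) (normr_ge0 (t - s)).
by rewrite !mulrDl; lra.
Qed.

Lemma flow_continuous :
  Ck_on 0 [set q : R * 'rV[R]_m | `|q.1| < e /\ U q.2] (fun q => phi q.1 q.2).
Proof.
have [C C0 H] := flow_lip.
move=> x xA; apply: (@lip_continuous _ _ _ (C + C)).
apply: (open_nearS (open_tube (ff_dom F)) xA) => y [ye yU].
have [xe xU] := xA; apply: le_trans (H _ _ _ _ ye xe xU yU) _.
have [n1 n2] := norm_pair_le (x - y).
by rewrite mulrDl; apply: lerD; apply: ler_wpM2l.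
Qed.

(** The right-hand side of the variational equation; clamping [phi t p] extends it to all times, as
    [picard] requires. *)
Lemma diff_clamp_continuous p (y : R -> 'rV[R]_n) : U p -> continuous y ->
  continuous (fun t => 'd X (clamp a b (phi t p)) (y t)).
Proof.
move=> Up cy.
have -> : (fun t => 'd X (clamp a b (phi t p)) (y t)) =
    (fun t => \sum_j y t 0 j *: 'd X (clamp a b (phi t p)) (delta_mx 0 j)).
  by apply/funext => t; exact: diff_row.
have C0 : Ck_on 0 setT (fun t =>
    \sum_j y t 0 j *: 'd X (clamp a b (phi t p)) (delta_mx 0 j)).
  apply: Ck_sum => [|j]; first exact: openT.
  apply: Ck_scale; first exact: openT.
    move=> t _; apply: (@continuous_comp _ _ _ y (fun v : 'rV[R]_n => v 0 j)).
      exact: cy.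
    exact: coord_continuous.
  move=> t _.
  apply: (@continuous_comp _ _ _ (fun t => clamp a b (phi t p)) (fun z => 'd X z (delta_mx 0 j))).
    by apply: continuous_comp; [exact: (ff_cont F)|exact: clamp_continuous].
  have [_ /(_ (delta_mx 0 j))] := @CX 1; apply.
  exact/clamp_box/(ff_le F).
by move=> t; exact: C0.
Qed.

(** [v p t h] solves the equation linearised along [phi^~ p] and is the derivative of [phi t] at [p]
    in the direction [h]. The error [phi t (p + h) - phi t p - v p t h] starts at 0 and solves the
    same linear equation up to the Taylor remainder of [X], which [flow_lip] makes quadratic in [h];
    Gronwall's lemma concludes. *)
Lemma flow_variation : exists v : 'rV[R]_m -> R -> 'rV[R]_m -> 'rV[R]_n,
  [/\ forall p t, linear (v p t),
    forall p h, U p -> v p 0 h = h *m M,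
    forall p h, U p -> continuous (v p ^~ h),
    forall p h t, U p -> `|t| < e ->
      is_derive t (1 : R) (v p ^~ h) ('d X (phi t p) (v p t h)) &
    exists C : R, [/\ 0 <= C,
      forall p h t, U p -> `|t| < e -> `|v p t h| <= C * `|h| &
      forall p h t, U p -> U (p + h) -> `|t| < e ->
        `|phi t (p + h) - phi t p - v p t h| <= C * `|h| ^+ 2]].
Proof.
have e0 := ff_e F.
have [L L0 [HL _]] := box_lip (@CX 1).
have [Q Q0 HQ] := box_quad (@CX 2).
have [G G0 HG] := @gronwall_sym n L e L0.
have [K K0 HK] := mulmx_bound M.
have [C C0 HC] := flow_lip.
(* One solution for each basis vector of the initial space; [v] combines them and is thus linear in
   [h] by construction. *)
have /choice[w Hw] (pj : 'rV[R]_m * 'I_m) : exists w : R -> 'rV[R]_n, U pj.1 ->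
    w 0 = row pj.2 M /\ forall t, is_derive t (1 : R) w ('d X (clamp a b (phi t pj.1)) (w t)).
  case: (pselect (U pj.1)) => [Up|nU]; last by exists (fun=> 0) => /nU.
  have [||t y z|w [w0 dw]] := @picard R n (fun t y => 'd X (clamp a b (phi t pj.1)) y)
    (L + 1) _ _ _ (row pj.2 M).
  - by rewrite ltr_wpDl.
  - by move=> y; exact: diff_clamp_continuous.
  - rewrite -linearB; apply: le_trans (HL _ _ _) _; first exact/clamp_box/(ff_le F).
    by rewrite ler_wpM2r // lerDl.
  by exists w.
pose v (p : 'rV[R]_m) (t : R) (h : 'rV[R]_m) : 'rV[R]_n := \sum_j h 0 j *: w (p, j) t.
have vlin p t : linear (v p t).
  move=> r h h'; rewrite /v scaler_sumr -big_split /=; apply: eq_bigr => j _.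
  by rewrite !mxE scalerDl scalerA.
have v0 p h : U p -> v p 0 h = h *m M.
  move=> Up; rewrite mulmx_sum_row; apply: eq_bigr => j _.
  by have [-> _] := Hw (p, j) Up.
have dv p h t : U p -> is_derive t (1 : R) (v p ^~ h) ('d X (clamp a b (phi t p)) (v p t h)).
  move=> Up.
  have -> : v p ^~ h = \sum_(j < m) (fun t => h 0 j *: w (p, j) t).
    by apply/funext => s; rewrite /v fct_sumE.
  rewrite [in X in is_derive _ _ _ X]/v linear_sum.
  apply: is_derive_sum => j; rewrite linearZ.
  have [_ dw] := Hw (p, j) Up.
  exact: is_derive_ext (is_deriveZ (h 0 j) (dw t)) _ _.
clearbody v.
have dv' p h t : U p -> `|t| < e ->
    is_derive t (1 : R) (v p ^~ h) ('d X (phi t p) (v p t h)).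
  by move=> Up te; have := dv p h t Up; rewrite clamp_id //; exact: (ff_in F).
have vb p h t : U p -> `|t| < e -> `|v p t h| <= G * K * `|h|.
  move=> Up te; have te' (u : R) : `|u| <= `|t| -> `|u| < e by move=> /le_lt_trans; apply.
  have D' (u : R) : `|u| <= `|t| -> `|'d X (phi u p) (v p u h)| <= L * `|v p u h| + 0.
    by move=> /te' ue; rewrite addr0; apply: HL; exact: (ff_in F).
  have H := HG _ _ 0 t (lexx _) te (fun u ut => dv' p h u Up (te' u ut)) D'.
  apply: le_trans H _; rewrite addr0 (v0 p h Up) -mulrA.
  exact: (ler_wpM2l G0 (HK h)).
have vq p h t : U p -> U (p + h) -> `|t| < e ->
    `|phi t (p + h) - phi t p - v p t h| <= G * Q * C ^+ 2 * `|h| ^+ 2.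
  move=> Up Uph te; have te' (u : R) : `|u| <= `|t| -> `|u| < e by move=> /le_lt_trans; apply.
  have D (u : R) : `|u| <= `|t| ->
      is_derive u (1 : R) (fun u => phi u (p + h) - phi u p - v p u h)
        (X (phi u (p + h)) - X (phi u p) - 'd X (phi u p) (v p u h)).
    move=> /te' ue.
    exact: is_derive_ext (is_deriveB (is_deriveB (ff_derive F Uph ue) (ff_derive F Up ue)) (dv' p h u Up ue)) _ _.
  have D' (u : R) : `|u| <= `|t| ->
      `|X (phi u (p + h)) - X (phi u p) - 'd X (phi u p) (v p u h)| <=
      L * `|phi u (p + h) - phi u p - v p u h| + Q * C ^+ 2 * `|h| ^+ 2.
    move=> /te' ue.
    have := HQ _ _ (ff_in F Up ue) (ff_in F Uph ue).
    have := HC u u (p + h) p ue ue Uph Up.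
    have := HL _ (phi u (p + h) - phi u p - v p u h) (ff_in F Up ue).
    move: (phi u p) (phi u (p + h)) (v p u h) => y z w' H1.
    rewrite subrr normr0 mulr0 addr0 [p + h]addrC addrK => H2 H3.
    (* Taylor remainder of [X] plus the linear equation applied to the error. *)
    have -> : X z - X y - 'd X y w' =
       (X z - X y - 'd X y (z - y)) + 'd X y (z - y - w').
      by rewrite (linearB ('d X y) (z - y)) /= addrA subrK.
    apply: le_trans (ler_normD _ _) _; rewrite addrC; apply: lerD => //.
    apply: le_trans H3 _.
    rewrite -mulrA ler_wpM2l // -exprMn ler_pXn2r ?nnegrE //.
    by rewrite mulr_ge0.
  have de0 : 0 <= Q * C ^+ 2 * `|h| ^+ 2.
    by rewrite mulr_ge0 ?sqr_ge0 // mulr_ge0 ?sqr_ge0.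
  have H := HG _ _ _ t de0 te D D'.
  apply: le_trans H _.
  rewrite (flow_init_sub Uph Up) (v0 p h Up) [p + h]addrC addrK subrr normr0 add0r.
  by rewrite !mulrA.
exists v; split => //.
  by move=> p h Up; apply: derive_continuous => t; exact: dv.
have GK0 : 0 <= G * K by rewrite mulr_ge0.
have GQ0 : 0 <= G * Q * C ^+ 2 by rewrite !mulr_ge0 // sqr_ge0.
exists (G * K + G * Q * C ^+ 2); split.
- by rewrite addr_ge0.
- move=> p h t Up te; apply: le_trans (vb p h t Up te) _.
  by rewrite ler_wpM2r // lerDl.
- move=> p h t Up Uph te; apply: le_trans (vq p h t Up Uph te) _.
  by rewrite ler_wpM2r ?sqr_ge0 // lerDr.
Qed.

End family.
End flow_regularity.

(** * The tangent field and C^k regularity of flows *)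

Section flow_smooth.
Context {R : realType}.

(** The complete lift of [X] to the tangent bundle: its integral curves pair an integral curve of
    [X] with a solution of the variational equation along it. *)
Definition tangent_field n (X : 'rV[R]_n -> 'rV[R]_n) (z : 'rV[R]_(n + n)) :
    'rV[R]_(n + n) :=
  row_mx (X (lsubmx z)) ('d X (lsubmx z) (rsubmx z)).

Lemma tangent_field_smooth n (Om : set 'rV[R]_n) (X : 'rV[R]_n -> 'rV[R]_n) :
  open Om -> smooth_on Om X ->
  open [set z : 'rV[R]_(n + n) | Om (lsubmx z)] /\
  smooth_on [set z : 'rV[R]_(n + n) | Om (lsubmx z)] (tangent_field X).
Proof.
move=> oOm sX.
have oT : open [set z : 'rV[R]_(n + n) | Om (lsubmx z)].
  by apply: open_comp => // z _; exact: continuous_lsubmx.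
split => // k.
have Cl : Ck_on k [set z : 'rV[R]_(n + n) | Om (lsubmx z)] lsubmx.
  exact: (Ck_lsubmx oT (@Ck_id _ _ _ _)).
have Cr : Ck_on k [set z : 'rV[R]_(n + n) | Om (lsubmx z)] rsubmx.
  exact: (Ck_rsubmx oT (@Ck_id _ _ _ _)).
have Ccomp (f : 'rV[R]_n -> 'rV[R]_n) : Ck_on k Om f ->
    Ck_on k [set z : 'rV[R]_(n + n) | Om (lsubmx z)] (fun z => f (lsubmx z)).
  by move=> Cf; apply: (Ck_comp (fin_coord_rV n) oT _ Cl Cf).
apply: Ck_row_mx => //; first exact/Ccomp/sX.
have : Ck_on k [set z : 'rV[R]_(n + n) | Om (lsubmx z)]
    (fun z => \sum_j (rsubmx z : 'rV[R]_n) 0 j *: 'd X (lsubmx z) (delta_mx 0 j)).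
  apply: Ck_sum => // j; apply: Ck_scale => //.
    apply: (Ck_lin (l := @coord_mx R 1 n 0 j)) => //; exact: coord_continuous.
  apply: (Ccomp (fun y => 'd X y (delta_mx 0 j))).
  by have [_] := sX k.+1; apply.
by apply: Ck_ext => // z _; rewrite -diff_row.
Qed.

Lemma is_derive_mulmxr m n (M : 'M[R]_(m, n)) (f : R -> 'rV[R]_m) t f' :
  is_derive t (1 : R) f f' -> is_derive t (1 : R) (fun s => f s *m M) (f' *m M).
Proof.
move=> df; pose l := mulmxr M : {linear 'rV[R]_m -> 'rV[R]_n}.
have cl : continuous l by exact/fin_coord_continuous/fin_coord_rV.
have dl : differentiable l (f t) by exact: linear_differentiable.
have := is_derive_chain df dl.
by rewrite diff_lin.
Qed.

Lemma is_derive_row_mx m n (f : R -> 'rV[R]_m) (g : R -> 'rV[R]_n) (t : R) f' g' :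
  is_derive t (1 : R) f f' -> is_derive t (1 : R) g g' ->
  is_derive t (1 : R) (fun s => row_mx (f s) (g s)) (row_mx f' g').
Proof.
move=> df dg.
apply: is_derive_ext (is_deriveD (is_derive_mulmxr (row_mx 1%:M 0) df)
  (is_derive_mulmxr (row_mx 0 1%:M) dg)) _ _ => [y|] /=.
  by rewrite -[(_ + _ : R -> _) y]/(_ + _) !mul_mx_row !mulmx1 !mulmx0 add_row_mx addr0 add0r.
by rewrite !mul_mx_row !mulmx1 !mulmx0 add_row_mx addr0 add0r.
Qed.

Lemma continuous_row_mx m n (f : R -> 'rV[R]_m) (g : R -> 'rV[R]_n) :
  continuous f -> continuous g -> continuous (fun s => row_mx (f s) (g s)).
Proof.
move=> cf cg t.
have : Ck_on 0 setT (fun s => row_mx (f s) (g s)).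
  by apply: Ck_row_mx; [exact: openT|move=> ? _; exact: cf|move=> ? _; exact: cg].
by apply.
Qed.

(** The differential consists of [X] composed with the flow and of the variation [v]. For a fixed
    direction, [v] is a component of a family of integral curves of the tangent field, so the
    induction on [k] runs over all dimensions and fields at once. *)
Lemma flow_smooth k : forall n m (Om : set 'rV[R]_n) (X : 'rV[R]_n -> 'rV[R]_n)
  (a b : 'rV[R]_n) (U : set 'rV[R]_m) (M : 'M[R]_(m, n)) (c : 'rV[R]_n) (e : R)
  (phi : R -> 'rV[R]_m -> 'rV[R]_n), flow_family Om X a b U M c e phi ->
  Ck_on k [set q : R * 'rV[R]_m | `|q.1| < e /\ U q.2] (fun q => phi q.1 q.2).
Proof.
elim: k => [|k IH] n m Om X a b U M c e phi F; first exact: flow_continuous F.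
have [v [vlin v0 vcont dv [C [C0 vb vq]]]] := flow_variation F.
have oA := @open_tube R m U e (ff_dom F).
set A := [set q : R * 'rV[R]_m | _] in oA *.
have CXb k' : Ck_on k' (box a b) X.
  by apply: Ck_sub (ff_box F) _; exact: (ff_smooth F).
have [L L0 [_ HL]] := box_lip (@CXb 1).
have [K K0 HK] := flow_lip F.
have inA x : A x -> Om (phi x.1 x.2).
  by move=> [xe xU]; apply: (ff_box F); exact: (ff_in F).
apply: (@Ck_diffI R (R * 'rV[R]_m)%type 'rV[R]_n k A (fun q => phi q.1 q.2)
  (fun x w => w.1 *: X (phi x.1 x.2) + v x.2 x.1 w.2)) => //.
- move=> x xA; have [xe xU] := xA.
  set d := (d in is_diff _ _ d).
  have lind : linear d.
    move=> r w w'; rewrite /d /= vlin scalerDl -[_ *: w.1]/(r * w.1) -scalerA.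
    by rewrite scalerDr addrACA.
  pose dlM := GRing.isLinear.Build _ _ _ _ _ lind.
  pose dL : {linear _ -> _} := HB.pack d dlM.
  have cd : continuous dL.
    exact/fin_coord_continuous/fin_coord_prod/fin_coord_rV/fin_coord_real.
  apply: (@is_diff_quad _ _ _ _ dL (2 * L * K + C)) => //.
  have N : \forall h \near 0, A (x + h).
    have : \forall y \near x, A y by exact: open_near.
    by rewrite (near_shift 0) /=; apply: filterS => h; rewrite /= subr0 addrC.
  apply: filterS N => -[r h] [/= re Uh]; rewrite /dL /= /d /=.
  set N := `|(r, h)|.
  have [/= N1 N2] := norm_pair_le (r, h); rewrite -/N in N1 N2.
  have N0 : 0 <= N by exact: normr_ge0.
  set p := x.2; set t := x.1.
  (* The increment is split into a time step at [p + h] and a space step at time [t]. During the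
     time step the velocity differs from [X (phi t p)] by at most [L K (|h| + |r|) <= 2 L K N]. *)
  have E1 : `|phi (t + r) (p + h) - phi t (p + h) - r *: X (phi t p)| <= 2 * L * K * N ^+ 2.
    have bt (u : R) : Num.min t (t + r) <= u <= Num.max t (t + r) ->
        `|u| < e /\ `|u - t| <= `|r|.
      move=> ur; split; first exact: (lt_between_norm xe re ur).
      move: ur; rewrite minEle maxEle; case: ifPn => H ur; rewrite ler_norml.
        have r0 : 0 <= r by lra.
        rewrite ger0_norm //; lra.
      have r0 : r <= 0 by rewrite -ltNge in H; lra.
      rewrite ler0_norm //; lra.
    have D (u : R) : Num.min t (t + r) <= u <= Num.max t (t + r) ->
        is_derive u (1 : R) (fun u => phi u (p + h) - u *: X (phi t p))
          (X (phi u (p + h)) - X (phi t p)).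
      move=> /bt [ue _].
      have d2 : is_derive u (1 : R) (fun s => s *: X (phi t p)) (X (phi t p)).
        split; first exact/derivable1_diffP.
        by rewrite deriveE // diff_val scale1r.
      exact: is_derive_ext (is_deriveB (ff_derive F Uh ue) d2) _ _.
    have D' (u : R) : Num.min t (t + r) <= u <= Num.max t (t + r) ->
        `|X (phi u (p + h)) - X (phi t p)| <= 2 * L * K * N.
      move=> /bt [ue ut].
      have := HL _ _ (ff_in F xU xe) (ff_in F Uh ue) => /le_trans; apply.
      rewrite [2 * L]mulrC -!mulrA ler_wpM2l //.
      have := HK t u (p + h) p xe ue Uh xU => /le_trans; apply.
      rewrite [p + h]addrC addrK.
      have H1 := ler_wpM2l K0 N2; have H2 := ler_wpM2l K0 (le_trans ut N1).
      by rewrite mulr2n mulrDl mul1r; lra.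
    have := @bounded_derive_lip _ n _ _ _ _ _ (t + r) t D D'.
    rewrite !ge_min !le_max !lexx !orbT => /(_ isT isT) H.
    have E : phi (t + r) (p + h) - phi t (p + h) - r *: X (phi t p) =
       phi (t + r) (p + h) - (t + r) *: X (phi t p) - (phi t (p + h) - t *: X (phi t p)).
      by apply/rowP => i; rewrite !mxE; ring.
    rewrite E; apply: le_trans H _.
    rewrite addrAC subrr add0r expr2 mulrA ler_wpM2l //.
    by rewrite !mulr_ge0.
  have E2 := vq p h t xU Uh xe.
  have -> : phi (t + r) (p + h) - phi t p - (r *: X (phi t p) + v p t h) =
     (phi (t + r) (p + h) - phi t (p + h) - r *: X (phi t p)) +
     (phi t (p + h) - phi t p - v p t h).
    by apply/rowP => i; rewrite !mxE; ring.
  apply: le_trans (ler_normD _ _) _; rewrite mulrDl; apply: lerD => //.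
  apply: le_trans E2 _; rewrite ler_wpM2l // ler_pXn2r ?nnegrE //.
- move=> w; apply: Ck_add => //.
    apply: Ck_scale => //; first exact: Ck_cst.
    apply: (Ck_comp (fin_coord_rV n) oA inA (IH _ _ _ _ _ _ _ _ _ _ _ F)).
    exact: (ff_smooth F).
  (* The direction is frozen: it becomes a constant in the affine initial value of the lifted
     family. *)
  have [h Ehh] : {h | h = w.2} by exists w.2.
  rewrite -Ehh.
  (* By [vb] the variation stays in the cube of half-side [D], which completes the box of the lifted
     family. *)
  pose D := C * `|h|.
  have [oT sT] := tangent_field_smooth (ff_open F) (ff_smooth F).
  have FT : flow_family [set z : 'rV[R]_(n + n) | Om (lsubmx z)] (tangent_field X)
    (row_mx a (const_mx (- D))) (row_mx b (const_mx D)) U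
    (row_mx M 0) (row_mx c (h *m M)) e (fun t p => row_mx (phi t p) (v p t h)).
    split => //.
    - move=> z zb; apply: (ff_box F) => j; have := zb (lshift n j).
      by rewrite !row_mxEl !mxE.
    - move=> j; case: (splitP j) => i Ei.
        have -> : j = lshift n i by apply: val_inj.
        by rewrite !row_mxEl; exact: (ff_le F).
      have -> : j = rshift n i by apply: val_inj.
      rewrite !row_mxEr !mxE; have : 0 <= D by rewrite mulr_ge0.
      by lra.
    - exact: (ff_dom F).
    - exact: (ff_e F).
    - move=> p Up; rewrite (ff_init F Up) v0 // mul_mx_row mulmx0 add_row_mx add0r //.
    - by move=> p Up; apply: continuous_row_mx; [exact: (ff_cont F)|exact: vcont].
    - move=> p t Up te j; case: (splitP j) => i Ei.
        have -> : j = lshift n i by apply: val_inj.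
        by rewrite !row_mxEl; exact: (ff_in F).
      have -> : j = rshift n i by apply: val_inj.
      rewrite !row_mxEr !mxE -ler_norml; apply: le_trans (vb p h t Up te).
      exact: mx_norm_ge.
    - move=> p t Up te; rewrite /tangent_field row_mxKl row_mxKr.
      by apply: is_derive_row_mx; [exact: (ff_derive F)|exact: dv].
  have := Ck_rsubmx oA (IH _ _ _ _ _ _ _ _ _ _ _ FT).
  by apply: Ck_ext => // q _; rewrite row_mxKr.
Qed.

End flow_smooth.

(** * Local flows in R^n *)

Section local_existence.
Context {R : realType}.

Lemma local_flow_rV n (Om : set 'rV[R]_n) (X : 'rV[R]_n -> 'rV[R]_n) x0 :
  open Om -> smooth_on Om X -> Om x0 ->
  exists (e : R) (U : set 'rV[R]_n) (phi : R -> 'rV[R]_n -> 'rV[R]_n),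
  [/\ 0 < e, open U, U x0, U `<=` Om &
   [/\ forall p, U p -> phi 0 p = p,
    forall p t, U p -> `|t| < e -> Om (phi t p),
    forall p t, U p -> `|t| < e -> is_derive t (1 : R) (phi^~ p) (X (phi t p)) &
    smooth_on [set q : R * 'rV[R]_n | `|q.1| < e /\ U q.2] (fun q => phi q.1 q.2)]].
Proof.
move=> oOm sX Ox0.
have /nbhs_normP[r2 /= r20 Hr] : \forall y \near x0, Om y by exact: open_near.
pose r := r2 / 2; have r0 : 0 < r by rewrite divr_gt0.
pose a : 'rV[R]_n := x0 - const_mx r; pose b : 'rV[R]_n := x0 + const_mx r.
have inbox y : `|y - x0| <= r -> box a b y.
  move=> yr j; rewrite !mxE.
  have := le_trans (mx_norm_ge (y - x0) 0 j) yr; rewrite !mxE ler_norml; lra.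
have boxOm : box a b `<=` Om.
  move=> y yb; apply: Hr; rewrite /= distrC.
  apply: (@le_lt_trans _ _ r); last by rewrite /r; lra.
  apply/mx_norm_leP; first exact: ltW.
  by move=> i j; rewrite ord1; have := yb j; rewrite !mxE ler_norml; lra.
have ab j : a 0 j <= b 0 j by rewrite !mxE; lra.
have CX k : Ck_on k (box a b) X by apply: Ck_sub boxOm _; exact: sX.
have [L L0 [_ HL]] := box_lip (CX 1%N).
have [B B0 HB] := box_bound (CX 0%N).
(* The clamped field has integral curves from every point for all times, whether or not they leave
   the box. *)
have /choice[w Hw] (p : 'rV[R]_n) : exists w : R -> 'rV[R]_n,
    w 0 = p /\ forall t, is_derive t (1 : R) w (X (clamp a b (w t))).
  apply: (@picard R n (fun t y => X (clamp a b y)) (L + 1)).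
  - by rewrite ltr_wpDl.
  - move=> y cy t; apply: (@continuous_comp _ _ _ (fun t => clamp a b (y t)) X).
      by apply: continuous_comp; [exact: cy|exact: clamp_continuous].
    exact/(CX 0%N)/clamp_box.
  - move=> t y z; apply: le_trans (HL _ _ (clamp_box _ ab) (clamp_box _ ab)) _.
    apply: ler_pM => //; first by rewrite lerDl.
    exact: clamp_lip.
pose phi t p := w p t.
(* The speed is at most [B], so a curve starting within [r / 2] of [x0] stays within [r] of it up to
   time [e]; [B + 1] avoids a division by 0. *)
pose e := r / 2 / (B + 1).
have B1 : 0 < B + 1 by rewrite ltr_wpDl.
have e0 : 0 < e by rewrite divr_gt0 // divr_gt0.
pose U := [set p : 'rV[R]_n | `|p - x0| < r / 2].
have oU : open U.
  rewrite /U -[X in open X]/((fun p => `|p - x0|) @^-1` [set y | y < r / 2]).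
  apply: open_comp; last exact: open_lt.
  move=> p _; apply: continuous_comp; last exact: norm_continuous.
  by apply: continuousB => //; exact: cst_continuous.
have inb p t : U p -> `|t| < e -> box a b (phi t p).
  move=> Up te; apply: inbox.
  have [w0 dw] := Hw p.
  have := @bounded_derive_lip _ n (w p) (fun t => X (clamp a b (w p t))) B (- `|t|) `|t| t 0.
  rewrite w0 subr0 => H.
  have {}H : `|w p t - p| <= B * `|t|.
    apply: H => //.
    - by move=> u _; apply: HB; exact: clamp_box.
    - by rewrite -ler_norml.
    - by rewrite oppr_le0 normr_ge0.
  rewrite -(subrKA p); apply: le_trans (ler_normD _ _) _.
  have : B * `|t| <= r / 2.
    apply: (@le_trans _ _ ((B + 1) * e)); last by rewrite /e mulrC divfK // gt_eqF.
    apply: ler_pM => //; last exact: ltW.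
    by rewrite lerDl.
  move: Up; rewrite /U /=; rewrite /phi; lra.
have F : flow_family Om X a b U 1%:M 0 e phi.
  split => //.
  - by move=> p Up; have [w0 _] := Hw p; rewrite /phi w0 mulmx1 addr0.
  - by move=> p Up; have [_ /derive_continuous] := Hw p.
  - move=> p t Up te; have [_ /(_ t)] := Hw p.
    by have := clamp_id (inb p t Up te); rewrite /phi => ->.
exists e, U, phi; split => //.
- by rewrite /U /= subrr normr0 divr_gt0.
- by move=> p Up; apply: boxOm; apply: inbox; move: Up; rewrite /U /=; lra.
split => //.
- by move=> p _; have [w0 _] := Hw p; rewrite /phi w0.
- by move=> p t Up te; apply: boxOm; exact: inb.
- by move=> p t Up te; exact: (ff_derive F).
- by move=> k; exact: flow_smooth F.
Qed.

End local_existence.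

(** * Symmetry of second derivatives, connectedness and matrix calculus *)

Section calculus.
Context {R : realType}.

(** The second difference of [f] over the parallelogram with sides [s u] and [s w] is symmetric in
    [u] and [w]. Two successive mean value estimates compare it with [s^2] times the second
    derivative taken in one order. *)
Lemma schwarz_aux (V : normedModType R) n (A : set V) (f : V -> 'rV[R]_n) x u w (e : R) :
  open A -> A x -> Ck_on 2 A f -> 0 < e ->
  exists2 d : R, 0 < d & forall s : R, 0 < s < d ->
  `|(f (x + s *: u + s *: w) - f (x + s *: u)) - (f (x + s *: w) - f x)
    - (s * s) *: 'd (fun y => 'd f y u) x w| <= e * (s * s).
Proof.
move=> oA Ax [df Cdf] e0.
have [dfu Cdfu] := Cdf u.
set D := 'd (fun y => 'd f y u) x w.
have cD : {for x, continuous (fun y => 'd (fun y => 'd f y u) y w)} by exact: Cdfu.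
have N0 := open_near oA Ax.
move/cvgrPdist_le : cD => /(_ e e0) cD.
have N1 : \forall y \near x, A y /\ `|D - 'd (fun y => 'd f y u) y w| <= e.
  by near=> y; split; near: y.
have /nbhs_normP[d /= d0 Hd] := N1.
(* [s < d / m] keeps the whole parallelogram within [d] of [x]; the summand 1 makes [m] positive. *)
pose m := `|u| + `|w| + 1.
have m0 : 0 < m by rewrite /m; have := normr_ge0 u; have := normr_ge0 w; lra.
exists (d / m) => [|s /andP[s0 sd]]; first exact: divr_gt0.
have inA (r q : R) : 0 <= r <= s -> 0 <= q <= s ->
    A (x + r *: u + q *: w) /\ `|D - 'd (fun y => 'd f y u) (x + r *: u + q *: w) w| <= e.
  move=> /andP[r0 rs] /andP[q0 qs]; apply: Hd.
  rewrite /= -addrA opprD addrA subrr add0r normrN.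
  apply: le_lt_trans (ler_normD _ _) _; rewrite !normrZ !ger0_norm //.
  apply: (@le_lt_trans _ _ (s * (`|u| + `|w|))).
    by rewrite mulrDr; apply: lerD; apply: ler_wpM2r.
  apply: (@lt_le_trans _ _ (s * m)); first by rewrite ltr_pM2l // /m; lra.
  by rewrite -ler_pdivlMr // ltW.
have dscal (F : 'rV[R]_n) (t : R) : is_derive t (1 : R) (fun t => t *: F) F.
  split; first exact/derivable1_diffP.
  by rewrite deriveE // diff_val scale1r.
(* First the mean value estimate for ['d f] in the direction [w]; the one for [f] in the direction
   [u] then integrates it over [r]. *)
have inner (r : R) : 0 <= r <= s ->
    `|'d f (x + r *: u + s *: w) u - 'd f (x + r *: u) u - s *: D| <= e * s.
  move=> rs.
  have H := @bounded_derive_lip R n (fun q => 'd f (x + r *: u + q *: w) u - q *: D)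
    (fun q => 'd (fun y => 'd f y u) (x + r *: u + q *: w) w - D) e 0 s s 0.
  have {}H : `|'d f (x + r *: u + s *: w) u - s *: D -
      ('d f (x + r *: u + 0 *: w) u - 0 *: D)| <= e * `|s - 0|.
    apply: H.
    - move=> q qs; have [Ay _] := inA r q rs qs.
      exact: is_derive_ext (is_deriveB (is_derive_line (dfu _ Ay)) (dscal D q)) _ _.
    - by move=> q qs; have [_] := inA r q rs qs; rewrite distrC.
    - by rewrite lexx ltW.
    - by rewrite lexx ltW.
  move: H; rewrite !scale0r addr0 !subr0 (ger0_norm (ltW s0)).
  by congr (`|_| <= _); apply/rowP => i; rewrite !mxE; ring.
have H := @bounded_derive_lip R n (fun r => f (x + s *: w + r *: u) - f (x + r *: u) - r *: (s *: D))
    (fun r => 'd f (x + s *: w + r *: u) u - 'd f (x + r *: u) u - s *: D) (e * s) 0 s s 0.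
have {}H : `|f (x + s *: w + s *: u) - f (x + s *: u) - s *: (s *: D) -
   (f (x + s *: w + 0 *: u) - f (x + 0 *: u) - 0 *: (s *: D))| <= e * s * `|s - 0|.
  apply: H.
  - move=> r rs.
    have ss : 0 <= s <= s by rewrite lexx ltW.
    have zs : 0 <= (0 : R) <= s by rewrite lexx ltW.
    have [A1 _] := inA r s rs ss.
    have [A2 _] := inA r 0 rs zs.
    rewrite scale0r addr0 in A2.
    have dA1 : differentiable f (x + s *: w + r *: u) by apply: df; rewrite addrAC.
    exact: is_derive_ext (is_deriveB (is_deriveB (is_derive_line dA1) (is_derive_line (df _ A2))) (dscal _ r)) _ _.
  - by move=> r /inner; rewrite (addrAC x (r *: u)).
  - by rewrite lexx ltW.
  - by rewrite lexx ltW.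
move: H; rewrite !scale0r !addr0 !subr0 (ger0_norm (ltW s0)) -mulrA [x + s *: u + _]addrAC.
by congr (`|_| <= _); apply/rowP => i; rewrite !mxE; ring.
Unshelve. all: by end_near. Qed.

Lemma schwarz (V : normedModType R) n (A : set V) (f : V -> 'rV[R]_n) x u w :
  open A -> A x -> Ck_on 2 A f ->
  'd (fun y => 'd f y u) x w = 'd (fun y => 'd f y w) x u.
Proof.
move=> oA Ax Cf; apply/eqP; rewrite -subr_eq0 -normr_le0; apply/ler_addgt0Pr => e e0; rewrite add0r.
have e2 : 0 < e / 2 by rewrite divr_gt0.
have [d1 d10 H1] := schwarz_aux u w oA Ax Cf e2.
have [d2 d20 H2] := schwarz_aux w u oA Ax Cf e2.
pose s := Num.min d1 d2 / 2.
have m0 : 0 < Num.min d1 d2 by rewrite lt_min d10.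
have s0 : 0 < s by rewrite divr_gt0.
have sm : s < Num.min d1 d2 by rewrite /s; lra.
have /andP[s1 s2] : (s < d1) && (s < d2) by rewrite -lt_min.
have ss0 : 0 < s * s by rewrite mulr_gt0.
have K (D1 D2 : 'rV[R]_n) :
  `|(f (x + s *: u + s *: w) - f (x + s *: u)) - (f (x + s *: w) - f x)
    - (s * s) *: D1| <= e / 2 * (s * s) ->
  `|(f (x + s *: w + s *: u) - f (x + s *: w)) - (f (x + s *: u) - f x)
    - (s * s) *: D2| <= e / 2 * (s * s) -> `|D1 - D2| <= e.
  move=> K1 K2; rewrite -(@ler_pM2l _ (s * s)) //.
  have -> : s * s * `|D1 - D2| = `|(s * s) *: (D1 - D2)| by rewrite normrZ gtr0_norm.
  have -> : (s * s) *: (D1 - D2) =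
    (f (x + s *: w + s *: u) - f (x + s *: w) - (f (x + s *: u) - f x) - (s * s) *: D2) -
    (f (x + s *: u + s *: w) - f (x + s *: u) - (f (x + s *: w) - f x) - (s * s) *: D1).
    rewrite [x + s *: w + _]addrAC.
    by apply/rowP => i; rewrite !mxE; ring.
  apply: le_trans (ler_normB _ _) _.
  apply: le_trans (lerD K2 K1) _.
  by rewrite -mulrDl; lra.
exact: K (H1 s ltac:(lra)) (H2 s ltac:(lra)).
Qed.

(** The set where [P] holds is open and closed in the connected interval. The statement is about
    propositions, to serve both for kernels of derivatives and for membership in a structure. *)
Lemma locally_constant (P : R -> Prop) (a b : R) :
  (forall t0, a < t0 < b -> exists2 d : R, 0 < d &
     forall t, a < t < b -> `|t - t0| < d -> (P t <-> P t0)) ->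
  forall t1 t2, a < t1 < b -> a < t2 < b -> P t1 -> P t2.
Proof.
move=> H t1 t2 t1ab t2ab Pt1.
have cI : connected `]a, b[%classic.
  by apply/connected_intervalP => x y /= xI yI z xyz; move: xI yI; rewrite /= !in_itv /=; lra.
have loc (Q : R -> Prop) : (forall t0, a < t0 < b -> exists2 d : R, 0 < d &
     forall t, a < t < b -> `|t - t0| < d -> (Q t <-> Q t0)) ->
   open [set t | a < t < b /\ Q t].
  move=> HQ; rewrite openE => t /= [tab Qt].
  have [d d0 Hd] := HQ t tab; apply/nbhs_normP.
  exists (Num.min d (Num.min (t - a) (b - t))) => /=.
    by rewrite !lt_min d0; lra.
  move=> s /=; rewrite !lt_min => /and3P[sd s1 s2].
  have sab : a < s < b.
    by move: s1 s2; rewrite !ltr_norml; lra.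
  by split => //; apply/(Hd s sab) => //; rewrite distrC.
have : [set t | a < t < b /\ P t] = `]a, b[%classic.
  apply: cI.
  - by exists t1.
  - exists [set t | a < t < b /\ P t]; first exact: loc.
    by apply/seteqP; split => t /=; rewrite in_itv /= => -[].
  - exists (~` [set t | a < t < b /\ ~ P t]).
      apply: open_closedC; apply: loc => t0 t0ab.
      have [d d0 Hd] := H t0 t0ab; exists d => // t tab td.
      by have := Hd t tab td; tauto.
    apply/seteqP; split => t /=; rewrite in_itv /=.
      by move=> [tab Pt]; split=> // -[_]; apply.
    by move=> [tab nt]; split=> //; apply: contrapT => nP; apply: nt.
by move=> /seteqP[_ /(_ t2)] /=; rewrite in_itv /= => /(_ t2ab) [].
Qed.

Lemma is_derive0_constant (f : R -> R) (a b s t : R) :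
  (forall u, a < u < b -> is_derive u (1 : R) f 0) ->
  a < s < b -> a < t < b -> f s = f t.
Proof.
move=> df; wlog st : s t / s <= t => [W sab tab|sab tab].
  by have [/W|/ltW/W] := leP s t; [exact|move=> ->].
have D (u : R) : s <= u <= t -> is_derive u (1 : R) f 0 by move=> ut; apply: df; lra.
have D' (u : R) : s <= u <= t -> is_derive u (1 : R) (fun x => - f x) 0.
  by move=> /D H; apply: is_derive_ext (is_deriveN H) _ _ => //; rewrite oppr0.
have := is_derive_ndecr st D (fun _ _ => lexx 0).
have := is_derive_ndecr st D' (fun _ _ => lexx 0).
lra.
Qed.

Lemma is_derive_bigsum (I : finType) (f : I -> R -> R) (f' : I -> R) (t : R) :
  (forall i, is_derive t (1 : R) (f i) (f' i)) ->
  is_derive t (1 : R) (fun s => \sum_i f i s) (\sum_i f' i).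
Proof.
move=> H; elim: (index_enum I) => [|i r IH].
  apply: is_derive_ext (is_derive_cst 0 t 1) _ _ => [s|]; by rewrite big_nil.
apply: is_derive_ext (is_deriveD (H i) IH) _ _ => [s|]; by rewrite big_cons.
Qed.

Lemma derivable_bigsum (I : finType) (f : I -> R -> R) (t : R) :
  (forall i, derivable (f i) t 1) -> derivable (fun s => \sum_i f i s) t 1.
Proof.
by move=> H; have [] := is_derive_bigsum (fun i => derivableP (H i)).
Qed.

Lemma derivable_mul (f g : R -> R) (t : R) :
  derivable f t 1 -> derivable g t 1 -> derivable (fun s => f s * g s) t 1.
Proof. exact: derivableM. Qed.

Lemma derivable_bigprod (I : finType) (f : I -> R -> R) (t : R) :
  (forall i, derivable (f i) t 1) -> derivable (fun s => \prod_i f i s) t 1.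
Proof.
move=> H; elim: (index_enum I) => [|i r IH].
  by under eq_fun do rewrite big_nil; exact: derivable_cst.
by under eq_fun do rewrite big_cons; exact: derivable_mul.
Qed.

Lemma is_derive_mulmx m n p (A : R -> 'M[R]_(m, n)) (B : R -> 'M[R]_(n, p)) A' B' (t : R) :
  is_derive t (1 : R) A A' -> is_derive t (1 : R) B B' ->
  is_derive t (1 : R) (fun s => A s *m B s) (A' *m B t + A t *m B').
Proof.
move=> /is_derive_mxP dA /is_derive_mxP dB; apply/is_derive_mxP => i j.
have H : is_derive t (1 : R) (fun s => \sum_k A s i k * B s k j)
   (\sum_k (A t i k * B' k j + B t k j * A' i k)).
  by apply: is_derive_bigsum => k; exact: is_deriveM (dA i k) (dB k j).
apply: is_derive_ext H _ _ => [s|]; first by rewrite mxE.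
rewrite !mxE -big_split /=; apply: eq_bigr => k _.
by rewrite addrC [B t k j * _]mulrC.
Qed.

Lemma is_derive_trmx m n (A : R -> 'M[R]_(m, n)) A' (t : R) :
  is_derive t (1 : R) A A' -> is_derive t (1 : R) (fun s => (A s)^T) A'^T.
Proof.
move=> /is_derive_mxP dA; apply/is_derive_mxP => i j.
by apply: is_derive_ext (dA j i) _ _ => [s|]; rewrite mxE.
Qed.

Lemma derivable_det n (A : R -> 'M[R]_n) (t : R) :
  (forall i j, derivable (fun s => A s i j) t 1) -> derivable (fun s => \det (A s)) t 1.
Proof.
move=> dA; rewrite /determinant.
apply: derivable_bigsum => s; apply: derivable_mul; first exact: derivable_cst.
exact: derivable_bigprod.
Qed.

(** Cramer's formula shows that the inverse is derivable; the value then follows by differentiating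
    [A A^-1 = 1]. *)
Lemma is_derive_invmx n (A : R -> 'M[R]_n) A' (t : R) :
  is_derive t (1 : R) A A' -> A t \in unitmx ->
  is_derive t (1 : R) (fun s => invmx (A s)) (- (invmx (A t) *m A' *m invmx (A t))).
Proof.
move=> dA uA; have dA' := dA; have /is_derive_mxP dAij := dA'.
have cdet : derivable (fun s => \det (A s)) t 1.
  by apply: derivable_det => i j; case: (dAij i j).
have cc : {for t, continuous (fun s => \det (A s))}.
  by apply/differentiable_continuous/derivable1_diffP.
have det0 : \det (A t) != 0 by move: uA; rewrite unitmxE unitfE.
have nU : \forall s \near t, A s \in unitmx.
  near=> s; rewrite unitmxE unitfE; near: s.
  exact: (cvgr_neq0 _ cc det0).
have dI : derivable (fun s => invmx (A s)) t 1.
  apply: (@near_eq_derivable _ _ _ (fun s => (\det (A s))^-1 *: \adj (A s))).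
    by apply: filterS nU => s us; rewrite /invmx us.
  apply/derivable_mxP => i j.
  under eq_fun do rewrite mxE.
  apply: derivable_mul; first exact: derivableV.
  under eq_fun do rewrite mxE; rewrite /cofactor.
  apply: derivable_mul; first exact: derivable_cst.
  apply: derivable_det => i' j'; under eq_fun do rewrite !mxE.
  by case: (dAij (lift j i') (lift i j')).
have H := is_derive_mulmx dA (derivableP dI).
have H1 : is_derive t (1 : R) (fun s => A s *m invmx (A s)) 0.
  apply: near_eq_is_derive (is_derive_cst (1%:M : 'M[R]_n) t 1).
  by apply: filterS nU => s us; rewrite mulmxV.
have E : A' *m invmx (A t) + A t *m 'D_1 (fun s => invmx (A s)) t = 0.
  by have [_ <-] := H; have [_ ->] := H1.
split=> //; move/eqP: E.
rewrite addrC addr_eq0 => /eqP E.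
by rewrite -[LHS](mulKmx uA) E mulmxN mulmxA.
Unshelve. all: by end_near. Qed.

End calculus.

(** * Charts and frames *)

Section charts.
Context {R : realType}.

Lemma mul_jacobian n m (f : 'rV[R]_n -> 'rV[R]_m) p v : v *m jacobian f p = 'd f p v.
Proof. by rewrite /jacobian mul_rV_lin1. Qed.

Lemma mx_eq_mulr m n (A B : 'M[R]_(m, n)) : (forall v : 'rV[R]_m, v *m A = v *m B) -> A = B.
Proof. by move=> H; apply/row_matrixP => i; rewrite !rowE H. Qed.

Lemma jacobian_comp n m k (f : 'rV[R]_n -> 'rV[R]_m) (g : 'rV[R]_m -> 'rV[R]_k) p :
  differentiable f p -> differentiable g (f p) ->
  jacobian (g \o f) p = jacobian f p *m jacobian g (f p).
Proof.
move=> df dg; apply: mx_eq_mulr => v.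
by rewrite mulmxA !mul_jacobian (diff_comp df dg).
Qed.

Lemma near_jacobian n m (f g : 'rV[R]_n -> 'rV[R]_m) p :
  (\near p, f p = g p) -> differentiable f p -> jacobian g p = jacobian f p.
Proof.
move=> fg df; apply: mx_eq_mulr => v.
apply: etrans (mul_jacobian g p v) (etrans _ (esym (mul_jacobian f p v))).
exact: (congr1 (@^~ v) (near_diff fg df)).
Qed.

Lemma jacobian_id n (p : 'rV[R]_n) : jacobian id p = 1%:M.
Proof.
apply: mx_eq_mulr => v; rewrite mul_jacobian mulmx1.
exact: (congr1 (@^~ v) (@diff_val _ _ _ _ _ _ _ (is_diff_id p))).
Qed.

Context n (M : smoothManifold R n).
Implicit Types (c : chart R n M) (x : M).

Lemma open_chart_dom c (U : set M) : open U -> open (chart_dom c U).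
Proof.
move=> oU; rewrite openE => y [yt yU].
have H1 : \forall z \near y, chart_tgt c z by exact: open_near (@chart_tgt_open _ _ _ c) yt.
have H2 : \forall z \near y, U (chart_inv c z).
  by apply: (@chart_inv_cont _ _ _ c y yt); exact: open_nbhs_nbhs.
exact: filterI H1 H2.
Qed.

Lemma chart_domP c (U : set M) x : chart_src c x -> U x -> chart_dom c U (c x).
Proof. by move=> xc Ux; split; [exact: chart_fun_tgt|rewrite /= chart_funK]. Qed.

Lemma chart_dom_src c (U : set M) y : chart_dom c U y ->
  chart_src c (chart_inv c y) /\ U (chart_inv c y).
Proof. by move=> [yt yU]; split => //; exact: chart_inv_src. Qed.

Lemma transition_diff c c' x : atlas c -> atlas c' -> chart_src c x -> chart_src c' x ->
  differentiable (c' \o chart_inv c) (c x).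
Proof.
move=> ac ac' xc xc'; have [+ _] := atlas_compat ac ac' 1.
by apply; exact: chart_domP.
Qed.

Lemma chart_change_comp c c' c'' x : atlas c -> atlas c' -> atlas c'' ->
  chart_src c x -> chart_src c' x -> chart_src c'' x ->
  chart_change c c' x *m chart_change c' c'' x = chart_change c c'' x.
Proof.
move=> ac ac' ac'' xc xc' xc''; rewrite /chart_change.
have d1 := transition_diff ac ac' xc xc'.
have d2 := transition_diff ac' ac'' xc' xc''.
have E : (c' \o chart_inv c) (c x) = c' x by rewrite /= chart_funK.
rewrite -E in d2 *; apply: etrans (esym (jacobian_comp d1 d2)) _.
apply/esym/near_jacobian; last exact: differentiable_comp.
refine (open_nearS (open_chart_dom (@chart_src_open _ _ _ c')) (chart_domP xc xc') _).
by move=> y /chart_dom_src [_ H] /=; rewrite chart_funK.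
Qed.

Lemma chart_changexx c x : atlas c -> chart_src c x -> chart_change c c x = 1%:M.
Proof.
move=> ac xc; rewrite /chart_change -(jacobian_id (c x)).
apply: near_jacobian; last by case: (is_diff_id (c x)).
apply: (open_nearS (@chart_tgt_open _ _ _ c) (chart_fun_tgt xc)) => y yt /=.
by rewrite chart_invK.
Qed.

Lemma chart_changeK c c' x : atlas c -> atlas c' -> chart_src c x -> chart_src c' x ->
  chart_change c c' x *m chart_change c' c x = 1%:M.
Proof. by move=> ac ac' xc xc'; rewrite chart_change_comp // chart_changexx. Qed.

Lemma vf_coordE (X : vector_field M) c x : chart_src c x ->
  vf_coord X c (c x) = (X x : 'rV[R]_n) *m chart_change (chart_at x) c x.
Proof. by move=> xc; rewrite /vf_coord /= chart_funK. Qed.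

Lemma vf_coord_at (X : vector_field M) x :
  vf_coord X (chart_at x) (chart_at x x) = X x.
Proof.
rewrite vf_coordE; last exact: chart_at_src.
by rewrite chart_changexx ?mulmx1 //; [exact: chart_at_atlas|exact: chart_at_src].
Qed.

(** [s] refers to charts that vary with the point and need not be continuous as a matrix-valued map;
    its components in the one chart [c] can be differentiated. *)
Definition frame_coord (s : M -> 'M[R]_n) c (y : 'rV[R]_n) : 'M[R]_n :=
  s (chart_inv c y) *m chart_change (chart_at (chart_inv c y)) c (chart_inv c y).

Lemma row_frame_coord s c i y :
  row i (frame_coord s c y) = vf_coord (fun x => row i (s x) : tangent x) c y.
Proof. by rewrite /frame_coord row_mul. Qed.

Lemma frame_coordE s c x : chart_src c x ->
  frame_coord s c (c x) = s x *m chart_change (chart_at x) c x.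
Proof. by move=> xc; rewrite /frame_coord /= chart_funK. Qed.

Lemma frame_coord_at s x : frame_coord s (chart_at x) (chart_at x x) = s x.
Proof.
rewrite frame_coordE; last exact: chart_at_src.
by rewrite chart_changexx ?mulmx1 //; [exact: chart_at_atlas|exact: chart_at_src].
Qed.

Definition frame_bracket (X : vector_field M) (s : M -> 'M[R]_n) x : 'M[R]_n :=
  \matrix_i (lie_bracket X (fun x => row i (s x) : tangent x) x : 'rV[R]_n).

(* Along any curve through [x] with velocity [X x], the coordinates of the frame
   field [s] in the chart [chart_at x] have this derivative. *)
Definition frame_deriv (X : vector_field M) (s : M -> 'M[R]_n) x : 'M[R]_n :=
  frame_bracket X s x + s x *m jacobian (vf_coord X (chart_at x)) (chart_at x x).

Lemma row_frame_deriv X s x i : row i (frame_deriv X s x) =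
  'd (vf_coord (fun x => row i (s x) : tangent x) (chart_at x)) (chart_at x x) (X x).
Proof.
rewrite /frame_deriv raddfD /= /frame_bracket rowK row_mul mul_jacobian.
by rewrite /lie_bracket subrK.
Qed.

Lemma is_derive_frame (X : vector_field M) (s : M -> 'M[R]_n) (U : set M) x
    (c : R -> 'rV[R]_n) (t : R) :
  open U -> U x -> smooth_frame U s -> c t = chart_at x x ->
  is_derive t (1 : R) c (X x : 'rV[R]_n) ->
  is_derive t (1 : R) (fun r => frame_coord s (chart_at x) (c r)) (frame_deriv X s x).
Proof.
move=> oU Ux ss ct dc; apply/is_derive_mxP => i j.
have ac := chart_at_atlas x; have xc := chart_at_src x.
have [+ _] := ss i (chart_at x) ac 1; move=> /(_ (c t)); rewrite ct => /(_ (chart_domP xc Ux)).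
rewrite -ct => df.
have /is_derive_mxP H := is_derive_chain dc df.
apply: is_derive_ext (H 0 j) _ _ => [r|].
  by rewrite -row_frame_coord mxE.
by rewrite ct -row_frame_deriv mxE.
Qed.

End charts.

Lemma continuous_pair (S T1 T2 : topologicalType) (f : S -> T1) (g : S -> T2) x :
  {for x, continuous f} -> {for x, continuous g} ->
  {for x, continuous (fun s => (f s, g s))}.
Proof. by move=> cf cg; exact: cvg_pair cf cg. Qed.

Lemma continuous_fst (S T : topologicalType) : continuous (@fst S T).
Proof. by move=> x; exact: cvg_fst. Qed.

Lemma continuous_snd (S T : topologicalType) : continuous (@snd S T).
Proof. by move=> x; exact: cvg_snd. Qed.

Lemma near_open_comp (S T : topologicalType) (f : S -> T) x (V : set T) :
  {for x, continuous f} -> open V -> V (f x) -> \forall y \near x, V (f y).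
Proof. by move=> cf oV Vx; apply: cf; exact: open_nbhs_nbhs. Qed.

Lemma open_itv (R : realType) (a b : R) : open [set r | a < r < b].
Proof.
have -> : [set r | a < r < b] = `]a, b[%classic.
  by apply/seteqP; split => u /=; rewrite in_itv.
exact: interval_open.
Qed.

Lemma near_itv (R : realType) (a b t : R) : a < t < b -> \forall s \near t, a < s < b.
Proof.
move=> /andP[at_ tb]; near=> s; apply/andP; split; near: s.
  exact: lt_nbhsr.
exact: lt_nbhsl.
Unshelve. all: by end_near. Qed.

Section flow_dom.
Context {R : realType} n (M : smoothManifold R n) (a b : R) (U : set M)
  (phi : R -> M -> M).

Definition flow_dom (c c' : chart R n M) : set (R * 'rV[R]_n) :=
  [set p | [/\ a < p.1 < b, chart_dom c U p.2 & chart_src c' (phi p.1 (chart_inv c p.2))]].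

(** Assumes continuity rather than [local_flow], because it also serves while a local flow is being
    constructed. *)
Lemma open_flow_dom_of c c' : open U ->
  (forall t x, a < t < b -> U x ->
    {for (t, x), continuous (fun p : R * M => phi p.1 p.2)}) ->
  open (flow_dom c c').
Proof.
move=> oU cphi; rewrite openE => -[t y] [/= tab yU yc].
have cy : {for (t, y), continuous (fun p : R * 'rV[R]_n => (p.1, chart_inv c p.2))}.
  apply: continuous_pair; first exact: continuous_fst.
  apply: (@continuous_comp _ _ _ snd (chart_inv c)); first exact: continuous_snd.
  by apply: chart_inv_cont; case: yU.
have [_ Uy] := chart_dom_src yU.
have cp := continuous_comp cy (cphi _ _ tab Uy).
have H1 : \forall p \near (t, y), chart_src c' (phi p.1 (chart_inv c p.2)).
  by apply: cp; apply: open_nbhs_nbhs; split => //; exact: chart_src_open.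
have H2 : \forall p \near (t, y), chart_dom c U p.2.
  have : {for (t, y), continuous (@snd R 'rV[R]_n)} by exact: continuous_snd.
  by apply; apply: open_nbhs_nbhs; split => //; exact/open_chart_dom.
have H3 : \forall p \near (t, y), a < p.1 < b.
  apply: (@near_open_comp _ _ fst (t, y) [set r | a < r < b]).
  - exact: continuous_fst.
  - exact: open_itv.
  - exact: tab.
by apply: filterS3 H3 H2 H1 => -[r z] /= *; split.
Qed.

End flow_dom.

(** * Flows on manifolds *)

Section flows.
Context {R : realType} n (M : smoothManifold R n) (X : vector_field M)
  (sX : smooth_vf [set: M] X) (a b : R) (U : set M) (phi : R -> M -> M)
  (F : local_flow X a b U phi).
Implicit Types (c : chart R n M) (x : M) (t : R).

Lemma flow_open : open U. Proof. by case: F. Qed.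

Lemma flow_joint_cont t x : a < t < b -> U x ->
  {for (t, x), continuous (fun p : R * M => phi p.1 p.2)}.
Proof. by case: F => _ _ _ _ [+ _]; apply. Qed.

Lemma flow_time_near t x (V : set M) : a < t < b -> U x -> open V -> V (phi t x) ->
  \forall s \near t, V (phi s x).
Proof.
move=> tab Ux oV Vt.
have c1 : {for t, continuous (fun s : R => (s, x))}.
  by apply: continuous_pair; [move=> ?|exact: cst_continuous].
have := continuous_comp c1 (flow_joint_cont tab Ux).
by apply; exact: open_nbhs_nbhs.
Qed.

(** [local_flow] states the equation in [chart_at (phi t x)], which changes with [t]; the transition
    map carries it to a fixed chart. *)
Lemma flow_coord_derive t x c : atlas c -> a < t < b -> U x -> chart_src c (phi t x) ->
  is_derive t (1 : R) (fun s => c (phi s x)) (vf_coord X c (c (phi t x))).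
Proof.
move=> ac tab Ux xc; set p := phi t x.
have ac1 := chart_at_atlas p; have pc1 := chart_at_src p.
have dF : is_derive t (1 : R) (fun s => chart_at p (phi s x)) (X p : 'rV[R]_n).
  by case: F => _ _ _ + _; apply.
have dT := transition_diff ac1 ac pc1 xc.
have := is_derive_chain dF dT.
have -> : 'd (c \o chart_inv (chart_at p)) (chart_at p p) (X p) = vf_coord X c (c p).
  rewrite vf_coordE //; exact: esym (mul_jacobian _ _ _).
apply: near_eq_is_derive.
apply: filterS (flow_time_near tab Ux (@chart_src_open _ _ _ (chart_at p)) pc1) => s H /=.
by rewrite chart_funK.
Qed.

Definition flow_coord c c' (p : R * 'rV[R]_n) : 'rV[R]_n := c' (phi p.1 (chart_inv c p.2)).

Lemma flow_coord_smooth c c' : atlas c -> atlas c' ->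
  smooth_on (flow_dom a b U phi c c') (flow_coord c c').
Proof. by case: F => _ _ _ _ [_]; exact. Qed.

Lemma open_flow_dom c c' : open (flow_dom a b U phi c c').
Proof. exact: open_flow_dom_of flow_open flow_joint_cont. Qed.

Section at_point.
Context (x : M) (Ux : U x) (c : chart R n M) (ac : atlas c) (xc : chart_src c x).

(** A counterpart of [tangent_map (phi t) x] in a target chart that does not move with [t], hence
    differentiable in time. *)
Definition flow_jac c' t : 'M[R]_n := jacobian (c' \o phi t \o chart_inv c) (c x).

Lemma flow_domI c' t : a < t < b -> chart_src c' (phi t x) -> flow_dom a b U phi c c' (t, c x).
Proof.
by move=> tab tc; split => //=; [exact: chart_domP|rewrite chart_funK].
Qed.

Lemma is_diff_pairl (t : R) (y : 'rV[R]_n) :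
  is_diff y (fun z : 'rV[R]_n => (t, z)) (fun z => (0, z)).
Proof. exact: is_diff_pair. Qed.

Lemma flow_slice_diff c' t : atlas c' -> a < t < b -> chart_src c' (phi t x) ->
  is_diff (c x) (c' \o phi t \o chart_inv c)
    (fun v => 'd (flow_coord c c') (t, c x) (0, v)).
Proof.
move=> ac' tab tc.
have [dPhi _] := flow_coord_smooth ac ac' 1.
have dP := dPhi _ (flow_domI tab tc).
exact: (is_diff_comp (is_diff_pairl t (c x)) (differentiableP dP)).
Qed.

Lemma mul_flow_jac c' t v : atlas c' -> a < t < b -> chart_src c' (phi t x) ->
  v *m flow_jac c' t = 'd (flow_coord c c') (t, c x) (0, v).
Proof.
move=> ac' tab tc; apply: etrans (mul_jacobian _ _ _) _.
exact: (congr1 (@^~ v) (@diff_val _ _ _ _ _ _ _ (flow_slice_diff ac' tab tc))).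
Qed.

Lemma flow_jac_change c' c'' t : atlas c' -> atlas c'' -> a < t < b ->
  chart_src c' (phi t x) -> chart_src c'' (phi t x) ->
  flow_jac c' t *m chart_change c' c'' (phi t x) = flow_jac c'' t.
Proof.
move=> ac' ac'' tab tc' tc''.
have [d1 _] := flow_slice_diff ac' tab tc'.
have d2 := transition_diff ac' ac'' tc' tc''.
rewrite /chart_change.
have E : (c' \o phi t \o chart_inv c) (c x) = c' (phi t x) by rewrite /= chart_funK.
rewrite -E in d2 *; apply: etrans (esym (jacobian_comp d1 d2)) _.
apply/esym/near_jacobian; last exact: differentiable_comp.
have c1 : {for c x, continuous (fun y : 'rV[R]_n => (t, y))}.
  by apply: continuous_pair; [exact: cst_continuous|move=> ?].
have N : \forall y \near c x, flow_dom a b U phi c c' (t, y).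
  apply: c1; apply: open_nbhs_nbhs; split; first exact: open_flow_dom.
  exact: flow_domI.
by apply: filterS N => y [_ _ /= H]; rewrite /= chart_funK.
Qed.

Lemma is_derive_pairl (y : 'rV[R]_n) t :
  is_derive t (1 : R) (fun s : R => (s, y)) ((1, 0) : R * 'rV[R]_n).
Proof.
have H : is_diff t (fun s : R => (s, y)) (fun s => (s, 0) : R * 'rV[R]_n).
  exact: is_diff_pair.
have [d1 _] := H.
split; first exact/derivable1_diffP.
rewrite deriveE //; exact: (congr1 (@^~ 1) (@diff_val _ _ _ _ _ _ _ H)).
Qed.

Lemma flow_coord_dt c' p : atlas c' -> flow_dom a b U phi c c' p ->
  'd (flow_coord c c') p (1, 0) = vf_coord X c' (flow_coord c c' p).
Proof.
case: p => t y ac' Dp; have [/= tab yU tc] := Dp.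
have [ysrc Uy] := chart_dom_src yU.
have dt := flow_coord_derive ac' tab Uy tc.
have [dPhi _] := flow_coord_smooth ac ac' 1.
have H := is_derive_chain (is_derive_pairl y t) (dPhi _ Dp).
by have [_ <-] := H; have [_ ->] := dt.
Qed.

(** By symmetry of second derivatives, the time derivative of the space derivative is the space
    derivative of the velocity, that is, of [X] composed with the flow. *)
Lemma flow_jac_derive c' t : atlas c' -> a < t < b -> chart_src c' (phi t x) ->
  is_derive t (1 : R) (flow_jac c')
    (flow_jac c' t *m jacobian (vf_coord X c') (c' (phi t x))).
Proof.
move=> ac' tab tc; set y := c x; set Phi := flow_coord c c'.
have Dp := flow_domI tab tc; have oD := @open_flow_dom c c'.
have sPhi := flow_coord_smooth ac ac'.
apply/is_derive_mxP => i j.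
pose v : 'rV[R]_n := delta_mx 0 i.
have [_ /(_ (0, v)) [dv _]] := sPhi 2.
have H := is_derive_chain (is_derive_pairl y t) (dv _ Dp).
have E : 'd (fun q => 'd Phi q (0, v)) (t, y) (1, 0) =
    v *m (flow_jac c' t *m jacobian (vf_coord X c') (c' (phi t x))).
  apply: etrans (@schwarz R (R * 'rV[R]_n)%type n _ Phi (t, y) (0, v) (1, 0) oD Dp (sPhi 2)) _.
  have [dPhi _] := sPhi 1.
  have PE : Phi (t, y) = c' (phi t x) by rewrite /Phi /flow_coord /= chart_funK.
  have dX : differentiable (vf_coord X c') (Phi (t, y)).
    have [+ _] := sX ac' 1; apply; rewrite PE; exact: chart_domP.
  have dXP := differentiable_comp (dPhi _ Dp) dX.
  have N : \forall q \near (t, y), (vf_coord X c' \o Phi) q = 'd Phi q (1, 0).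
    by apply: (open_nearS oD Dp) => q Dq; apply/esym; exact: flow_coord_dt.
  apply: etrans (congr1 (@^~ (0, v)) (near_diff N dXP)) _.
  apply: etrans (congr1 (@^~ (0, v)) (diff_comp (dPhi _ Dp) dX)) _.
  rewrite mulmxA (mul_flow_jac v ac' tab tc) -PE.
  exact: esym (mul_jacobian _ _ _).
have {}H : is_derive t (1 : R) (fun s => v *m flow_jac c' s)
    (v *m (flow_jac c' t *m jacobian (vf_coord X c') (c' (phi t x)))).
  rewrite -E; apply: near_eq_is_derive H.
  have Nab : \forall s \near t, a < s < b.
    exact: near_itv.
  apply: filterS2 Nab (flow_time_near tab Ux (@chart_src_open _ _ _ c') tc) => s sab sc.
  by rewrite (mul_flow_jac v ac' sab sc).
have /is_derive_mxP /(_ 0 j) H2 := H.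
by apply: is_derive_ext H2 _ _ => [s|]; rewrite -rowE mxE.
Qed.

End at_point.
End flows.

(** * Existence of local flows on a manifold *)

Section existence.
Context {R : realType} n (M : smoothManifold R n) (X : vector_field M)
  (sX : smooth_vf [set: M] X).

(** The flow of the coordinate expression of [X] in one chart around [p0], carried back to [M]. In
    other charts its smoothness and its equation follow by composing with transition maps. *)
Lemma exists_local_flow (p0 : M) : exists a b U phi,
  local_flow X a b U phi /\ U p0.
Proof.
set c := chart_at p0; have ac : atlas c := chart_at_atlas p0.
have sXc : smooth_on (chart_tgt c) (vf_coord X c).
  by move=> k; apply: Ck_sub (sX ac k) => y yt; split.
have [e [U0 [f [e0 oU0 U0p U0tgt [f0 fin fd fs]]]]] :=
  local_flow_rV (@chart_tgt_open _ _ _ c) sXc (chart_fun_tgt (chart_at_src p0)).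
pose phi t (x : M) := chart_inv c (f t (c x)).
pose U := [set x | chart_src c x /\ U0 (c x)].
have oU : open U.
  rewrite openE => x [xc Ux].
  have N : \forall y \near x, U0 (c y) := near_open_comp (@chart_fun_cont _ _ _ c x xc) oU0 Ux.
  have N' : \forall y \near x, chart_src c y.
    by apply: open_nbhs_nbhs; split => //; exact: chart_src_open.
  exact: filterI N' N.
have te (t : R) : (- e < t < e) -> `|t| < e by rewrite ltr_norml.
have cphi (t : R) (x : M) : - e < t < e -> U x ->
    {for (t, x), continuous (fun p : R * M => phi p.1 p.2)}.
  move=> /te et [xc Ux].
  have c1 : {for (t, x), continuous (fun p : R * M => (p.1, c p.2))}.
    apply: continuous_pair; first exact: continuous_fst.
    apply: (@continuous_comp _ _ _ snd c); first exact: continuous_snd.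
    exact: chart_fun_cont.
  have c2 : {for (t, c x), continuous (fun q : R * 'rV[R]_n => f q.1 q.2)}.
    exact: (fs 0%N).
  have c3 := @continuous_comp _ _ _ _ _ (t, x) c1 c2.
  apply: (@continuous_comp _ _ _ _ (chart_inv c) (t, x) c3).
  by apply: chart_inv_cont; exact: fin.
exists (- e), e, U, phi; split; last by split => //; exact: chart_at_src.
split => //.
- by rewrite oppr_lt0 e0.
- by move=> x [xc Ux]; rewrite /phi f0 // chart_funK.
- move=> t x /te et [xc Ux]; set q := phi t x.
  have ac1 := chart_at_atlas q; have qc1 := chart_at_src q.
  have qc : chart_src c q by apply: chart_inv_src; exact: fin.
  have cq : c q = f t (c x) by rewrite chart_invK //; exact: fin.
  have df := fd _ _ Ux et.
  have dT := transition_diff ac ac1 qc qc1.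
  rewrite cq in dT.
  have := is_derive_chain df dT.
  suff -> : 'd (chart_at q \o chart_inv c) (f t (c x)) (vf_coord X c (f t (c x))) = X q by [].
  rewrite -cq vf_coordE //; apply: etrans (esym (mul_jacobian _ _ _)) _.
  by rewrite -mulmxA chart_changeK // mulmx1.
split; first exact: cphi.
move=> c1 c2 ac1 ac2 k.
have oD : open (flow_dom (- e) e U phi c1 c2) by exact: open_flow_dom_of oU cphi.
have inD p : flow_dom (- e) e U phi c1 c2 p ->
    [/\ `|p.1| < e, chart_dom c1 (chart_src c) p.2,
        U0 (c (chart_inv c1 p.2)) &
        chart_src c2 (chart_inv c (f p.1 (c (chart_inv c1 p.2))))].
  by move=> [/te p1 [pt /= [pc pU]] p2]; split.
have C1 : Ck_on k (flow_dom (- e) e U phi c1 c2)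
    (fun p => (p.1, (c \o chart_inv c1) p.2)).
  apply: Ck_pair => //; first exact: Ck_fst.
  apply: (@Ck_comp _ _ _ _ k _ (chart_dom c1 (chart_src c)) snd (c \o chart_inv c1)).
  - exact: fin_coord_rV.
  - exact: oD.
  - by move=> p /inD [].
  - exact: Ck_snd.
  - exact: (atlas_compat ac1 ac k).
have C2 : Ck_on k (flow_dom (- e) e U phi c1 c2)
    (fun p => f p.1 (c (chart_inv c1 p.2))).
  apply: (@Ck_comp _ _ _ _ k _ _ _ (fun q => f q.1 q.2) _ oD _ C1 (fs k)).
    exact: fin_coord_prod fin_coord_real (fin_coord_rV n).
  by move=> p /inD [].
have C3 : Ck_on k (flow_dom (- e) e U phi c1 c2)
    ((c2 \o chart_inv c) \o (fun p => f p.1 (c (chart_inv c1 p.2)))).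
  apply: (@Ck_comp _ _ _ _ k _ _ _ _ (fin_coord_rV n) oD _ C2 (atlas_compat ac ac2 k)).
  by move=> p /inD [p1 p2 p3 p4]; split => //; exact: fin.
exact: C3.
Qed.

End existence.

Lemma mulmx_unit_eq0 (R : realType) m n (A : 'M[R]_(m, n)) (C : 'M[R]_n) :
  C \in unitmx -> A *m C = 0 -> A = 0.
Proof. by move=> uC H; rewrite -(mulmxK uC A) H mul0mx. Qed.

Lemma near_norm_le (R : realType) (V W : normedModType R) (f : V -> W) x (C : R) :
  {for x, continuous f} -> `|f x| < C -> \forall y \near x, `|f y| <= C.
Proof.
move=> cf fC; have e0 : 0 < C - `|f x| by rewrite subr_gt0.
move/cvgrPdist_le: cf => /(_ _ e0); apply: filterS => y.
have := ler_normB (f x) (f x - f y); rewrite opprB addrC subrK; lra.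
Qed.

Lemma gronwall_zero (R : realType) n (L : R) (f f' : R -> 'rV[R]_n) (a b s t : R) :
  0 <= L -> (forall u, a <= u <= b -> is_derive u (1 : R) f (f' u)) ->
  (forall u, a <= u <= b -> `|f' u| <= L * `|f u|) ->
  a <= s <= b -> a <= t <= b -> f s = 0 -> f t = 0.
Proof.
move=> L0 df H sab tab fs.
have [G G0 HG] := @gronwall R n L (b - a) L0.
have H0 u : a <= u <= b -> `|f' u| <= L * `|f u| + 0 by rewrite addr0; exact: H.
have := HG f f' 0 a b s t (lexx _) (lexx _) df H0 sab tab.
by rewrite fs normr0 addr0 mulr0 normr_le0 => /eqP.
Qed.

(** [C] plays the part of a change of chart: it disappears from the quotient of a transported frame
    by a frame field. *)
Lemma mulmx_cancel_unit (R : realType) m n (u : 'M[R]_(m, n)) (T C S : 'M[R]_n) :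
  S \in unitmx -> C \in unitmx ->
  u *m (T *m C) *m invmx (S *m C) = u *m T *m invmx S.
Proof.
move=> uS uC.
have E : C *m invmx (S *m C) = invmx S.
  by apply: (can_inj (mulKmx uS)); rewrite mulmxA !mulmxV // unitmx_mul uS.
by rewrite -!mulmxA E.
Qed.

(** * Derivatives of the flow maps and transported frames *)

Section flow_frames.
Context {R : realType} n (M : smoothManifold R n) (X : vector_field M)
  (sX : smooth_vf [set: M] X) (a b : R) (U : set M) (phi : R -> M -> M)
  (F : local_flow X a b U phi) (x : M) (Ux : U x).
Implicit Types (c : chart R n M) (t : R).

Let cx := chart_at x.

Lemma tangent_map_change t c : atlas c -> a < t < b -> chart_src c (phi t x) ->
  tangent_map (phi t) x *m chart_change (chart_at (phi t x)) c (phi t x) =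
  flow_jac phi x cx c t.
Proof.
move=> ac tab tc.
apply: (flow_jac_change F Ux (chart_at_atlas x) (chart_at_src x)
  (chart_at_atlas (phi t x)) ac tab (chart_at_src (phi t x)) tc).
Qed.

Lemma flow0 : a < (0 : R) < b. Proof. by case: F. Qed.

Lemma flow_id : phi 0 x = x. Proof. by case: F => _ _ + _ _; apply. Qed.

Lemma tangent_map0 : tangent_map (phi 0) x = 1%:M.
Proof.
rewrite /tangent_map flow_id -(jacobian_id (cx x)).
apply: near_jacobian; last by case: (is_diff_id (cx x)).
have [xc xs] := (chart_at_atlas x, chart_at_src x).
have D := chart_domP xs Ux.
apply: (open_nearS (open_chart_dom (flow_open F)) D) => y [yt yU] /=.
by case: F => _ _ H _ _; rewrite H // chart_invK.
Qed.

Lemma unitmx_chart_change c c' (y : M) : atlas c -> atlas c' ->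
  chart_src c y -> chart_src c' y -> chart_change c c' y \in unitmx.
Proof.
by move=> ac ac' yc yc'; case: (mulmx1_unit (chart_changeK ac ac' yc yc')) => + _; exact.
Qed.

(** In a fixed chart the image of [v] solves a linear equation, so by Gronwall's lemma it vanishes
    at [t] iff it does at [t0]; vanishing does not depend on the chart. *)
Lemma tangent_map_kernel_local t0 (v : 'rV[R]_n) : a < t0 < b -> exists2 d : R, 0 < d &
  forall t, a < t < b -> `|t - t0| < d ->
  (v *m tangent_map (phi t) x = 0 <-> v *m tangent_map (phi t0) x = 0).
Proof.
move=> t0ab; set p := phi t0 x; set c := chart_at p.
have ac : atlas c := chart_at_atlas p; have pc : chart_src c p := chart_at_src p.
have [_ CX] := sX ac 1.
have cc : {for t0, continuous (fun t => c (phi t x))}.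
  apply/differentiable_continuous/derivable1_diffP.
  by case: (flow_coord_derive F ac t0ab Ux pc).
have N1 := flow_time_near F t0ab Ux (@chart_src_open _ _ _ c) pc.
(* The coefficients of the linear equation are bounded near [t0] one basis vector at a time, their
   continuity being known along fixed vectors. *)
pose B (j : 'I_n) : R := `|'d (vf_coord X c) (c p) (delta_mx 0 j)| + 1.
have N2j (j : 'I_n) : \forall t \near t0,
    `|'d (vf_coord X c) (c (phi t x)) (delta_mx 0 j)| <= B j.
  have cj : {for t0, continuous (fun t => 'd (vf_coord X c) (c (phi t x)) (delta_mx 0 j))}.
    apply: (@continuous_comp _ _ _ _ (fun y => 'd (vf_coord X c) y (delta_mx 0 j)) t0 cc).
    by apply: CX; exact: chart_domP.
  by apply: (near_norm_le cj); rewrite /B ltrDl.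
have N2 := filter_forall (nbhs_filter t0) N2j.
have /nbhs_normP[d /= d0 Hd] : \forall t \near t0, [/\ a < t < b, chart_src c (phi t x) &
    forall j : 'I_n, `|'d (vf_coord X c) (c (phi t x)) (delta_mx 0 j)| <= B j].
  have N3 := near_itv t0ab.
  by apply: filterS3 N3 N1 N2 => t; split.
pose L := \sum_j B j.
have L0 : 0 <= L by apply: sumr_ge0 => j _; rewrite addr_ge0.
have tm0 t : a < t < b -> chart_src c (phi t x) ->
    (v *m tangent_map (phi t) x = 0 <-> v *m flow_jac phi x cx c t = 0).
  move=> tab tc; rewrite -(tangent_map_change ac tab tc) mulmxA; split=> [->|H].
    by rewrite mul0mx.
  have uC := unitmx_chart_change (chart_at_atlas (phi t x)) ac (chart_at_src (phi t x)) tc.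
  exact: mulmx_unit_eq0 uC H.
exists d; first exact: d0.
move=> t tab td.
have dt : `|t0 - t| < d by rewrite distrC.
have [_ tc _] := Hd t dt.
suff Hiff : v *m flow_jac phi x cx c t = 0 <-> v *m flow_jac phi x cx c t0 = 0.
  exact: iff_trans (tm0 t tab tc) (iff_trans Hiff (iff_sym (tm0 t0 t0ab pc))).
have near_d u : Num.min t t0 <= u <= Num.max t t0 -> `|t0 - u| < d.
  move: td; rewrite minEle maxEle !ltr_norml; case: ifPn => _; lra.
have D (u : R) : Num.min t t0 <= u <= Num.max t t0 ->
    is_derive u (1 : R) (fun u => v *m flow_jac phi x cx c u)
     (v *m flow_jac phi x cx c u *m jacobian (vf_coord X c) (c (phi u x))).
  move=> /near_d /Hd [uab uc _].
  have dj := flow_jac_derive sX F Ux (chart_at_atlas x) (chart_at_src x) ac uab uc.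
  apply: is_derive_ext (is_derive_mulmx (is_derive_cst v u 1) dj) _ _ => //.
  by rewrite mul0mx add0r mulmxA.
have D' (u : R) : Num.min t t0 <= u <= Num.max t t0 ->
    `|v *m flow_jac phi x cx c u *m jacobian (vf_coord X c) (c (phi u x))| <=
    L * `|v *m flow_jac phi x cx c u|.
  move=> /near_d /Hd [uab uc HB]; rewrite mul_jacobian.
  move: (v *m _) => w; rewrite diff_row mulr_suml.
  apply: le_trans (ler_norm_sum _ _ _) _; apply: ler_sum => j _.
  by rewrite normrZ mulrC; apply: ler_pM => //; exact: mx_norm_ge.
have mt : Num.min t t0 <= t <= Num.max t t0 by rewrite ge_min le_max !lexx.
have mt0 : Num.min t t0 <= t0 <= Num.max t t0 by rewrite ge_min le_max !lexx !orbT.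
split.
  exact: (gronwall_zero L0 D D' mt mt0).
exact: (gronwall_zero L0 D D' mt0 mt).
Qed.

(** A vector killed at time [t] is killed at time 0, where the derivative is the identity. *)
Lemma tangent_map_unit t : a < t < b -> tangent_map (phi t) x \in unitmx.
Proof.
move=> tab; rewrite -row_free_unit; apply/inj_row_free => v v0.
have := locally_constant (fun t0 => @tangent_map_kernel_local t0 v) tab flow0 v0.
by rewrite tangent_map0 mulmx1.
Qed.

Context (V : set M) (s : M -> 'M[R]_n) (oV : open V) (ss : smooth_frame V s)
  (us : forall y, V y -> s y \in unitmx).

(* The coordinates, in the frame [s], of a frame [u] at [x] carried along the
   flow; unlike the frames themselves they do not refer to a chart. *)
Definition frame_transport (u : 'M[R]_n) t : 'M[R]_n :=
  u *m tangent_map (phi t) x *m invmx (s (phi t x)).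

(** In a fixed chart the flow derivative satisfies [A' = A J] and the frame along the curve
    [S' = B + S J], with [B] the brackets; in [(u A S^-1)'] the terms in [J] cancel. *)
Lemma frame_transport_derive u t : a < t < b -> V (phi t x) ->
  is_derive t (1 : R) (frame_transport u)
    (- (frame_transport u t *m
       (frame_bracket X s (phi t x) *m invmx (s (phi t x))))).
Proof.
move=> tab Vt; set p := phi t x; set c := chart_at p.
have ac : atlas c := chart_at_atlas p; have pc : chart_src c p := chart_at_src p.
have dA := flow_jac_derive sX F Ux (chart_at_atlas x) (chart_at_src x) ac tab pc.
have dc := flow_coord_derive F ac tab Ux pc.
rewrite (_ : vf_coord X c (c (phi t x)) = X p) in dc; last exact: vf_coord_at.
have dS := is_derive_frame oV Vt ss (erefl (c p)) dc.
have sE : frame_coord s c (c (phi t x)) = s p by exact: frame_coord_at.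
have dI := is_derive_invmx dS.
rewrite sE in dI; have {}dI := dI (us Vt).
have duA := is_derive_mulmx (is_derive_cst u t 1) dA.
have dH := is_derive_mulmx duA dI.
have tmE : tangent_map (phi t) x = flow_jac phi x cx c t.
  by rewrite -(tangent_map_change ac tab pc) chart_changexx // mulmx1.
have alg (A J K : 'M[R]_n) : (0 *m A + u *m (A *m J)) *m invmx (s p) +
     u *m A *m - (invmx (s p) *m (K + s p *m J) *m invmx (s p)) =
     - (u *m A *m invmx (s p) *m (K *m invmx (s p))).
  rewrite mul0mx add0r mulmxN mulmxDr mulmxDl (mulmxA (invmx (s p)) (s p)).
  rewrite mulVmx ?us // mul1mx.
  by rewrite mulmxDr !mulmxA opprD addrCA subrr addr0.
have dH' : is_derive t (1 : R)
    (fun r => u *m flow_jac phi x cx c r *m invmx (frame_coord s c (c (phi r x))))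
    (- (frame_transport u t *m (frame_bracket X s p *m invmx (s p)))).
  apply: is_derive_ext dH _ _ => [r|]; first by [].
  rewrite /frame_transport tmE sE; exact: alg.
(* Near [t] both factors may be read in the fixed chart [c], since its chart change cancels. *)
apply: near_eq_is_derive dH'.
have N2 := flow_time_near F tab Ux oV Vt.
have N3 := flow_time_near F tab Ux (@chart_src_open _ _ _ c) pc.
apply: filterS3 (near_itv tab) N2 N3 => r rab Vr rc.
rewrite /frame_transport -(tangent_map_change ac rab rc) frame_coordE //.
apply: mulmx_cancel_unit (us Vr) _.
exact: unitmx_chart_change (chart_at_atlas _) ac (chart_at_src _) rc.
Qed.

End flow_frames.

(** * The group GN and its Lie algebra *)

Section algebra.
Context {R : realType}.

Lemma bform_delta n (G : 'M[R]_n) i j : bform G (delta_mx 0 i) (delta_mx 0 j) = G i j.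
Proof. by rewrite /bform -rowE trmx_delta -colE !mxE. Qed.

Lemma bform_inj n (A B : 'M[R]_n) : (forall v w, bform A v w = bform B v w) -> A = B.
Proof. by move=> H; apply/matrixP => i j; rewrite -!bform_delta H. Qed.

Lemma bform_mulmx n (G u : 'M[R]_n) v w :
  bform G (v *m u) (w *m u) = bform (u *m G *m u^T) v w.
Proof. by rewrite /bform trmx_mul !mulmxA. Qed.

Lemma bformN n (G : 'M[R]_n) v w : bform (- G) v w = - bform G v w.
Proof. by rewrite /bform mulmxN mulNmx mxE. Qed.

Lemma bformZl n (G : 'M[R]_n) (a : R) v w : bform G (a *: v) w = a * bform G v w.
Proof. by rewrite /bform -!scalemxAl mxE. Qed.

Context (d : nat).
Implicit Types (f K : 'M[R]_d.+2) (v w z : 'rV[R]_d.+2).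

(** [eta_mx] is the permutation matrix of this transposition, which exchanges [k] and [l]. *)
Definition swap01 (j : 'I_d.+2) : 'I_d.+2 :=
  if j == 0 then 1 else if j == 1 then 0 else j.

Lemma swap01K : involutive swap01.
Proof.
move=> j; rewrite /swap01; case: (eqVneq j 0) => [->|j0] //=.
by case: (eqVneq j 1) => [->|j1] //=; rewrite (negPf j0) (negPf j1).
Qed.

Lemma eta_mxE i j : eta_mx R d i j = (i == swap01 j)%:R.
Proof.
by rewrite mxE /swap01; case: i j => [[|[|i]] Hi] [[|[|j]] Hj].
Qed.

Lemma mul_eta v j : (v *m eta_mx R d) 0 j = v 0 (swap01 j).
Proof.
rewrite mxE (bigD1 (swap01 j)) //= eta_mxE eqxx mulr1 big1 ?addr0 // => i ij.
by rewrite eta_mxE (negPf ij) mulr0.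
Qed.

Lemma swap01_eq1 j : (swap01 j == 1) = (j == 0).
Proof. by rewrite -[1]/(swap01 0) (inj_eq (inv_inj swap01K)). Qed.

Lemma kvec_eta j : (kvec R d *m eta_mx R d) 0 j = (j == 1)%:R.
Proof. by rewrite mul_eta mxE eqxx -[j in RHS]swap01K swap01_eq1. Qed.

Lemma kvec_line v : (forall j, j != 0 -> v 0 j = 0) -> v = v 0 0 *: kvec R d.
Proof.
move=> H; apply/rowP => j; rewrite !mxE /=.
by case: (eqVneq j 0) => [->|j0]; rewrite ?mulr1 // mulr0 H.
Qed.

Lemma kvec_lineP v (a : R) j : v = a *: kvec R d -> j != 0 -> v 0 j = 0.
Proof. by move=> -> j0; rewrite !mxE /= (negPf j0) mulr0. Qed.

(* The Lie algebra of [GN]. *)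
Definition gn K : Prop :=
  [/\ forall j, j != 0 -> K 0 j = 0,
      forall z, bform (K *m eta_mx R d + eta_mx R d *m K^T) (kvec R d) z = 0 &
      forall w w', kperp w -> kperp w' ->
        bform (K *m eta_mx R d + eta_mx R d *m K^T) w w' = 0].

Lemma kvec_mul K : kvec R d *m K = row 0 K.
Proof. by rewrite rowE. Qed.

(** The link between group and Lie algebra: along [H' = - H K] the pulled-back form changes by minus
    the form that occurs in [gn]. *)
Lemma is_derive_pull (H : R -> 'M[R]_d.+2) K (t : R) v w :
  is_derive t (1 : R) H (- (H t *m K)) ->
  is_derive t (1 : R) (fun s => eta (v *m H s) (w *m H s))
    (- bform (K *m eta_mx R d + eta_mx R d *m K^T) (v *m H t) (w *m H t)).
Proof.
move=> dH.
have dv := is_derive_mulmx (is_derive_cst v t 1) dH.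
have dw := is_derive_trmx (is_derive_mulmx (is_derive_cst w t 1) dH).
have dN := is_derive_mulmx (is_derive_mulmx dv (is_derive_cst (eta_mx R d) t 1)) dw.
have /is_derive_mxP /(_ 0 0) D := dN.
have alg (h e : 'M[R]_d.+2) : ((0 *m h + v *m - (h *m K)) *m e + v *m h *m 0) *m (w *m h)^T +
    v *m h *m e *m (0 *m h + w *m - (h *m K))^T =
    - (v *m h *m (K *m e + e *m K^T) *m (w *m h)^T).
  rewrite !mul0mx !add0r mulmx0 addr0 !mulmxN linearN /= !mulNmx mulmxN -opprD.
  by congr (- _); rewrite mulmxDr mulmxDl !trmx_mul !mulmxA.
apply: is_derive_ext D _ _ => [s|]; first by [].
by rewrite /= alg /bform mxE.
Qed.

(** [(H^-1)' = K H^-1]: the first row of [H^-1] is multiplied by the first row of [K] alone, hence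
    merely rescaled. *)
Lemma is_derive_row_inv (H : R -> 'M[R]_d.+2) K (t : R) :
  is_derive t (1 : R) H (- (H t *m K)) -> H t \in unitmx ->
  (forall j, j != 0 -> K 0 j = 0) ->
  forall j, is_derive t (1 : R) (fun s => invmx (H s) 0 j) (K 0 0 * invmx (H t) 0 j).
Proof.
move=> dH uH K0 j.
have /is_derive_mxP /(_ 0 j) D := is_derive_invmx dH uH.
apply: is_derive_ext D _ _ => [//|].
rewrite mulmxN mulNmx opprK mulmxA mulVmx // mul1mx mxE.
by rewrite (bigD1 0) //= big1 ?addr0 // => i i0; rewrite K0 // mul0r.
Qed.

(** As all entries of the first row of [H^-1] satisfy the same scalar equation, their ratios to a
    nonvanishing one, the [j]-th, are constant; so the row stays a multiple of [k] if it is one at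
    [s]. This gives the condition on the line of [k], and the two others follow in turn. *)
Lemma GN_interval (H K : R -> 'M[R]_d.+2) (a b s t : R) (j : 'I_d.+2) :
  (forall u, a < u < b -> is_derive u (1 : R) H (- (H u *m K u))) ->
  (forall u, a < u < b -> H u \in unitmx) ->
  (forall u, a < u < b -> gn (K u)) ->
  (forall u, a < u < b -> invmx (H u) 0 j != 0) ->
  a < s < b -> a < t < b -> GN (H s) -> GN (H t).
Proof.
move=> dH uH gK qj sab tab [_ [al Hs] Hww Hkz].
have al0 : al != 0.
  apply/eqP => al0; rewrite al0 scale0r in Hs.
  have := mulmx_unit_eq0 (uH s sab) Hs.
  by move=> /rowP /(_ 0); rewrite !mxE /= => /eqP; rewrite oner_eq0.
have qs i : i != 0 -> invmx (H s) 0 i = 0.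
  move=> i0; have E : kvec R d *m invmx (H s) = al^-1 *: kvec R d.
    apply: (can_inj (mulmxK (uH s sab))); rewrite mulmxKV ?uH //.
    by rewrite -scalemxAl Hs scalerA mulVf // scale1r.
  have := kvec_lineP E i0; by rewrite kvec_mul mxE.
have ratio i u : a < u < b ->
    invmx (H u) 0 i / invmx (H u) 0 j = invmx (H s) 0 i / invmx (H s) 0 j.
  move=> uab.
  apply: (@is_derive0_constant R (fun u => invmx (H u) 0 i / invmx (H u) 0 j) a b) => // r rab.
  have [K0 _ _] := gK r rab.
  have D i' := is_derive_row_inv (dH r rab) (uH r rab) K0 i'.
  have nz := qj r rab.
  have DV := @is_deriveV R (fun u => invmx (H u) 0 j) r _ 1 nz (D j).
  apply: is_derive_ext (is_deriveM (D i) DV) _ _ => [//|].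
  move: nz; rewrite /GRing.scale /=; move: (invmx (H r) 0 j) (invmx (H r) 0 i) => y z nz.
  by field.
have qu u i : a < u < b -> i != 0 -> invmx (H u) 0 i = 0.
  move=> uab i0; have := ratio i u uab; rewrite qs // mul0r => /eqP.
  by rewrite mulf_eq0 invr_eq0 (negPf (qj u uab)) orbF => /eqP.
have kH u : a < u < b -> exists2 be : R, be != 0 & kvec R d *m H u = be *: kvec R d.
  move=> uab; have E : kvec R d *m invmx (H u) = invmx (H u) 0 0 *: kvec R d.
    rewrite kvec_mul; have := @kvec_line (row 0 (invmx (H u))); rewrite mxE; apply => i i0.
    by rewrite mxE; exact: qu.
  have q0 : invmx (H u) 0 0 != 0.
    apply/eqP => q0; rewrite q0 scale0r in E.
    have uI : invmx (H u) \in unitmx by rewrite unitmx_inv uH.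
    have := mulmx_unit_eq0 uI E.
    by move=> /rowP /(_ 0); rewrite !mxE /= => /eqP; rewrite oner_eq0.
  exists (invmx (H u) 0 0)^-1; first by rewrite invr_eq0.
  have := congr1 (fun v => v *m H u) E; rewrite /= mulmxKV ?uH // -scalemxAl => E'.
  by rewrite [in RHS]E' scalerA mulVf // scale1r.
have etaZ (c : R) v w : eta (c *: v) w = c * eta v w by exact: bformZl.
have Nk z u : a < u < b -> eta (kvec R d *m H u) (z *m H u) = eta (kvec R d) z.
  move=> uab; rewrite -Hkz.
  apply: (@is_derive0_constant R (fun u => eta (kvec R d *m H u) (z *m H u)) a b) => // r rab.
  apply: is_derive_ext (is_derive_pull _ z (dH r rab)) _ _ => [//|].
  have [_ K1 _] := gK r rab; have [be _ ->] := kH r rab.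
  by rewrite bformZl K1 mulr0 oppr0.
(* The last condition of [gn] concerns [kperp] only, so [H] must first be seen to preserve it. *)
have pw w u : a < u < b -> kperp w -> kperp (w *m H u).
  move=> uab kw; have := Nk w u uab; have [be be0 ->] := kH u uab.
  rewrite kw etaZ => /eqP; rewrite mulf_eq0 (negPf be0) /= => /eqP.
  exact.
split.
- exact: uH.
- by have [be _ E] := kH t tab; exists be.
- move=> w w' kw kw'; rewrite -(Hww w w' kw kw').
  apply: (@is_derive0_constant R (fun u => eta (w *m H u) (w' *m H u)) a b) => // r rab.
  apply: is_derive_ext (is_derive_pull _ w' (dH r rab)) _ _ => [//|].
  have [_ _ K2] := gK r rab.
  by rewrite K2 ?oppr0 //; exact: pw.
- by move=> z; exact: Nk.
Qed.

(** Some entry of the first row of [H^-1] is nonzero at [t0] and, by continuity, nearby; there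
    [GN_interval] applies in both directions of time. *)
Lemma GN_locally_constant (H K : R -> 'M[R]_d.+2) (a b t0 : R) :
  (forall u, a < u < b -> is_derive u (1 : R) H (- (H u *m K u))) ->
  (forall u, a < u < b -> H u \in unitmx) ->
  (forall u, a < u < b -> gn (K u)) ->
  a < t0 < b ->
  exists2 e : R, 0 < e & forall t, `|t - t0| < e -> (GN (H t) <-> GN (H t0)).
Proof.
move=> dH uH gK t0ab.
have [j qj] : exists j, invmx (H t0) 0 j != 0.
  apply: contrapT => nq.
  have uI : invmx (H t0) \in unitmx by rewrite unitmx_inv uH.
  have E : kvec R d *m invmx (H t0) = 0.
    apply/rowP => j; rewrite kvec_mul !mxE; apply: contrapT => /eqP q0.
    by apply: nq; exists j.
  have := mulmx_unit_eq0 uI E.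
  by move=> /rowP /(_ 0); rewrite !mxE /= => /eqP; rewrite oner_eq0.
have [K0 _ _] := gK t0 t0ab.
have [dq _] := is_derive_row_inv (dH t0 t0ab) (uH t0 t0ab) K0 j.
have cq : {for t0, continuous (fun s => invmx (H s) 0 j)}.
  by apply/differentiable_continuous/derivable1_diffP.
have N1 : \forall s \near t0, invmx (H s) 0 j != 0 by exact: (cvgr_neq0 _ cq qj).
have N2 := near_itv t0ab.
have /nbhs_normP[e /= e0 He] : \forall s \near t0, a < s < b /\ invmx (H s) 0 j != 0.
  by apply: filterS2 N2 N1 => s; split.
have sub u : t0 - e < u < t0 + e -> a < u < b /\ invmx (H u) 0 j != 0.
  by move=> ue; apply: He; rewrite /= ltr_norml; lra.
exists e => // t te.
have tt : t0 - e < t < t0 + e by move: te; rewrite ltr_norml; lra.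
have tt0 : t0 - e < t0 < t0 + e by lra.
have main s r := @GN_interval H K (t0 - e) (t0 + e) s r j
  (fun u ue => dH u (proj1 (sub u ue))) (fun u ue => uH u (proj1 (sub u ue)))
  (fun u ue => gK u (proj1 (sub u ue))) (fun u ue => proj2 (sub u ue)).
by split; apply: main.
Qed.

End algebra.

Lemma congruence_cancel (R : realType) n (S G C J : 'M[R]_n) : C *m J = 1%:M ->
  (S *m C) *m (J *m G *m J^T) *m (S *m C)^T = S *m G *m S^T.
Proof.
move=> CJ; rewrite trmx_mul !mulmxA -(mulmxA S) CJ mulmx1 -(mulmxA _ J^T).
by rewrite -trmx_mul CJ trmx1 mulmx1.
Qed.

Lemma derive_near_cst (R : realType) (W : normedModType R) (f : R -> W) (t : R) c D :
  is_derive t (1 : R) f D -> (\forall s \near t, f s = c) -> D = 0.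
Proof.
by move=> dF N; have [_ <-] := near_eq_is_derive (g := cst c) N dF; exact: derive_cst.
Qed.

(** With [Y = a k S] at the point, subtracting [a] times the first row of the derivative of
    [S G S^T] from the derivative of [Y G S^T] removes the derivatives of the metric and of the
    right-hand factor. *)
Lemma congruence_deriv_cancel (R : realType) n (y k : 'rV[R]_n) (a : R)
    (D S G dg : 'M[R]_n) :
  (y - a *: (k *m D)) *m G *m S^T =
  (y *m G *m S^T + a *: (k *m S) *m dg *m S^T + a *: (k *m S) *m G *m D^T) -
  a *: (k *m (D *m G *m S^T + S *m dg *m S^T + S *m G *m D^T)).
Proof.
rewrite !mulmxBl !mulmxDr !scalerDr -!scalemxAl !mulmxA.
set v := a *: (k *m D *m _ *m _); set w := a *: (k *m S *m dg *m _).
by rewrite (opprD (v + w)) addrACA subrr addr0 opprD addrACA subrr addr0.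
Qed.

(** * GN-structures *)

Section GN_structures.
Context {R : realType} (d : nat) (M : smoothManifold R d.+2) (P : frame_set M)
  (hP : GN_structure P) (g : tensor02 M) (hg : lorentzian_metric g)
  (Q : frame_set M) (hQ : principal_subbundle (@Sim R d) Q)
  (QP : forall x, Q x `<=` P x)
  (Qg : forall x u v w, Q x u -> bform (g x) (v *m u) (w *m u) = eta v w)
  (X : vector_field M) (sX : smooth_vf [set: M] X).

Let lam := null_distribution P.

Definition adapted_section (V : set M) (s : M -> 'M[R]_d.+2) :=
  [/\ open V, smooth_frame V s & forall y, V y -> Q y (s y)].

Lemma exists_adapted_section (p : M) : exists V s, adapted_section V s /\ V p.
Proof.
have [_ _ _ /(_ p) [V [s [oV Vp ss Qs]]]] := hQ.
by exists V, s; split.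
Qed.

Section section.
Context (V : set M) (s : M -> 'M[R]_d.+2) (hs : adapted_section V s).
Implicit Types (p : M) (v w z : 'rV[R]_d.+2).

Lemma section_unit p : V p -> s p \in unitmx.
Proof. by case: hs => _ _ H /H Qp; have [H1 _ _ _] := hQ; exact: H1 Qp. Qed.

Lemma section_metric p : V p -> s p *m g p *m (s p)^T = eta_mx R d.
Proof.
case: hs => _ _ H /H Qp; apply: bform_inj => v w.
by rewrite -bform_mulmx; exact: Qg.
Qed.

(** As [Q] lies in [P], the section trivialises [P] as well. *)
Lemma section_GN p u : V p -> P p u <-> GN (u *m invmx (s p)).
Proof.
move=> Vp; have [_ _ H] := hs; have Ps := QP (H p Vp).
have [_ Pr Pt _] := hP; split=> [Pu|GNu].
  have [f Gf ->] := Pt _ _ _ Ps Pu.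
  by rewrite mulmxK // section_unit.
by have := Pr _ _ _ Ps GNu; rewrite mulmxKV // section_unit.
Qed.

Lemma section_null p v : V p -> @lam p v <-> exists a : R, v = a *: (kvec R d *m s p).
Proof.
move=> Vp; have [_ _ H] := hs; have Ps := QP (H p Vp); split=> [[u Pu [a ->]]|[a ->]].
  have [_ _ Pt _] := hP; have [f [_ [al kf] _ _] ->] := Pt _ _ _ Ps Pu.
  by exists (a * al); rewrite mulmxA -scalemxAl kf -!scalemxAl scalerA.
by exists (s p) => //; exists a; rewrite scalemxAl.
Qed.

Lemma section_orthogonal p w : V p ->
  @orthogonal R d.+2 M g lam p w <-> exists2 z, kperp z & w = z *m s p :> 'rV[R]_d.+2.
Proof.
move=> Vp.
have E v z : bform (g p) (v *m s p) (z *m s p) = eta v z.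
  by rewrite bform_mulmx section_metric.
split=> [ow|[z kz ->] v /(section_null _ Vp) [a ->]].
  exists (w *m invmx (s p)); last by rewrite mulmxKV // section_unit.
  rewrite /kperp /= -E mulmxKV ?section_unit //; apply: ow.
  by apply/(section_null _ Vp); exists 1; rewrite scale1r.
by rewrite bformZl E kz mulr0.
Qed.

(** The matrix [K] of the brackets [[X, s_i] = sum_j K_ij s_j]. *)
Definition structure_mx p := frame_bracket X s p *m invmx (s p).

Lemma tensor_coord_at p : tensor_coord g (chart_at p) (chart_at p p) = g p.
Proof.
have [ac pc] := (chart_at_atlas p, chart_at_src p).
by rewrite /tensor_coord /= chart_funK // chart_changexx // mul1mx trmx1 mulmx1.
Qed.

Lemma section_metric_coord c y : atlas c -> chart_dom c V y ->
  frame_coord s c y *m tensor_coord g c y *m (frame_coord s c y)^T = eta_mx R d.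
Proof.
move=> ac /chart_dom_src [yc Vy].
rewrite /frame_coord /tensor_coord /=; set x := chart_inv c y in yc Vy *.
have C1 := chart_changeK (chart_at_atlas x) ac (chart_at_src x) yc.
exact: etrans (congruence_cancel (s x) (g x) C1) (section_metric Vy).
Qed.

(** Along this line the differentials in [lie_derivative] and [lie_bracket] become derivatives of
    curves of matrices, to which the product rule [is_derive_mulmx] applies. *)
Let line p (r : R) : 'rV[R]_d.+2 := chart_at p p + r *: (X p : 'rV[R]_d.+2).

Lemma line0 p : line p 0 = chart_at p p.
Proof. by rewrite /line scale0r addr0. Qed.

Lemma is_derive_line0 p : is_derive (0 : R) (1 : R) (line p) (X p : 'rV[R]_d.+2).
Proof.
have D : is_derive (0 : R) (1 : R) (fun r => r *: (X p : 'rV[R]_d.+2)) (X p : 'rV[R]_d.+2).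
  split; first exact/derivable1_diffP.
  by rewrite deriveE // diff_val scale1r.
apply: is_derive_ext (is_deriveD (is_derive_cst (chart_at p p) (0 : R) (1 : R)) D) _ _ => //.
by rewrite add0r.
Qed.

Lemma near_line p (A : set 'rV[R]_d.+2) : open A -> A (chart_at p p) ->
  \forall r \near (0 : R), A (line p r).
Proof.
move=> oA Ap.
have cl : {for (0 : R), continuous (line p)}.
  apply/differentiable_continuous/derivable1_diffP.
  by case: (is_derive_line0 p).
by apply: cl; apply: open_nbhs_nbhs; rewrite line0.
Qed.

Lemma is_derive_tensor p : is_derive (0 : R) (1 : R)
  (fun r => tensor_coord g (chart_at p) (line p r))
  ('d (tensor_coord g (chart_at p)) (chart_at p p) (X p)).
Proof.
have [ac pc] := (chart_at_atlas p, chart_at_src p).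
have [sg _ _] := hg; have [+ _] := sg _ ac 1.
move=> /(_ _ (chart_domP pc (I : [set: M] p))) dg.
rewrite -line0 in dg *; exact: is_derive_chain (is_derive_line0 p) dg.
Qed.

Lemma is_derive_section p : V p -> is_derive (0 : R) (1 : R)
  (fun r => frame_coord s (chart_at p) (line p r)) (frame_deriv X s p).
Proof.
by case: hs => oV ss _ Vp; exact: is_derive_frame oV Vp ss (line0 p) (is_derive_line0 p).
Qed.

Lemma section_metric_deriv p : V p ->
  let dg := 'd (tensor_coord g (chart_at p)) (chart_at p p) (X p) in
  frame_deriv X s p *m g p *m (s p)^T + s p *m dg *m (s p)^T
    + s p *m g p *m (frame_deriv X s p)^T = 0.
Proof.
move=> Vp dg; have [ac pc] := (chart_at_atlas p, chart_at_src p).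
have [oV ss _] := hs.
have DS := is_derive_section Vp; have DT := is_derive_tensor p.
have := is_derive_mulmx (is_derive_mulmx DS DT) (is_derive_trmx DS).
rewrite line0 frame_coord_at tensor_coord_at mulmxDl -/dg => D.
have N : \forall r \near (0 : R), frame_coord s (chart_at p) (line p r) *m
    tensor_coord g (chart_at p) (line p r) *m (frame_coord s (chart_at p) (line p r))^T
    = eta_mx R d.
  have := near_line (open_chart_dom oV) (chart_domP pc Vp).
  by apply: filterS => r; exact: section_metric_coord.
exact: derive_near_cst D N.
Qed.

(** The differentiated relation [s g s^T = eta] eliminates the derivative of [g]; the jacobian of
    [X] in [frame_deriv] cancels against that of the Lie derivative, leaving the brackets. *)
Lemma section_lie_derivative p : V p ->
  s p *m lie_derivative X g p *m (s p)^T =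
  - (structure_mx p *m eta_mx R d + eta_mx R d *m (structure_mx p)^T).
Proof.
move=> Vp; have D := section_metric_deriv Vp; move: D => /=.
rewrite /lie_derivative /=; move: ('d (tensor_coord g (chart_at p)) (chart_at p p) (X p)) => dg.
rewrite /frame_deriv; move: (jacobian _ _) => J D.
rewrite -(section_metric Vp) /structure_mx.
have us := section_unit Vp.
have E1 (A : 'M[R]_d.+2) : A *m invmx (s p) *m (s p *m g p *m (s p)^T) = A *m g p *m (s p)^T.
  by rewrite !mulmxA mulmxKV.
have E2 (A : 'M[R]_d.+2) : s p *m g p *m (s p)^T *m (A *m invmx (s p))^T = s p *m g p *m A^T.
  by rewrite trmx_mul -!mulmxA (mulmxA (s p)^T) -trmx_mul mulVmx // trmx1 mul1mx.
rewrite E1 E2; move: (frame_bracket X s p) D => B; rewrite linearD /= trmx_mul => D.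
apply/eqP; rewrite -subr_eq0 opprK; apply/eqP; rewrite -[RHS]D.
rewrite !(mulmxDl, mulmxDr) !mulmxA.
have AC5 (a1 a2 a3 b1 b2 : 'M[R]_d.+2) :
    a1 + a2 + a3 + (b1 + b2) = b1 + a2 + a1 + (b2 + a3).
  by apply/matrixP => i j; rewrite !mxE; ring.
exact: AC5.
Qed.

Lemma bform_lie p v w : V p ->
  bform (lie_derivative X g p) (v *m s p) (w *m s p) =
  - bform (structure_mx p *m eta_mx R d + eta_mx R d *m (structure_mx p)^T) v w.
Proof. by move=> Vp; rewrite bform_mulmx section_lie_derivative // bformN. Qed.

Lemma nil_killing_section p : V p ->
  ((forall Y Z : tangent p, @lam p Y -> bform (lie_derivative X g p) Y Z = 0) /\
   (forall W W' : tangent p, orthogonal g lam W -> orthogonal g lam W' ->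
      bform (lie_derivative X g p) W W' = 0)) <->
  ((forall z, bform (structure_mx p *m eta_mx R d + eta_mx R d *m (structure_mx p)^T)
      (kvec R d) z = 0) /\
   (forall w w', kperp w -> kperp w' ->
      bform (structure_mx p *m eta_mx R d + eta_mx R d *m (structure_mx p)^T) w w' = 0)).
Proof.
move=> Vp; have us := section_unit Vp.
split=> [[H1 H2]|[H1 H2]]; split.
- move=> z; apply/eqP; rewrite -oppr_eq0 -bform_lie //; apply/eqP; apply: H1.
  by apply/(section_null _ Vp); exists 1; rewrite scale1r.
- move=> w w' kw kw'; apply/eqP; rewrite -oppr_eq0 -bform_lie //; apply/eqP; apply: H2.
    by apply/(section_orthogonal _ Vp); exists w.
  by apply/(section_orthogonal _ Vp); exists w'.
- move=> Y Z /(section_null _ Vp) [a ->].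
  by rewrite bformZl -[Z](mulmxKV us) bform_lie // H1 oppr0 mulr0.
- move=> W W' /(section_orthogonal _ Vp) [w kw ->] /(section_orthogonal _ Vp) [w' kw' ->].
  by rewrite bform_lie // H2 // oppr0.
Qed.

(** The hypothesis is applied to the first vector of [s], which spans [lam] on [V]. *)
Lemma bracket_section : bracket_preserves lam X ->
  forall p, V p -> forall j, j != 0 -> structure_mx p 0 j = 0.
Proof.
move=> H p Vp j j0; have [oV ss _] := hs.
have Hrow y : V y -> @lam y (row 0 (s y)).
  by move=> Vy; apply/(section_null _ Vy); exists 1; rewrite scale1r kvec_mul.
have /(section_null _ Vp) [a E] := H V _ oV (ss 0) Hrow p Vp.
have us := section_unit Vp.
have E' : row 0 (structure_mx p) = a *: kvec R d.
  rewrite row_mul rowK E -scalemxAl mulmxK //.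
by have := kvec_lineP E' j0; rewrite mxE.
Qed.

(* [Y] is orthogonal to all the vectors of [s] but the second; differentiating
   this and subtracting the analogous relation for the first vector of [s]
   avoids differentiating the ratio of [Y] to that vector. *)
Lemma section_bracket p (W : set M) (Y : vector_field M) : V p ->
  (forall j, j != 0 -> structure_mx p 0 j = 0) ->
  open W -> smooth_vf W Y -> (forall x, W x -> @lam x (Y x)) -> W p ->
  @lam p (lie_bracket X Y p).
Proof.
move=> Vp K0 oW sY lY Wp; have us := section_unit Vp.
have [ac pc] := (chart_at_atlas p, chart_at_src p).
have [oV ss _] := hs.
have [+ _] := sY _ ac 1; move=> /(_ _ (chart_domP pc Wp)) dY.
rewrite -line0 in dY; have DY := is_derive_chain (is_derive_line0 p) dY.
rewrite line0 in DY.
have DS := is_derive_section Vp; have DT := is_derive_tensor p.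
have := is_derive_mulmx (is_derive_mulmx DY DT) (is_derive_trmx DS).
rewrite line0 frame_coord_at tensor_coord_at mulmxDl vf_coord_at => D.
(* [k eta] has its only nonzero coordinate at index 1, and [Y] is pointwise a multiple of the first
   vector of [s]. *)
have N j : j != 1 -> \forall r \near (0 : R), (vf_coord Y (chart_at p) (line p r) *m
    tensor_coord g (chart_at p) (line p r) *m (frame_coord s (chart_at p) (line p r))^T) 0 j
    = 0.
  move=> j1.
  have N1 := near_line (open_chart_dom oV) (chart_domP pc Vp).
  have N2 := near_line (open_chart_dom oW) (chart_domP pc Wp).
  apply: filterS2 N1 N2 => r r1 r2.
  have [_ Vr] := chart_dom_src r1; have [_ Wr] := chart_dom_src r2.
  have := lY _ Wr => /(section_null _ Vr) [a Ea].
  have E : vf_coord Y (chart_at p) (line p r) =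
      a *: (kvec R d *m frame_coord s (chart_at p) (line p r)).
    by rewrite /vf_coord /= Ea /frame_coord mulmxA -scalemxAl.
  rewrite E -!scalemxAl.
  have -> : kvec R d *m frame_coord s (chart_at p) (line p r) *m
      tensor_coord g (chart_at p) (line p r) *m
      (frame_coord s (chart_at p) (line p r))^T = kvec R d *m eta_mx R d.
    by rewrite -(section_metric_coord ac r1) !mulmxA.
  by rewrite mxE kvec_eta (negPf j1) mulr0.
have := section_metric_deriv Vp => /=.
have /(section_null _ Vp) [a Ea] := lY p Wp.
have -> : lie_bracket X Y p = 'd (vf_coord Y (chart_at p)) (chart_at p p) (X p)
    - (Y p : 'rV[R]_d.+2) *m jacobian (vf_coord X (chart_at p)) (chart_at p p).
  by rewrite /lie_bracket /=; congr (_ - _); exact: esym (mul_jacobian _ _ _).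
move: D; rewrite Ea.
move: ('d (tensor_coord g (chart_at p)) (chart_at p p) (X p)) => dg.
move: ('d (vf_coord Y (chart_at p)) (chart_at p p) (X p)) => y.
rewrite /frame_deriv; move: (jacobian (vf_coord X (chart_at p)) (chart_at p p)) => J.
have SE : frame_bracket X s p = structure_mx p *m s p by rewrite mulmxKV.
rewrite SE; move: (structure_mx p) K0 => K K0.
set S := s p in us *; set dS := K *m S + S *m J; set G := g p => D E.
have z0 j : j != 1 -> ((y - a *: (kvec R d *m dS)) *m invmx S *m eta_mx R d) 0 j = 0.
  move=> j1.
  have /is_derive_mxP /(_ 0 j) Dj := D.
  have Dj0 := derive_near_cst Dj (N j j1).
  rewrite -(section_metric Vp) -/S -/G.
  have -> : (y - a *: (kvec R d *m dS)) *m invmx S *m (S *m G *m S^T) =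
      (y - a *: (kvec R d *m dS)) *m G *m S^T by rewrite !mulmxA mulmxKV.
  by rewrite (congruence_deriv_cancel _ _ _ _ _ _ dg) E mulmx0 scaler0 subr0 Dj0.
set v := (y - a *: (kvec R d *m dS)) *m invmx S in z0.
(* Multiplication by [eta] exchanges the coordinates 0 and 1: vanishing off 1 becomes vanishing off
   0. *)
have vk : v = v 0 0 *: kvec R d.
  apply: kvec_line => i i0; rewrite -[i]swap01K -mul_eta; apply: z0.
  by rewrite swap01_eq1.
have kK : kvec R d *m K = K 0 0 *: kvec R d.
  rewrite kvec_mul; have := @kvec_line _ _ (row 0 K); rewrite mxE; apply => j j0.
  by rewrite mxE K0.
apply/(section_null _ Vp); exists (v 0 0 + a * K 0 0); rewrite -/S.
have E1 : y - a *: (kvec R d *m dS) = v 0 0 *: (kvec R d *m S).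
  by rewrite [RHS]scalemxAl -vk mulmxKV.
(* Since [dS = K S + S J], the bracket splits into a part along [k S] by [E1] and the part
   [a k K S], along [k S] by [kK]. *)
have -> : y - a *: (kvec R d *m S) *m J =
    (y - a *: (kvec R d *m dS)) + a *: (kvec R d *m K *m S).
  rewrite /dS mulmxDr scalerDr !mulmxA -scalemxAl opprD addrA.
  by rewrite addrAC subrK.
by rewrite E1 kK -scalemxAl scalerA -scalerDl.
Qed.

End section.
End GN_structures.

(** * Both sides of the equivalence compared with [gn] *)

Section main.
Context {R : realType} (d : nat) (M : smoothManifold R d.+2) (P : frame_set M)
  (hP : GN_structure P) (g : tensor02 M) (hg : lorentzian_metric g)
  (Q : frame_set M) (hQ : principal_subbundle (@Sim R d) Q)
  (QP : forall x, Q x `<=` P x)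
  (Qg : forall x u v w, Q x u -> bform (g x) (v *m u) (w *m u) = eta v w)
  (X : vector_field M) (sX : smooth_vf [set: M] X).

Lemma algebra_preserving_nil_killing_gn :
  algebra_preserving_nil_killing g (null_distribution P) X <->
  forall V s, adapted_section Q V s -> forall p, V p -> gn (structure_mx X s p).
Proof.
split=> [[nk bp] V s hs p Vp|H].
  have [H1 H2] := (nil_killing_section hP hg hQ QP Qg X hs Vp).1 (nk p).
  split=> //; exact: (bracket_section hP hQ QP hs bp Vp).
split=> [p|W Y oW sY lY p Wp].
  have [V [s [hs Vp]]] := exists_adapted_section hQ p.
  apply/(nil_killing_section hP hg hQ QP Qg X hs Vp).
  by have [] := H V s hs p Vp.
have [V [s [hs Vp]]] := exists_adapted_section hQ p.
have [K0 _ _] := H V s hs p Vp.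
exact: (section_bracket hP hg hQ QP Qg hs Vp K0 oW sY lY Wp).
Qed.

Lemma automorphism_gn : infinitesimal_automorphism P X ->
  forall V s, adapted_section Q V s -> forall p, V p -> gn (structure_mx X s p).
Proof.
move=> H V s hs p Vp.
have [a [b [U [phi [F Up]]]]] := exists_local_flow sX p.
have ab0 := flow0 F.
have [oV ss Qs] := hs.
have us y (Vy : V y) : s y \in unitmx := section_unit hQ hs Vy.
have p0 : phi 0 p = p := flow_id F Up.
have Vp0 : V (phi 0 p) by rewrite p0.
(* Starting from the frame [s p] itself makes [T 0] the identity, so the derivative of [T] at 0 is
   [- K]; the conditions of [GN] on [T t] then differentiate to those of [gn] on [K]. *)
pose T := frame_transport phi p s (s p).
have T0 : T 0 = 1%:M.
  by rewrite /T /frame_transport p0 (tangent_map0 F Up) mulmx1 mulmxV // us.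
have dT : is_derive (0 : R) (1 : R) T (- (T 0 *m structure_mx X s p)).
  by have := frame_transport_derive sX F Up oV ss us (s p) ab0 Vp0; rewrite p0.
have N : \forall t \near (0 : R), GN (T t).
  apply: filterS2 (near_itv ab0) (flow_time_near F ab0 Up oV Vp0) => t tab Vt.
  apply/(section_GN hP hQ QP hs _ Vt).
  exact: (H a b U phi F t tab p (s p) Up (QP (Qs p Vp))).
have near0 (f : R -> R) D (c : R) : is_derive (0 : R) (1 : R) f (- D) ->
    (forall t, GN (T t) -> f t = c) -> D = 0.
  move=> df fc; have : - D = 0.
    by apply: (derive_near_cst df (c := c)); apply: filterS N => t; exact: fc.
  by move=> /eqP; rewrite oppr_eq0 => /eqP.
set K := structure_mx X s p in dT *.
split.
- move=> j j0; have /is_derive_mxP /(_ 0 j) := dT; rewrite T0 mul1mx mxE => D.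
  apply: (near0 _ _ 0 D) => t [_ [al Ht] _ _].
  by have := kvec_lineP Ht j0; rewrite kvec_mul mxE.
- move=> z; have := is_derive_pull (kvec R d) z dT; rewrite T0 !mulmx1 => D.
  by apply: (near0 _ _ (eta (kvec R d) z) D) => t [_ _ _]; exact.
- move=> w w' kw kw'; have := is_derive_pull w w' dT; rewrite T0 !mulmx1 => D.
  by apply: (near0 _ _ (eta w w') D) => t [_ _ + _]; exact.
Qed.

(** The integral curve may leave the domain of any one section; membership in [P] is shown to be
    locally constant in time, with a section around each point of the curve, and connectedness
    brings it back to time 0. *)
Lemma gn_automorphism :
  (forall V s, adapted_section Q V s -> forall p, V p -> gn (structure_mx X s p)) ->
  infinitesimal_automorphism P X.
Proof.
move=> H a b U phi F t tab x u Ux Pu.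
have ab0 := flow0 F.
pose S t := P (phi t x) (u *m tangent_map (phi t) x).
suff: S t by [].
have S0 : S 0 by rewrite /S (flow_id F Ux) (tangent_map0 F Ux) mulmx1.
apply: (@locally_constant R S a b _ 0 t ab0 tab S0) => t0 t0ab.
have [V [s [hs Vt0]]] := exists_adapted_section hQ (phi t0 x).
have [oV ss Qs] := hs.
have us y (Vy : V y) : s y \in unitmx := section_unit hQ hs Vy.
have uu : u \in unitmx by have [H1 _ _ _] := hP; exact: H1 Pu.
have /nbhs_normP[e /= e0 He] : \forall r \near t0, a < r < b /\ V (phi r x).
  by apply: filterS2 (near_itv t0ab) (flow_time_near F t0ab Ux oV Vt0) => r; split.
have sub (r : R) : t0 - e < r < t0 + e -> a < r < b /\ V (phi r x).
  by move=> re; apply: He; rewrite /= ltr_norml; lra.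
pose T := frame_transport phi x s u.
have ST (r : R) : t0 - e < r < t0 + e -> S r <-> GN (T r).
  by move=> /sub [_ Vr]; exact: (section_GN hP hQ QP hs _ Vr).
have dT (r : R) : t0 - e < r < t0 + e ->
    is_derive r (1 : R) T (- (T r *m structure_mx X s (phi r x))).
  by move=> /sub [rab Vr]; exact: (frame_transport_derive sX F Ux oV ss us u rab Vr).
have uT (r : R) : t0 - e < r < t0 + e -> T r \in unitmx.
  move=> /sub [rab Vr]; rewrite /T /frame_transport !unitmx_mul uu unitmx_inv us //.
  by rewrite (tangent_map_unit sX F Ux rab).
have gK (r : R) : t0 - e < r < t0 + e -> gn (structure_mx X s (phi r x)).
  by move=> /sub [_ Vr]; exact: (H V s hs _ Vr).
have tt0 : t0 - e < t0 < t0 + e by lra.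
have [e' e'0 He'] := GN_locally_constant dT uT gK tt0.
exists (Num.min e e') => [|r _]; first by rewrite lt_min e0.
rewrite lt_min => /andP[re re'].
have rr : t0 - e < r < t0 + e by move: re; rewrite ltr_norml; lra.
exact: iff_trans (ST r rr) (iff_trans (He' r re') (iff_sym (ST t0 tt0))).
Qed.

End main.

Theorem proposition6 (R : realType) (d : nat) (M : smoothManifold R d.+2)
  (P : frame_set M) (hP : GN_structure P)
  (g : tensor02 M) (hg : metric_belongs g P)
  (X : vector_field M) (hX : smooth_vf [set: M] X) :
  infinitesimal_automorphism P X <->
  algebra_preserving_nil_killing g (null_distribution P) X.
Proof.
have [lg [Q [hQ QP Qg]]] := hg.
apply: iff_trans (iff_sym (algebra_preserving_nil_killing_gn hP lg hQ QP Qg X)).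
split; first exact: (automorphism_gn hP hQ QP hX).
exact: (gn_automorphism hP hQ QP hX).
Qed.
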